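(* Let $d\geq 5$ and let $D_1,D_2\subseteq \partial C_{d+1}^*$ be the complexes defined below. Then $\partial (D_1\cup D_2)$ is a centrally symmetric simplicial complex (with $2d+2$ vertices, under the involution $x_j\leftrightarrow y_j$) whose geometric realization is homeomorphic to $\mathbb{S}^2\times \mathbb{S}^{d-3}$.
   Context: $\partial C_{n}^*$ is the boundary complex of the $n$-cross-polytope on vertices $\{x_1,\dots,x_n,y_1,\dots,y_n\}$, faces being subsets containing no pair $\{x_j,y_j\}$; $-F$ denotes the image of $F$ under $x_j\leftrightarrow y_j$. A complex is centrally symmetric if it has a free involution on vertices inducing a free involution on non-empty faces. For a combinatorial manifold with boundary, $\partial$ denotes the subcomplex of faces whose links are balls. Inside $\partial C_d^*$ (vertices $x_1,\dots,x_d,y_1,\dots,y_d$, indices cyclic: $x_{d+j}=x_j$, $y_{d+j}=y_j$), for $1\le j\le d-1$, $1\le k\le d$ put $\tau_j^k=(\{x_1,\dots,x_d\}\setminus\{x_k,\dots,x_{k+j-1}\})\cup\{y_k,\dots,y_{k+j-1}\}$; let $\Gamma_0$ be generated by $\{x_1,\dots,x_d\}$, $\Gamma_j$ ($1\le j\le d-1$) by $\tau_j^1,\dots,\tau_j^d$, and $\Gamma_d$ by $\{y_1,\dots,y_d\}$. $\Delta*\{v\}$ denotes the cone. If $d=2m+1$ is odd: $D_1=(\bigcup_{k=0}^{m+1}\Gamma_k)*\{x_{d+1}\}$ and $D_2=(\bigcup_{k=m}^{d}\Gamma_k)*\{y_{d+1}\}$. If $d=2m$ is even: let $\gamma=\bigcup_{i=1}^{m}\tau_{m-1}^i$,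 so that $-\gamma=\bigcup_{i=m}^{d-1}\tau_{m+1}^i$; then $D_1=\big((\bigcup_{k=0}^{m}\Gamma_k)\cup(-\gamma)\big)*\{x_{d+1}\}$ and $D_2=\big((\bigcup_{k=m}^{d}\Gamma_k)\cup\gamma\big)*\{y_{d+1}\}$. *)

(* Defs.v *)
From mathcomp Require Import all_boot all_order all_algebra.
From mathcomp Require Import all_classical all_reals all_analysis.

Set Implicit Arguments.
Unset Strict Implicit.
Unset Printing Implicit Defensive.

Import Order.TTheory GRing.Theory Num.Theory.
Import numFieldNormedType.Exports.

(* A simplicial complex with vertices in the finite type T is the set of its
   faces, the empty face included. *)
Section Complexes.
Variable T : finType.
Implicit Types (K : {set {set T}}) (F G : {set T}) (v : T) (s : T -> T).

Definition simplicial_complex K : Prop :=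
  finset.set0 \in K /\
  (forall F G : {set T}, G \in K -> F \subset G -> F \in K).

Definition vertices K : {set T} := [set v | [set v] \in K].

Definition link K F : {set {set T}} :=
  [set G : {set T} | [disjoint F & G] && (F :|: G \in K)].

(* The cone K * {v}, for v not a vertex of K. *)
Definition cone K v : {set {set T}} := K :|: [set v |: F | F in K].

Definition image_complex s K : {set {set T}} := [set s @: F | F : {set T} in K].

Definition centrally_symmetric_under s K : Prop :=
  [/\ {in vertices K, involutive s},
      {in vertices K, forall v, s v \in vertices K /\ s v <> v},
      {in K, forall F, s @: F \in K} &
      {in K, forall F, F <> finset.set0 -> s @: F <> F}].

End Complexes.

Section Topology.
Local Open Scope classical_set_scope.
Local Open Scope ring_scope.

Definition homeomorphic (X Y : topologicalType) (A : set X) (B : set Y) : Prop :=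
  exists (f : X -> Y) (g : Y -> X),
    [/\ {within A, continuous f} /\ {within B, continuous g},
        f @` A `<=` B, g @` B `<=` A,
        {in A, cancel f g} & {in B, cancel g f}].

Definition unit_ball (R : realType) (n : nat) : set 'rV[R]_n :=
  [set u | \sum_(i < n) u 0 i ^+ 2 <= 1].
#[global] Arguments unit_ball : clear implicits.

Definition unit_sphere (R : realType) (n : nat) : set 'rV[R]_n.+1 :=
  [set u | \sum_(i < n.+1) u 0 i ^+ 2 = 1].
#[global] Arguments unit_sphere : clear implicits.

(* Barycentric coordinates, with the topology of pointwise convergence on
   R^T (T is finite). *)
Definition realization (R : realType) (T : finType) (K : {set {set T}}) :
    set {ptws T -> R} :=
  [set p | [/\ forall v : T, 0 <= p v, \sum_(v : T) p v = 1 &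
               finset (fun v : T => p v != 0) \in K]].
#[global] Arguments realization R {T} K.

Definition topological_ball (R : realType) (T : finType) (K : {set {set T}}) : Prop :=
  exists n : nat, homeomorphic (realization R K) (unit_ball R n).

End Topology.

(* The empty face always belongs to the boundary, although its link, the whole
   complex, need not be a ball. *)
Definition boundary (R : realType) (T : finType) (K : {set {set T}}) :
    {set {set T}} :=
  [set F in K | (F == finset.set0) || `[< topological_ball R (link K F) >]].

(* Vertices of the n-cross-polytope: (i, false) is x_(i+1) and (i, true) is
   y_(i+1). *)
Definition cross_vertex (n : nat) : finType := ('I_n * bool)%type.

Definition antipode (n : nat) (v : cross_vertex n) : cross_vertex n :=
  (v.1, ~~ v.2).

Section Construction.
Variable d : nat.
Local Notation V := (cross_vertex d.+1).

(* x_j and y_j for j >= 1, with indices cyclic modulo d; the vertices x_(d+1)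
   and y_(d+1), which are not reached by these, are the apexes below. *)
Definition base_x (j : nat) : V := (inord (j.-1 %% d), false).
Definition base_y (j : nat) : V := (inord (j.-1 %% d), true).

Definition apex_x : V := (ord_max, false).
Definition apex_y : V := (ord_max, true).

Definition tau (j k : nat) : {set V} :=
  ([set base_x i.+1 | i : 'I_d] :\: [set base_x (k + i) | i : 'I_j])
    :|: [set base_y (k + i) | i : 'I_j].

(* For j = 0 (resp. j = d) every tau j k is {x_1, ..., x_d} (resp.
   {y_1, ..., y_d}). *)
Definition Gamma (j : nat) : {set {set V}} :=
  \bigcup_(1 <= k < d.+1) powerset (tau j k).

Definition gamma : {set {set V}} :=
  \bigcup_(1 <= i < (d./2).+1) powerset (tau (d./2).-1 i).

Definition D1 : {set {set V}} :=
  let m := d./2 in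
  if odd d then cone (\bigcup_(0 <= k < m.+2) Gamma k) apex_x
  else cone ((\bigcup_(0 <= k < m.+1) Gamma k)
               :|: image_complex (@antipode d.+1) gamma) apex_x.

Definition D2 : {set {set V}} :=
  let m := d./2 in
  if odd d then cone (\bigcup_(m <= k < d.+1) Gamma k) apex_y
  else cone ((\bigcup_(m <= k < d.+1) Gamma k) :|: gamma) apex_y.

End Construction.

(* Main.v *)
Require Import Defs.
From mathcomp Require Import all_boot all_order all_algebra.
From mathcomp Require Import all_classical all_reals all_analysis.
From mathcomp Require Import ring lra zify.
Import Order.TTheory GRing.Theory Num.Theory.
Import numFieldNormedType.Exports.

(* Passing to cones turns the complexes into unions of orthants: a face of
   D1 u D2 is a partial sign vector, and its facets are the sign vectors in a
   set S described by the cyclic arcs of {1, ..., d} (taken negative) together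
   with the sign of the apex.  A face F is on the boundary iff it extends both
   to a sign vector in S and to one outside S: arcs form a convex geometry, so
   the facets around F can be peeled off one by one, each along a proper set of
   coordinates, until one orthant (a ball) remains; in the other case the link
   is a cross-polytope of dimension at most 1, which is not a ball.

   The cone of the boundary is therefore X u -X, where X is the half with
   nonnegative apex coordinate.  Flipping the remaining orthants one after the
   other projects X onto the set H of vectors z of R^d having, after a reordering
   and a change of signs of the coordinates, at least two weak sign changes,
   whose frontier consists of the vectors with at most one.  The heat flow on a
   path of d vertices strictly diminishes sign changes, and so it crosses the
   frontier of H exactly once; in eigencoordinates (v, w), where v collects the
   two largest eigenvalues, a suitable multiple of it crosses |v| = |w| exactly
   once too.  Sliding along the orbits identifies H with {|v| <= |w|}, and two
   antipodal copies glue to {|v|^2 + s^2 = |w|^2}, the cone over S^2 x S^(d-3). *)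

Set Implicit Arguments.
Unset Strict Implicit.
Unset Printing Implicit Defensive.

Local Open Scope classical_set_scope.
Local Open Scope ring_scope.

(** * Continuity on a set *)

(** All homeomorphisms are explicit positively homogeneous maps between cones without origin. They
    compose without any renormalisation, and a realization is recovered at the end as a slice
    meeting every ray once. Both parities of d are treated at once: an arc that does not pass from
    the last position to the first has length at most h = [uphalf d], one that does has length at
    most d + 1 - h. For even d the longer arcs are those supplied by [gamma]. The facets common to
    the two cones form a ring of 2d sign vectors, neighbours differing in one coordinate. Listing
    the coordinates in the order in which the ring flips them, and changing half of the signs, makes
    these the vectors with at most one sign change; this is the origin of [crossing]. The obstacle
    is to match the union of these orthants, its frontier and the antipodal map with a round model
    all at the same time. A linear diagonal flow respects rays and the antipodal map, so it only has
    to cross each of the two frontiers once. Subtracting from the eigenvalues the midpoint of the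
    second and third rescales the flow by positive factors, and makes exactly two modes grow. *)

Definition cont_on (X Y : topologicalType) (A : set X) (F : X -> Y) : Prop :=
  forall x, A x -> F y @[y --> within A (nbhs x)] --> F x.

Section ContOn.
Variables (X Y Z : topologicalType).

Lemma cont_onE (A : set X) (F : X -> Y) : cont_on A F <-> {within A, continuous F}.
Proof. by split=> [h|/subspace_continuousP//]; apply/subspace_continuousP. Qed.

Lemma cont_on_comp (A : set X) (B : set Y) (F : X -> Y) (G : Y -> Z) :
  (forall x, A x -> B (F x)) -> cont_on A F -> cont_on B G -> cont_on A (G \o F).
Proof.
move=> AB cF cG x Ax; apply: cvg_trans (cG _ (AB _ Ax)) => P /= HP.
have := cF _ Ax _ HP; rewrite /nbhs/= /within /= => H.
near=> z => Az /=.
have : A z -> B (F z) -> P (G (F z)) by near: z.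
by apply => //; exact: AB.
Unshelve. all: by end_near. Qed.

Lemma cont_on_eq (A : set X) (F G : X -> Y) :
  (forall x, A x -> F x = G x) -> cont_on A F -> cont_on A G.
Proof.
move=> FG cF x Ax; rewrite -(FG _ Ax); apply: cvg_trans (cF _ Ax).
apply: near_eq_cvg; rewrite /prop_near1 /nbhs/= /within /=.
by near=> z => Az; rewrite FG.
Unshelve. all: by end_near. Qed.

Lemma cont_on_sub (A B : set X) (F : X -> Y) :
  (forall x, A x -> B x) -> cont_on B F -> cont_on A F.
Proof.
move=> AB cF x Ax P HP; have := cF _ (AB _ Ax) P HP.
rewrite /nbhs/= /within /= => H; near=> z => /AB; near: z; exact: H.
Unshelve. all: by end_near. Qed.

Lemma cont_on_setT (A : set X) (F : X -> Y) : continuous F -> cont_on A F.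
Proof. by move=> cF x Ax; apply: cvg_within_filter; exact: cF. Qed.

Lemma cont_on_id (A : set X) : cont_on A (fun x => x).
Proof. by move=> x Ax; apply: cvg_within_filter; exact: cvg_id. Qed.

(** Serves for maps that are given by different formulas near different points, such as a flow time
    that depends on exit times only where these exist. *)
Lemma cont_on_local (A : set X) (F : X -> Y) :
  (forall x, A x -> exists U, [/\ open U, U x & cont_on (A `&` U) F]) -> cont_on A F.
Proof.
move=> h x Ax; have [U [oU Ux cF]] := h _ Ax.
move=> P HP; have := cF x (conj Ax Ux) P HP.
rewrite /nbhs/= /within /= => H.
have nU : nbhs x U by exact: open_nbhs_nbhs.
near=> z => Az.
have : (A `&` U) z -> P (F z) by near: z.
by apply; split => //; near: z.
Unshelve. all: by end_near. Qed.

End ContOn.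

Section ContReal.
Variables (R : realType) (X : topologicalType) (A : set X).
Implicit Types f g : X -> R.

Lemma cont_on_cst (Y : topologicalType) (c : Y) : cont_on A (fun=> c).
Proof. by move=> x _; exact: cvg_cst. Qed.

Lemma cont_onD f g : cont_on A f -> cont_on A g -> cont_on A (fun x => f x + g x).
Proof. by move=> hf hg x Ax; apply: cvgD; [exact: hf|exact: hg]. Qed.

Lemma cont_onM f g : cont_on A f -> cont_on A g -> cont_on A (fun x => f x * g x).
Proof. by move=> hf hg x Ax; apply: cvgM; [exact: hf|exact: hg]. Qed.

Lemma cont_onN f : cont_on A f -> cont_on A (fun x => - f x).
Proof. by move=> hf x Ax; apply: cvgN; exact: hf. Qed.

Lemma cont_onB f g : cont_on A f -> cont_on A g -> cont_on A (fun x => f x - g x).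
Proof. by move=> hf hg; apply: cont_onD => //; exact: cont_onN. Qed.

Lemma cont_onV f : (forall x, A x -> f x != 0) -> cont_on A f ->
  cont_on A (fun x => (f x)^-1).
Proof. by move=> h0 hf x Ax; apply: cvgV; [exact: h0|exact: hf]. Qed.

Lemma cont_on_abs f : cont_on A f -> cont_on A (fun x => `|f x|).
Proof. by move=> hf x Ax; apply: cvg_norm; exact: hf. Qed.

Lemma cont_on_min f g : cont_on A f -> cont_on A g ->
  cont_on A (fun x => Num.min (f x) (g x)).
Proof.
move=> hf hg.
apply: (@cont_on_eq _ _ _ (fun x => (f x + g x - `|f x - g x|) * 2^-1)).
  move=> x _; have [h|h] := leP (f x) (g x).
    by rewrite ler0_norm ?subr_le0//; lra.
  by rewrite ger0_norm ?subr_ge0 ?ltW//; lra.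
apply: cont_onM; last exact: cont_on_cst.
by apply: cont_onB; [exact: cont_onD|apply: cont_on_abs; exact: cont_onB].
Qed.

Lemma cont_on_max f g : cont_on A f -> cont_on A g ->
  cont_on A (fun x => Num.max (f x) (g x)).
Proof.
move=> hf hg; apply: (@cont_on_eq _ _ _ (fun x => - Num.min (- f x) (- g x))).
  by move=> x _; rewrite -oppr_max opprK.
by apply: cont_onN; apply: cont_on_min; exact: cont_onN.
Qed.

Lemma cont_on_sum (I : Type) (r : seq I) (P : pred I) (f : I -> X -> R) :
  (forall i, P i -> cont_on A (f i)) -> cont_on A (fun x => \sum_(i <- r | P i) f i x).
Proof.
move=> h; elim: r => [|i r IH].
  by apply: (cont_on_eq _ (@cont_on_cst _ 0)) => x _; rewrite big_nil.
have [Pi|nPi] := boolP (P i).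
  apply: (cont_on_eq _ (cont_onD (h i Pi) IH)) => x _; by rewrite big_cons Pi.
by apply: (cont_on_eq _ IH) => x _; rewrite big_cons (negbTE nPi).
Qed.

Lemma cont_on_bigmin (I : Type) (r : seq I) (P : pred I) (f : I -> X -> R) (g : X -> R) :
  (forall i, P i -> cont_on A (f i)) -> cont_on A g ->
  cont_on A (fun x => \big[Num.min/g x]_(i <- r | P i) f i x).
Proof.
move=> h hg; elim: r => [|i r IH].
  by apply: (cont_on_eq _ hg) => x _; rewrite big_nil.
have [Pi|nPi] := boolP (P i).
  apply: (cont_on_eq _ (cont_on_min (h i Pi) IH)) => x _; by rewrite big_cons Pi.
by apply: (cont_on_eq _ IH) => x _; rewrite big_cons (negbTE nPi).
Qed.

Lemma cont_on_comp_real f (g : R -> R) : continuous g -> cont_on A f ->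
  cont_on A (fun x => g (f x)).
Proof.
move=> cg hf; apply: (@cont_on_comp _ _ _ _ setT f g) => //.
exact: cont_on_setT.
Qed.

Lemma cont_on_sqrt f : cont_on A f -> cont_on A (fun x => Num.sqrt (f x)).
Proof. by apply: cont_on_comp_real; exact: sqrt_continuous. Qed.

Lemma cont_on_ptws (J : finType) (F : X -> {ptws J -> R}) :
  (forall j, cont_on A (fun x => F x j)) -> cont_on A F.
Proof.
move=> h x Ax; apply/cvg_sup => j.
apply/cvg_image; first by rewrite eqEsubset; split=> // y _; exists (fun=> y).
move=> P HP; have H := h j x Ax P HP.
exists ((fun f : {ptws J -> R} => f j) @^-1` P) => //.
rewrite eqEsubset; split=> [y [f Pf <-]//|y Py].
by exists (fun=> y).
Qed.

Lemma cont_on_mx m n (F : X -> 'M[R]_(m, n)) :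
  (forall i j, cont_on A (fun x => F x i j)) -> cont_on A F.
Proof.
move=> h x Ax P /= [Q HQ sQ].
have H : \forall y \near within A (nbhs x), forall i j, Q i j (F y i j).
  by apply: filter_forall => i; apply: filter_forall => j; exact: (h i j x Ax _ (HQ i j)).
have := H; rewrite /nbhs/= /within /= => H'.
near=> y => Ay; apply: sQ => i j.
have : A y -> forall i j, Q i j (F y i j) by near: y.
by move=> /(_ Ay); apply.
Unshelve. all: by end_near.
Qed.

End ContReal.

Section ContProj.
Variables (R : realType).

Lemma cont_on_proj (J : finType) (A : set {ptws J -> R}) j : cont_on A (fun p => p j).
Proof.
apply: cont_on_setT; exact: (@proj_continuous J (fun=> R) j).
Qed.

Lemma cont_on_mxproj m n (A : set 'M[R]_(m, n)) i j : cont_on A (fun p => p i j).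
Proof. apply: cont_on_setT => x; exact: coord_continuous. Qed.

Lemma cont_on_pair (X Y Z : topologicalType) (A : set X) (F : X -> Y) (G : X -> Z) :
  cont_on A F -> cont_on A G -> cont_on A (fun x => (F x, G x)).
Proof. by move=> hF hG x Ax; apply: cvg_pair; [exact: hF|exact: hG]. Qed.

Lemma cont_on_fst (Y Z : topologicalType) (A : set (Y * Z)) : cont_on A (@fst Y Z).
Proof. apply: cont_on_setT => x; exact: cvg_fst. Qed.

Lemma cont_on_snd (Y Z : topologicalType) (A : set (Y * Z)) : cont_on A (@snd Y Z).
Proof. apply: cont_on_setT => x; exact: cvg_snd. Qed.
End ContProj.

(** * Cones over complexes *)

Section Conic.
Variable R : realType.
Local Notation rf I := {ptws I -> R}.

Definition scale (I : finType) (k : R) (x : rf I) : rf I := fun i => k * x i.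
Definition opp (I : finType) (x : rf I) : rf I := fun i => - x i.
Definition conic (I : finType) (A : set (rf I)) : Prop :=
  forall k x, 0 < k -> A x -> A (scale k x).

Lemma scaleA (I : finType) (a b : R) (x : rf I) : scale a (scale b x) = scale (a * b) x.
Proof. by apply/funext => i; rewrite /scale mulrA. Qed.
Lemma scale1 (I : finType) (x : rf I) : scale 1 x = x.
Proof. by apply/funext => i; rewrite /scale mul1r. Qed.
Lemma scaleV (I : finType) (k : R) (x : rf I) : 0 < k -> scale k^-1 (scale k x) = x.
Proof. by move=> k0; rewrite scaleA mulVf ?scale1// gt_eqF. Qed.
Lemma oppK (I : finType) (x : rf I) : opp (opp x) = x.
Proof. by apply/funext => i; rewrite /opp opprK. Qed.
Lemma oppZ (I : finType) k (x : rf I) : opp (scale k x) = scale k (opp x).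
Proof. by apply/funext => i; rewrite /opp /scale mulrN. Qed.

Lemma cont_on_opp (I : finType) (A : set (rf I)) : cont_on A (@opp I).
Proof. by apply: cont_on_ptws => i; apply: cont_onN; exact: cont_on_proj. Qed.

(** Homogeneity is asked of [F] only; when [A] is conic it passes to [G] by [conic_isoZ]. It lets
    the map descend to rays, hence to realizations. *)
Definition conic_iso (I J : finType) (A : set (rf I)) (B : set (rf J))
    (F : rf I -> rf J) (G : rf J -> rf I) : Prop :=
  [/\ cont_on A F /\ cont_on B G, forall x, A x -> B (F x) /\ G (F x) = x,
      forall y, B y -> A (G y) /\ F (G y) = y &
      forall k x, 0 < k -> A x -> F (scale k x) = scale k (F x)].

Lemma conic_isoZ (I J : finType) (A : set (rf I)) (B : set (rf J)) F G k y :
  conic A -> conic_iso A B F G -> 0 < k -> B y -> G (scale k y) = scale k (G y).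
Proof.
move=> cA [_ hF hG hZ] k0 By; have [AG FG] := hG _ By.
by rewrite -{1}FG -hZ// (hF _ _).2//; exact: cA.
Qed.

Lemma conic_iso_sym (I J : finType) (A : set (rf I)) (B : set (rf J)) F G :
  conic A -> conic_iso A B F G -> conic_iso B A G F.
Proof.
move=> cA h; have [[cF cG] hF hG hZ] := h; split=> // k y k0 By.
exact: (conic_isoZ cA h).
Qed.

Lemma conic_iso_trans (I J L : finType) (A : set (rf I)) (B : set (rf J)) (C : set (rf L))
   F G F' G' :
  conic_iso A B F G -> conic_iso B C F' G' -> conic_iso A C (F' \o F) (G \o G').
Proof.
move=> [[cF cG] hF hG hZ] [[cF' cG'] hF' hG' hZ']; split.
- split; first by apply: cont_on_comp cF cF' => x /hF[].
  by apply: cont_on_comp cG' cG => x /hG'[].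
- move=> x Ax; have [Bx Gx] := hF _ Ax; have [Cx Gx'] := hF' _ Bx.
  by split=> //=; rewrite Gx'.
- move=> y Cy; have [By Fy] := hG' _ Cy; have [Ay Fy'] := hG _ By.
  by split=> //=; rewrite Fy'.
- by move=> k x k0 Ax /=; rewrite hZ// hZ'//; case: (hF _ Ax).
Qed.

Lemma conic_iso_id (I : finType) (A : set (rf I)) : conic_iso A A id id.
Proof. by split=> //; split; exact: cont_on_id. Qed.

Definition conic_homeo (I J : finType) (A : set (rf I)) (B : set (rf J)) : Prop :=
  exists F G, conic_iso A B F G.

Lemma conic_homeo_trans (I J L : finType) (A : set (rf I)) (B : set (rf J)) (C : set (rf L)) :
  conic_homeo A B -> conic_homeo B C -> conic_homeo A C.
Proof.
move=> [F [G h]] [F' [G' h']]; exists (F' \o F), (G \o G'); exact: conic_iso_trans h h'.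
Qed.

Section Realization.
Variable T : finType.
Implicit Types (K : {set {set T}}) (p : rf T).

Definition supp p : {set T} := finset (fun v => p v != 0).

(** The origin is left out, so that every ray meets the realization, the slice [mass p = 1], exactly
    once. *)
Definition cone_over K : set (rf T) :=
  [set p | [/\ forall v, 0 <= p v, exists v, p v != 0 & supp p \in K]].

Lemma suppZ k p : 0 < k -> supp (scale k p) = supp p.
Proof. by move=> k0; apply/setP => v; rewrite !inE mulf_eq0 gt_eqF. Qed.

Lemma conic_cone_over K : conic (cone_over K).
Proof.
move=> k p k0 [p0 [v pv] pK]; split=> [w||]; first by rewrite mulr_ge0// ltW.
  by exists v; rewrite mulf_neq0// gt_eqF.
by rewrite suppZ.
Qed.

Definition mass p : R := \sum_v p v.

Lemma mass_gt0 K p : cone_over K p -> 0 < mass p.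
Proof.
move=> [p0 [v pv] _]; rewrite /mass (bigD1 v)//= ltr_pwDl//.
  by rewrite lt_neqAle eq_sym pv p0.
exact: sumr_ge0.
Qed.

Lemma massZ k p : mass (scale k p) = k * mass p.
Proof. by rewrite /mass mulr_sumr. Qed.

Lemma realizationE K p : realization R K p <-> cone_over K p /\ mass p = 1.
Proof.
split=> [[p0 p1 pK]|[[p0 _ pK] p1]]; split=> //.
split=> //; apply/not_existsP => h; suff : mass p = 0 by rewrite /mass p1 => /eqP; rewrite oner_eq0.
by apply: big1 => v _; have /negP := h v; rewrite negbK => /eqP.
Qed.

Lemma cont_on_mass (A : set (rf T)) : cont_on A mass.
Proof. by apply: cont_on_sum => i _; exact: cont_on_proj. Qed.

(** [B] is another conic model of the same space of rays and [C] a space of representatives: [a] is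
    constant on rays and [c] picks a point on each. The inverse rescales [G (c y)] to mass one, and
    homogeneity makes the scalings cancel. *)
Lemma realization_homeomorphic K (J : finType) (B : set (rf J)) (F : rf T -> rf J) G
    (Y : topologicalType) (C : set Y) (a : rf J -> Y) (c : Y -> rf J) :
  conic_iso (cone_over K) B F G ->
  cont_on B a -> cont_on C c ->
  (forall b, B b -> C (a b)) -> (forall y, C y -> B (c y) /\ a (c y) = y) ->
  (forall k b, 0 < k -> B b -> a (scale k b) = a b) ->
  (forall b, B b -> exists2 k, 0 < k & c (a b) = scale k b) ->
  homeomorphic (realization R K) C.
Proof.
move=> h ca cc BC CB aZ ac; have [[cF cG] hF hG hZ] := h.
have GZ k y := conic_isoZ (k := k) (y := y) (@conic_cone_over K) h.
have gC y : C y -> cone_over K (G (c y)) by move=> /CB[/hG[]].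
exists (a \o F), (fun y => scale (mass (G (c y)))^-1 (G (c y))); split.
- split; apply/cont_onE.
    apply: (@cont_on_comp _ _ _ _ B) => //.
      by move=> x /realizationE[/hF[]].
    by apply: cont_on_sub cF => x /realizationE[].
  apply: cont_on_ptws => v; rewrite /scale.
  have cGc : cont_on C (G \o c) by apply: cont_on_comp cc cG => y /CB[].
  apply: cont_onM.
    apply: cont_onV.
      by move=> x /gC/mass_gt0; rewrite lt_neqAle eq_sym => /andP[].
    exact: (@cont_on_comp _ _ _ _ setT _ mass) cGc (@cont_on_mass _).
  exact: (@cont_on_comp _ _ _ _ setT _ (fun p : rf T => p v)) cGc (@cont_on_proj _ _ _ v).
- by move=> _ [x /realizationE[/hF[Bx _] _] <-]; exact: BC.
- move=> _ [y Cy <-]; apply/realizationE; have := gC _ Cy => hy; have m0 := mass_gt0 hy.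
  split; first by apply: conic_cone_over; rewrite ?invr_gt0.
  by rewrite massZ mulVf// gt_eqF.
- move=> x; rewrite in_setE => /realizationE[Kx mx] /=.
  have [Bx Gx] := hF _ Kx; have [k k0 ->] := ac _ Bx.
  rewrite GZ// Gx massZ mx mulr1 scaleV//.
- move=> y; rewrite in_setE => Cy /=.
  have := gC _ Cy => hy; have m0 := mass_gt0 hy.
  have [By ay] := CB _ Cy; have [_ FGy] := hG _ By.
  by rewrite hZ ?invr_gt0// aZ ?invr_gt0// FGy// ay.
Qed.

End Realization.

(** * From barycentric to signed coordinates *)

Section Signed.
Variables (N0 N : finType) (g : N0 -> N) (gi : N -> N0).
Hypotheses (gK : cancel g gi) (giK : cancel gi g).

Definition sign_face (z : rf N) : {set N0 * bool} :=
  finset (fun v : N0 * bool => if v.2 then z (g v.1) < 0 else 0 < z (g v.1)).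

Definition signed_cone (K : {set {set N0 * bool}}) : set (rf N) :=
  [set z | (exists o, z o != 0) /\ sign_face z \in K].

(** Opposite vertices become the two half-lines of one coordinate axis; [g] and [gi] relabel the
    axes. *)
Definition to_signed (p : rf (N0 * bool)%type) : rf N :=
  fun o => p (gi o, false) - p (gi o, true).
Definition of_signed (z : rf N) : rf (N0 * bool)%type :=
  fun v => if v.2 then Num.max 0 (- z (g v.1)) else Num.max 0 (z (g v.1)).

Lemma of_signedK z : to_signed (of_signed z) = z.
Proof.
apply/funext => o; rewrite /to_signed /of_signed /= giK.
by have [h|h] := leP 0 (z o); have [h'|h'] := leP 0 (- z o); lra.
Qed.

Lemma supp_of_signed z : supp (of_signed z) = sign_face z.
Proof.
apply/setP => -[i b]; rewrite !inE /of_signed /=; case: b => /=.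
  by have [h|h] := leP 0 (- z (g i)); have [h'|h'] := ltP (z (g i)) 0; lra.
by have [h|h] := leP 0 (z (g i)); have [h'|h'] := ltP 0 (z (g i)); lra.
Qed.

(** No face contains both vertices of a pair, so at most one of their two coordinates is nonzero and
    the difference determines both, as its positive and negative parts. *)
Lemma cone_over_signed (K : {set {set N0 * bool}}) :
  (forall F i, F \in K -> (i, false) \in F -> (i, true) \in F -> False) ->
  conic_iso (cone_over K) (signed_cone K) to_signed of_signed.
Proof.
move=> hK.
have toK p : cone_over K p -> of_signed (to_signed p) = p.
  move=> [p0 _ pK]; apply/funext => -[i b].
  have := hK _ i pK; rewrite !inE => hi.
  have := p0 (i, false); have := p0 (i, true).
  rewrite /of_signed /to_signed /= gK.
  have [e|ne] := eqVneq (p (i, false)) 0.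
    by rewrite e; case: b => /= h1 h2;
      [rewrite max_r; lra|rewrite max_l; lra].
  have [e|ne'] := eqVneq (p (i, true)) 0; last by case: hi.
  by rewrite e; case: b => /= h1 h2; [rewrite max_l; lra|rewrite max_r; lra].
split.
- split.
    by apply: cont_on_ptws => o; apply: cont_onB; exact: cont_on_proj.
  apply: cont_on_ptws => -[i b]; case: b => /=; rewrite /of_signed /=;
    (apply: cont_on_max; [exact: cont_on_cst|]).
    by apply: cont_onN; exact: cont_on_proj.
  exact: cont_on_proj.
- move=> p Kp; rewrite toK//; split=> //; have [p0 [v pv] pK] := Kp; split.
    apply/not_existsP => h.
    have z0 o : to_signed p o = 0 by have /negP := h o; rewrite negbK => /eqP.
    move: pv; rewrite -(toK _ Kp) /of_signed z0 oppr0 maxxx.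
    by case: ifP; rewrite eqxx.
  by rewrite -supp_of_signed toK.
- move=> z [[j zj] zK]; rewrite of_signedK; split=> //; split.
  + by move=> [i b]; case: b; rewrite /of_signed /= le_max lexx.
  + have [h|h] := ltP 0 (z j).
      exists (gi j, false); rewrite /of_signed /= giK; rewrite max_r ?ltW//.
    by exists (gi j, true); rewrite /of_signed /= giK max_r ?oppr_eq0//; lra.
  + by rewrite supp_of_signed.
- by move=> k p k0 _; apply/funext => o; rewrite /to_signed /scale mulrBr.
Qed.

End Signed.
End Conic.

(** * Unions of orthants *)

Section Bigmin.
Variables (R : realType) (N : finType).
Implicit Types (S : {set N}) (u : N -> R).

(** In use the default [c] is a value [u i0] with [i0] in [S], so that this is the true minimum over
    [S]. *)
Definition fmin S (c : R) u : R := \big[Num.min/c]_(i in S) u i.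

Lemma fmin_le S c u i : i \in S -> fmin S c u <= u i.
Proof. exact: bigmin_le_cond. Qed.

Lemma fmin_ge S c u x : x <= c -> (forall i, i \in S -> x <= u i) -> x <= fmin S c u.
Proof. by move=> h1 h2; apply/bigmin_geP. Qed.

Lemma fmin_attained S i0 u : i0 \in S -> exists2 i, i \in S & u i = fmin S (u i0) u.
Proof.
move=> i0S; have /bigmin_leP := lexx (fmin S (u i0) u).
case=> [h|[i iS h]].
  by exists i0 => //; apply/eqP; rewrite eq_le h fmin_le.
by exists i => //; apply/eqP; rewrite eq_le h fmin_le.
Qed.

Lemma fmin_eq S i0 u x : i0 \in S -> (forall i, i \in S -> x <= u i) ->
  (exists2 i, i \in S & u i = x) -> fmin S (u i0) u = x.
Proof.
move=> i0S h [i iS ui]; apply/eqP; rewrite eq_le fmin_ge ?h// andbT -ui.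
exact: fmin_le.
Qed.

Lemma fminZ S c u k : 0 <= k -> fmin S (k * c) (fun i => k * u i) = k * fmin S c u.
Proof.
move=> k0; rewrite /fmin; elim/big_rec2: _ => // i x y _ ->.
by rewrite minr_pMr.
Qed.

Lemma cont_on_fmin (X : topologicalType) (A : set X) S (c : X -> R) (u : X -> N -> R) :
  cont_on A c -> (forall i, cont_on A (fun x => u x i)) ->
  cont_on A (fun x => fmin S (c x) (u x)).
Proof. by move=> hc hu; apply: cont_on_bigmin => // i _; exact: hu. Qed.

End Bigmin.

Section Orthants.
Variables (R : realType) (N : finType).
Local Notation rf := {ptws N -> R}.
Implicit Types (Z T A C E : {set N}) (P : {set {set N}}) (z u : rf).

(* A set of coordinates stands for the orthant in which exactly these
   coordinates are nonpositive. *)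
Definition compat Z u : Prop := forall o, if o \in Z then u o <= 0 else 0 <= u o.

Definition union_orthants P : set rf := [set u | exists2 Z, Z \in P & compat Z u].

(** The coordinates outside [E] are frozen at zero; they are the ones occupied by the face whose
    link is being studied. *)
Definition fan E P : set rf :=
  [set u | [/\ exists o, u o != 0, forall o, o \notin E -> u o = 0 & union_orthants P u]].

Lemma compatZ Z u k : 0 < k -> compat Z u -> compat Z (scale k u).
Proof.
move=> k0 h o; have := h o; rewrite /scale; case: ifP => _ ?.
  by rewrite pmulr_rle0.
by rewrite pmulr_rge0.
Qed.

Lemma conic_fan E P : conic (fan E P).
Proof.
move=> k u k0 [[j uj] uE [Z ZP cZ]]; split.
- by exists j; rewrite mulf_neq0// gt_eqF.
- by move=> o /uE uo; rewrite /scale uo mulr0.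
- by exists Z => //; exact: compatZ.
Qed.

Definition symdiff T Z : {set N} := finset (fun o => (o \in T) != (o \in Z)).

Lemma symdiffK T : involutive (symdiff T).
Proof.
by move=> Z; apply/setP => o; rewrite !inE; case: (o \in T); case: (o \in Z).
Qed.

(** This reflection carries the orthant [T] to the nonnegative one, so that attaching an orthant has
    to be understood only there. *)
Definition twist T u : rf := fun o => if o \in T then - u o else u o.

Lemma twistK T : involutive (twist T).
Proof. by move=> u; apply/funext => o; rewrite /twist; case: (o \in T); rewrite ?opprK. Qed.

Lemma compat_twist T Z u : compat (symdiff T Z) (twist T u) <-> compat Z u.
Proof.
rewrite /compat /twist; split=> h o; have := h o; rewrite !inE;
  by case: (o \in T); case: (o \in Z) => //=; rewrite ?oppr_le0 ?oppr_ge0.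
Qed.

Lemma twist_neq0 T u o : (twist T u o != 0) = (u o != 0).
Proof. by rewrite /twist; case: ifP => // _; rewrite oppr_eq0. Qed.

Lemma cont_on_twist T (D : set rf) : cont_on D (twist T).
Proof.
apply: cont_on_ptws => o; rewrite /twist; case: (o \in T); last exact: cont_on_proj.
by apply: cont_onN; exact: cont_on_proj.
Qed.

Lemma twistZ T k u : twist T (scale k u) = scale k (twist T u).
Proof. by apply/funext => o; rewrite /twist /scale; case: ifP => // _; rewrite mulrN. Qed.

Lemma fan_twist T E P u : fan E P u <-> fan E (symdiff T @: P) (twist T u).
Proof.
split=> -[[j uj] uE [Z ZP cZ]]; split.
- by exists j; rewrite twist_neq0.
- by move=> o /uE uo; rewrite /twist uo oppr0 if_same.
- by exists (symdiff T Z); [exact: imset_f|apply/compat_twist].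
- by exists j; rewrite -(twist_neq0 T).
- by move=> o /uE /eqP; rewrite -[_ == _]negbK twist_neq0 negbK => /eqP.
- have /imsetP[Z' Z'P eZ] := ZP; exists Z' => //; apply/(compat_twist T).
  by rewrite -eZ.
Qed.

Lemma conic_iso_twist T E P :
  conic_iso (fan E P) (fan E (symdiff T @: P)) (twist T) (twist T).
Proof.
split.
- by split; exact: cont_on_twist.
- by move=> u /fan_twist h; rewrite twistK.
- by move=> u h; rewrite twistK; split=> //; apply/(fan_twist T); rewrite twistK.
- by move=> k u _ _; rewrite twistZ.
Qed.

Section Expand.
Variables (E A : {set N}) (P : {set {set N}}) (a0 c0 : N).
Hypotheses (AE : A \subset E) (a0A : a0 \in A) (c0C : c0 \in E :\: A).
Hypothesis hA : forall B : {set N}, B \subset A -> B != finset.set0 -> B \in P.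
Hypothesis hP : forall Z, Z \in P -> exists2 i, i \in A & i \in Z.

Let nu u : R := fmin (E :\: A) (u c0) u.
Let mu u : R := fmin A (u a0) u.
Let nu0 u := Num.max 0 (nu u).

(** Only vectors positive on [E :\: A] move, by one common shift on [A] and another on [E :\: A].
    Differences inside each block are kept, so everything is decided by the planar map sending
    ([nu], [mu]) to (min([nu], -[mu]), [mu] + [nu]). *)
Definition expand_fun u : rf := fun o =>
  if o \in A then u o + nu0 u
  else if o \in E then u o - nu0 u + Num.min (nu0 u) (Num.max 0 (- mu u)) else u o.

Definition shrink_fun u : rf := fun o =>
  if o \in A then u o - Num.max 0 (mu u) - nu0 u
  else if o \in E then u o + Num.max 0 (mu u) else u o.

Let CE o : o \in E :\: A -> (o \in A = false) * (o \in E).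
Proof. by rewrite inE => /andP[/negbTE-> ->]. Qed.

Let mu_le0 u : fan E P u -> mu u <= 0.
Proof.
move=> [_ _ [Z /hP[i iA iZ] cZ]]; have := cZ i; rewrite iZ => ui.
by apply: le_trans ui; exact: fmin_le.
Qed.

Let expand_id u : nu u <= 0 -> expand_fun u = u.
Proof.
move=> h; apply/funext => o; rewrite /expand_fun /nu0 max_l// addr0.
by rewrite min_l ?subr0 ?addr0 ?if_same// le_max lexx.
Qed.

Let shrink_id u : nu u <= 0 -> mu u <= 0 -> shrink_fun u = u.
Proof.
by move=> h h'; apply/funext => o; rewrite /shrink_fun /nu0 !max_l// !subr0 addr0 !if_same.
Qed.

Let nu_le u o : o \in E :\: A -> nu u <= u o. Proof. exact: fmin_le. Qed.
Let mu_le u o : o \in A -> mu u <= u o. Proof. exact: fmin_le. Qed.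

(* In coordinates (nu, mu) the map sends the quadrant nu >= 0 >= mu onto the
   half plane nu >= 0, fixing the ray nu = 0 >= mu. *)
Let expandE u : fan E P u -> 0 < nu u ->
  [/\ nu (expand_fun u) = Num.min (nu u) (- mu u), mu (expand_fun u) = mu u + nu u
    & fan E (finset.set0 |: P) (expand_fun u)].
Proof.
move=> fu nu_gt0; have mu0 := mu_le0 fu.
have nu0u : nu0 u = nu u by rewrite /nu0 max_r// ltW.
have muN : Num.max 0 (- mu u) = - mu u by rewrite max_r// oppr_ge0.
have FA o : o \in A -> expand_fun u o = u o + nu u.
  by move=> oA; rewrite /expand_fun oA nu0u.
have FC o : o \in E :\: A -> expand_fun u o = u o - nu u + Num.min (nu u) (- mu u).
  by move=> /CE[h1 h2]; rewrite /expand_fun h1 h2 nu0u muN.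
have min0 : 0 <= Num.min (nu u) (- mu u) by rewrite le_min oppr_ge0 mu0 ltW.
have [a aA ua] := fmin_attained u a0A; have [c cC uc] := fmin_attained u c0C.
have n1 : nu (expand_fun u) = Num.min (nu u) (- mu u).
  apply: fmin_eq => //; last by exists c => //; rewrite FC// uc -/(nu u) subrr add0r.
  by move=> o oC; rewrite FC// lerDr subr_ge0 nu_le.
have m1 : mu (expand_fun u) = mu u + nu u.
  apply: fmin_eq => //; last by exists a => //; rewrite FA// ua.
  by move=> o oA; rewrite FA// lerD2r mu_le.
split=> //; case: fu => _ uE _; split.
- have [h|h] := eqVneq (expand_fun u c) 0; last by exists c.
  exists a; rewrite FA// ua -/(mu u); move: h; rewrite FC// uc -/(nu u) subrr add0r.
  by have [h1 h2|h1 h2] := leP (nu u) (- mu u); rewrite gt_eqF//; lra.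
- move=> o oE; rewrite /expand_fun (negbTE oE) uE// ifN//.
  by apply: contra oE; exact: (fintype.subsetP AE).
- exists (finset (fun o => (o \in A) && (expand_fun u o < 0))).
    rewrite !inE; have [//|ne] := eqVneq; apply: hA => //.
    by apply/fintype.subsetP => o; rewrite inE => /andP[].
  move=> o; rewrite !inE; case: (boolP (o \in A)) => /= oA.
    by case: ltP => // /ltW.
  have [oE|oE] := boolP (o \in E); last first.
    by rewrite /expand_fun (negbTE oE) (negbTE oA) uE.
  have oC : o \in E :\: A by rewrite inE oA.
  by rewrite FC// addr_ge0// subr_ge0 nu_le.
Qed.

Let shrinkE u : fan E (finset.set0 |: P) u -> 0 < nu u \/ 0 < mu u ->
  [/\ 0 <= nu u, nu (shrink_fun u) = nu u + Num.max 0 (mu u),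
      mu (shrink_fun u) = Num.min 0 (mu u) - nu u & fan E P (shrink_fun u)].
Proof.
move=> fu h; have [_ uE [Z ZP cZ]] := fu.
have n0 : 0 <= nu u.
  case: h => [/ltW//|m0]; move: ZP; rewrite !inE => /orP[/eqP Z0|/hP[i iA iZ]].
    have u0 o : 0 <= u o by have := cZ o; rewrite Z0 inE.
    exact: fmin_ge.
  by have := cZ i; rewrite iZ => ui; have := mu_le u iA; lra.
have nu0u : nu0 u = nu u by rewrite /nu0 max_r.
have GA o : o \in A -> shrink_fun u o = u o - Num.max 0 (mu u) - nu u.
  by move=> oA; rewrite /shrink_fun oA nu0u.
have GC o : o \in E :\: A -> shrink_fun u o = u o + Num.max 0 (mu u).
  by move=> /CE[h1 h2]; rewrite /shrink_fun h1 h2.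
have [a aA ua] := fmin_attained u a0A; have [c cC uc] := fmin_attained u c0C.
rewrite -/(mu u) in ua; rewrite -/(nu u) in uc.
have mm : mu u - Num.max 0 (mu u) = Num.min 0 (mu u).
  by have [h1|h1] := leP 0 (mu u); lra.
have m0 : 0 <= Num.max 0 (mu u) by rewrite le_max lexx.
have pos : 0 < nu u + Num.max 0 (mu u).
  by case: h => h; [lra|]; rewrite max_r ?ltW//; lra.
have n1 : nu (shrink_fun u) = nu u + Num.max 0 (mu u).
  apply: fmin_eq => //; last by exists c => //; rewrite GC// uc.
  by move=> o oC; rewrite GC// lerD2r nu_le.
have m1 : mu (shrink_fun u) = Num.min 0 (mu u) - nu u.
  rewrite -mm; apply: fmin_eq => //; last by exists a => //; rewrite GA// ua.
  by move=> o oA; rewrite GA// !lerD2r mu_le.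
split=> //; split.
- by exists c; rewrite GC// uc gt_eqF.
- move=> o oE; rewrite /shrink_fun (negbTE oE) uE// ifN//.
  by apply: contra oE; exact: (fintype.subsetP AE).
- exists (finset (fun o => (o \in A) && (shrink_fun u o <= 0))).
    apply: hA; first by apply/fintype.subsetP => o; rewrite inE => /andP[].
    apply/set0Pn; exists a; rewrite inE aA /= GA// ua mm.
    by have hm : Num.min 0 (mu u) <= 0 by [rewrite ge_min lexx]; lra.
  move=> o; rewrite !inE; case: (boolP (o \in A)) => /= oA.
    by case: leP => // /ltW.
  have [oE|oE] := boolP (o \in E); last first.
    by rewrite /shrink_fun (negbTE oE) (negbTE oA) uE.
  have oC : o \in E :\: A by rewrite inE oA.
  by rewrite GC//; have := nu_le u oC; lra.
Qed.

Lemma conic_iso_expand0 :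
  conic_iso (fan E P) (fan E (finset.set0 |: P)) expand_fun shrink_fun.
Proof.
have subP u : fan E P u -> fan E (finset.set0 |: P) u.
  by move=> [h1 h2 [Z ZP cZ]]; split=> //; exists Z => //; rewrite inE ZP orbT.
have c_nu0 D : cont_on D nu0.
  apply: cont_on_max; first exact: cont_on_cst.
  by apply: cont_on_fmin => *; exact: cont_on_proj.
have c_mu D : cont_on D mu by apply: cont_on_fmin => *; exact: cont_on_proj.
have c_0 D : cont_on D (fun _ : rf => 0 : R) by exact: cont_on_cst.
split.
- split; apply: cont_on_ptws => o; rewrite /expand_fun /shrink_fun; case: (o \in A).
  + by apply: cont_onD => //; exact: cont_on_proj.
  + case: (o \in E); last exact: cont_on_proj.
    apply: cont_onD; first by apply: cont_onB => //; exact: cont_on_proj.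
    by apply: cont_on_min => //; apply: cont_on_max => //; exact: cont_onN.
  + apply: cont_onB => //; apply: cont_onB; first exact: cont_on_proj.
    exact: cont_on_max.
  + case: (o \in E); last exact: cont_on_proj.
    by apply: cont_onD; [exact: cont_on_proj|exact: cont_on_max].
- move=> u fu; have mu0 := mu_le0 fu.
  have [n0|n0] := leP (nu u) 0; first by rewrite expand_id// shrink_id//; split=> //; exact: subP.
  have [n1 m1 fan1] := expandE fu n0; split=> //.
  apply/funext => o; rewrite /shrink_fun /nu0 n1 m1 /expand_fun /nu0.
  rewrite (max_r (ltW n0)) (max_r (y := - mu u)) ?oppr_ge0//.
  have [e1 e2] : Num.max 0 (Num.min (nu u) (- mu u)) = Num.min (nu u) (- mu u) /\
      Num.max 0 (mu u + nu u) = nu u - Num.min (nu u) (- mu u).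
    have [h1|h1] := leP (nu u) (- mu u); last by rewrite !max_r; lra.
    by rewrite max_r ?max_l; lra.
  by rewrite e1 e2; case: (o \in A); [|case: (o \in E) => //]; ring.
- move=> u fu; have [h|/not_orP[/negP n0 /negP m0]] := pselect (0 < nu u \/ 0 < mu u).
    have [n0 n1 m1 fan1] := shrinkE fu h; split=> //.
    apply/funext => o; rewrite /expand_fun /nu0 n1 m1 /shrink_fun /nu0.
    have [e1 e2] : Num.max 0 (nu u + Num.max 0 (mu u)) = nu u + Num.max 0 (mu u) /\
        Num.min (nu u + Num.max 0 (mu u)) (Num.max 0 (- (Num.min 0 (mu u) - nu u))) = nu u.
      have [h2|h2] := leP 0 (mu u); (split; [by rewrite max_r//; lra|]).
        by rewrite max_r ?min_r; lra.
      by rewrite addr0 max_r ?min_l; lra.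
    by rewrite e1 e2 (max_r n0); case: (o \in A); [|case: (o \in E) => //]; ring.
  rewrite -!leNgt in n0 m0; rewrite shrink_id// expand_id//; split=> //.
  (* A fixed point in the new orthant has a vanishing coordinate in [A], hence already lies in the
     old orthant across that wall. *)
  have [h1 h2 [Z + cZ]] := fu; rewrite !inE => /orP[/eqP Z0|ZP]; last by split=> //; exists Z.
  have u0 o : 0 <= u o by have := cZ o; rewrite Z0 inE.
  have [a aA ua] := fmin_attained u a0A; rewrite -/(mu u) in ua.
  split=> //; exists [set a]%SET.
    by apply: hA; [rewrite finset.sub1set|rewrite -card_gt0 cards1].
  by move=> o; rewrite inE; case: eqVneq => [->|//]; rewrite ua.
- move=> k u k0 _; apply/funext => o.
  have nuk : nu (scale k u) = k * nu u by exact/fminZ/ltW.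
  have muk : mu (scale k u) = k * mu u by exact/fminZ/ltW.
  have n0k : nu0 (scale k u) = k * nu0 u.
    by rewrite /nu0 nuk -[X in Num.max X _](mulr0 k) maxr_pMr// ltW.
  have maxk : Num.max 0 (- mu (scale k u)) = k * Num.max 0 (- mu u).
    by rewrite muk -mulrN -[X in Num.max X _](mulr0 k) maxr_pMr// ltW.
  rewrite /expand_fun n0k maxk -minr_pMr ?ltW// /scale.
  by case: ifP => _; [|case: ifP => // _]; ring.
Qed.

End Expand.
End Orthants.

(** * Attaching orthants one at a time *)

Section Build.
Variables (R : realType) (N : finType).
Implicit Types (Z T A B E : {set N}) (P : {set {set N}}).

Lemma symdiffxx T : symdiff T T = finset.set0.
Proof. by apply/setP => o; rewrite !inE eqxx. Qed.

(** Reflecting in [T] reduces to [conic_iso_expand0]. Since [A] is not all of [E], the new orthant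
    has a free wall through which the old union can be pushed into it. *)
Lemma fan_expand E A P T : A \subset E -> A != finset.set0 -> A != E ->
  (forall B, B \subset A -> B != finset.set0 -> symdiff T B \in P) ->
  (forall Z, Z \in P -> exists2 i, i \in A & (i \in T) != (i \in Z)) ->
  conic_homeo (fan (R := R) E P) (fan E (T |: P)).
Proof.
move=> AE /set0Pn[a0 a0A] nAE hA hP.
have /set0Pn[c0 c0C] : E :\: A != finset.set0.
  by apply: contra nAE; rewrite finset.setD_eq0 => EA; rewrite finset.eqEsubset AE.
apply: (@conic_homeo_trans _ _ _ _ _ (fan E (symdiff T @: P))).
  exists (twist T), (twist T); exact: conic_iso_twist.
apply: (@conic_homeo_trans _ _ _ _ _ (fan E (symdiff T @: (T |: P)))); last first.
  exists (twist T), (twist T); apply: conic_iso_sym; last exact: conic_iso_twist.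
  exact: conic_fan.
rewrite imsetU1 symdiffxx.
exists (expand_fun E A a0 c0), (shrink_fun E A a0 c0); apply: conic_iso_expand0 => //.
  by move=> B BA B0; apply/imsetP; exists (symdiff T B); rewrite ?hA// symdiffK.
move=> Z /imsetP[Z' /hP[i iA ne] ->]; exists i => //; by rewrite inE.
Qed.

(* Any orthant outside an initial segment of the order is attached to the
   earlier ones along the faces missing one of the coordinates of A T. *)
Lemma build_fan E P T0 (rho : {set N} -> nat) (A : {set N} -> {set N}) :
  T0 \in P ->
  (forall T, T \in P -> T != T0 -> [/\ A T \subset E, A T != E &
     forall B, B \subset A T -> B != finset.set0 ->
       symdiff T B \in P /\ (rho (symdiff T B) < rho T)%N]) ->
  (forall T Z, T \in P -> T != T0 -> Z \in P -> Z != T ->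
     (Z == T0) || (rho Z <= rho T)%N -> exists2 i, i \in A T & (i \in T) != (i \in Z)) ->
  conic_homeo (fan (R := R) E [set T0]%SET) (fan E P).
Proof.
move=> T0P h1 h2.
(* [Q] runs over the initial segments for [rho], with [T0] counted first whatever its rank; the
   induction removes a member of largest rank. *)
suff H n : forall Q : {set {set N}}, #|Q| = n.+1 -> T0 \in Q -> Q \subset P ->
    (forall T Z, T \in Q -> Z \in P -> Z \notin Q -> (T == T0) || (rho T <= rho Z)%N) ->
    conic_homeo (fan (R := R) E [set T0]%SET) (fan E Q).
  apply: (H #|P|.-1) => //.
    by rewrite prednK// card_gt0; apply/set0Pn; exists T0.
  by move=> T Z _ ->.
elim: n => [|n IH] Q cQ T0Q QP hQ.
  have /eqP/cards1P[x eQ] := cQ; move: T0Q; rewrite eQ inE => /eqP->.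
  by exists id, id; exact: conic_iso_id.
have /set0Pn[T1 T1Q] : Q :\ T0 != finset.set0.
  by rewrite -card_gt0; move: cQ; rewrite (cardsD1 T0) T0Q add1n => -[->].
have [T TQ maxT] := @arg_maxnP _ T1 (mem (Q :\ T0)) rho T1Q.
move: TQ; rewrite /= !inE => /andP[TT0 TQ].
have TP := fintype.subsetP QP _ TQ.
have [AE AnE hB] := h1 _ TP TT0.
have eQ : T |: (Q :\ T) = Q by rewrite finset.setD1K.
apply: (@conic_homeo_trans _ _ _ _ _ (fan E (Q :\ T))).
  apply: IH.
  - by move: cQ; rewrite (cardsD1 T) TQ add1n => -[].
  - by rewrite !inE eq_sym TT0.
  - by apply: fintype.subset_trans QP; exact: subD1set.
  - move=> T' Z; rewrite !inE => /andP[T'T T'Q] ZP; rewrite negb_and negbK.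
    case/orP => [/eqP->|ZQ]; last exact: hQ.
    by case: eqVneq => //= T'T0; apply: maxT; rewrite /= !inE T'T0.
rewrite -{2}eQ; apply: (@fan_expand _ (A T)) => //.
- have T0T : T0 != T by rewrite eq_sym.
  have [|i iA _] := h2 T T0 TP TT0 T0P T0T; first by rewrite eqxx.
  by apply/set0Pn; exists i.
- move=> B BA B0; have [BP rB] := hB _ BA B0.
  rewrite !inE; apply/andP; split.
    by apply: contraTneq rB => ->; rewrite ltnn.
  apply: contraLR isT => BQ; have := hQ T _ TQ BP BQ.
  by rewrite (negbTE TT0) /= leqNgt rB.
- move=> Z; rewrite !inE => /andP[ZT ZQ]; apply: h2 => //.
    exact: (fintype.subsetP QP).
  by case: eqVneq => //= ZT0; apply: maxT; rewrite /= !inE ZT0.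
Qed.

End Build.

(** * A single orthant is a cone over a ball *)

Section Ball.
Variables (R : realType) (N : finType) (E : {set N}) (l : N).
Hypothesis lE : l \in E.
Let S := E :\ l.
Let k := #|S|.
Let e (i : 'I_k) : N := enum_val i.

Let eS i : e i \in S. Proof. exact: enum_valP. Qed.
Let eE i : (e i \in E) * (e i == l = false).
Proof. by have := eS i; rewrite !inE => /andP[/negbTE -> ->]. Qed.

Let low (y : 'rV[R]_k) : R := \big[Num.min/0]_i y ord0 i.
Let len (y : 'rV[R]_k) : R := Num.sqrt (\sum_i y ord0 i ^+ 2).
Let dir (p : {ptws N -> R}) : 'rV[R]_k := \row_i (p (e i) - p l).
Let height p := len (dir p) + (p l + low (dir p)).

(** [p l + low (dir p)] is the smallest coordinate of [p] on [E], and [height] adds to it the length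
    of [dir p]. Hence nonnegativity of [p] says exactly that [dir p] is no longer than [height p].
    The inverse picks the point of height 1, whose smallest coordinate is 1 - [len y]. *)
Definition orthant_to_ball (p : {ptws N -> R}) : 'rV[R]_k := (height p)^-1 *: dir p.
Definition ball_to_orthant (y : 'rV[R]_k) : {ptws N -> R} := fun o =>
  if o \in E then \sum_(i | e i == o) y ord0 i - low y + (1 - len y) else 0.

Let lowZ c y : 0 <= c -> low (c *: y) = c * low y.
Proof.
move=> c0; rewrite /low; apply: (big_rec2 (fun a b => a = c * b)); first by rewrite mulr0.
by move=> i a b _ ->; rewrite !mxE minr_pMr.
Qed.

Let lenZ c y : 0 <= c -> len (c *: y) = c * len y.
Proof.
move=> c0; rewrite /len; under eq_bigr do rewrite mxE exprMn.
by rewrite -mulr_sumr sqrtrM ?sqr_ge0// sqrtr_sqr ger0_norm.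
Qed.

Let low_le y i : low y <= y ord0 i. Proof. exact: bigmin_le. Qed.
Let low_le0 y : low y <= 0. Proof. exact: bigmin_le_id. Qed.

Let dirZ c p : dir (scale c p) = c *: dir p.
Proof. by apply/rowP => i; rewrite !mxE /scale mulrBr. Qed.

Let heightZ c p : 0 <= c -> height (scale c p) = c * height p.
Proof. by move=> c0; rewrite /height dirZ lenZ// lowZ// /scale; ring. Qed.

Let B : set {ptws N -> R} := fan E [set finset.set0]%SET.

Let BE p : B p -> (forall o, 0 <= p o) /\ 0 < height p.
Proof.
move=> [[j pj] pE [Z]]; rewrite inE => /eqP-> cp.
have p0 o : 0 <= p o by have := cp o; rewrite inE.
split=> //.
have m0 : 0 <= p l + low (dir p).
  rewrite -lerBlDl sub0r; apply/bigmin_geP; split; first by rewrite oppr_le0.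
  by move=> i _; rewrite mxE; have := p0 (e i); lra.
have l0 : 0 <= len (dir p) by exact: sqrtr_ge0.
rewrite lt_neqAle eq_sym addr_ge0// andbT; apply: contra pj.
rewrite paddr_eq0// => /andP[].
rewrite sqrtr_eq0 => le0 /eqP e0.
have d0 i : dir p ord0 i = 0.
  apply/eqP; rewrite -sqrf_eq0; apply/eqP; apply: (@psumr_eq0P _ _ xpredT (fun i => dir p ord0 i ^+ 2)) => //.
    by move=> *; exact: sqr_ge0.
  by apply/eqP; rewrite eq_le le0 sumr_ge0// => *; exact: sqr_ge0.
have lw : low (dir p) = 0 by rewrite /low; under eq_bigr do rewrite d0; rewrite big_const_idem //= minxx.
have pl : p l = 0 by move: e0; rewrite lw addr0.
apply/eqP; have [jE|jE] := boolP (j \in E); last exact: pE.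
have [->//|jl] := eqVneq j l.
have jS : j \in S by rewrite !inE jl.
by have := d0 (enum_rank_in jS j); rewrite mxE /e enum_rankK_in// pl subr0.
Qed.

Let sumE (y : 'rV[R]_k) i : \sum_(j | e j == e i) y ord0 j = y ord0 i.
Proof. by rewrite (big_pred1 i)// => j /=; rewrite (inj_eq enum_val_inj). Qed.
Let suml (y : 'rV[R]_k) : \sum_(j | e j == l) y ord0 j = 0.
Proof. by rewrite big_pred0// => j; rewrite eE. Qed.

Let dir_ball y : dir (ball_to_orthant y) = y.
Proof. by apply/rowP => i; rewrite mxE /ball_to_orthant lE eE suml sumE; ring. Qed.

Let height_ball y : height (ball_to_orthant y) = 1.
Proof. by rewrite /height dir_ball /ball_to_orthant lE suml; ring. Qed.

Lemma orthant_ball (V : finType) (K : {set {set V}}) :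
  conic_homeo (cone_over (R := R) K) B -> topological_ball R K.
Proof.
move=> [F [G h]]; exists k.
apply: (realization_homeomorphic (a := orthant_to_ball) (c := ball_to_orthant) h).
- have cdir i : cont_on B (fun p => dir p ord0 i).
    apply: (@cont_on_eq _ _ _ (fun p : {ptws N -> R} => p (e i) - p l)); first by move=> p _; rewrite mxE.
    by apply: cont_onB; exact: cont_on_proj.
  apply: cont_on_mx => i j; rewrite (ord1 i).
  apply: (@cont_on_eq _ _ _ (fun p => (height p)^-1 * dir p ord0 j)); first by move=> p _; rewrite !mxE.
  apply: cont_onM => //; apply: cont_onV; first by move=> p /BE[_ /gt_eqF->].
  apply: cont_onD.
    by apply: cont_on_sqrt; apply: cont_on_sum => a _; apply: cont_onM; exact: cdir.
  apply: cont_onD; first exact: cont_on_proj.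
  by apply: cont_on_bigmin => //; exact: cont_on_cst.
- have clen : cont_on (unit_ball R k) len.
    by apply: cont_on_sqrt; apply: cont_on_sum => a _; apply: cont_onM; exact: cont_on_mxproj.
  apply: cont_on_ptws => o; rewrite /ball_to_orthant; case: (o \in E); last exact: cont_on_cst.
  apply: cont_onD; last by apply: cont_onB => //; exact: cont_on_cst.
  apply: cont_onB; first by apply: cont_on_sum => i _; exact: cont_on_mxproj.
  by apply: cont_on_bigmin => //; [move=> i _; exact: cont_on_mxproj|exact: cont_on_cst].
- move=> p /BE[p0 s0]; rewrite /unit_ball /= /orthant_to_ball.
  have m0 : 0 <= p l + low (dir p).
    rewrite -lerBlDl sub0r; apply/bigmin_geP; split; first by rewrite oppr_le0.
    by move=> i _; rewrite mxE; have := p0 (e i); lra.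
  have : len ((height p)^-1 *: dir p) <= 1.
    have hV : 0 <= (height p)^-1 by rewrite invr_ge0 ltW.
    by rewrite lenZ// ler_pdivrMl// mulr1 /height lerDl.
  rewrite /len -{1}sqrtr1 ler_sqrt ?ltr01//.
- move=> y y1; rewrite /orthant_to_ball dir_ball height_ball invr1 scale1r; split=> //.
  have l1 : len y <= 1 by rewrite -sqrtr1 ler_sqrt// ltr01.
  split.
  + apply/not_existsP => hz.
    have z o : ball_to_orthant y o = 0 by have /negP := hz o; rewrite negbK => /eqP.
    have : height (ball_to_orthant y) = 0.
      rewrite -[ball_to_orthant y](_ : scale 0 (ball_to_orthant y) = _) ?heightZ ?mul0r//.
      by apply/funext => o; rewrite /scale mul0r z.
    by rewrite height_ball; apply/eqP; rewrite oner_eq0.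
  + by move=> o oE; rewrite /ball_to_orthant (negbTE oE).
  + exists finset.set0; rewrite ?inE// => o; rewrite inE /ball_to_orthant.
    case: ifP => // oE; rewrite addr_ge0 ?subr_ge0//.
    have [->|ol] := eqVneq o l; first by rewrite suml low_le0.
    have oS : o \in S by rewrite !inE ol.
    have -> : o = e (enum_rank_in oS o) by rewrite /e enum_rankK_in.
    by rewrite sumE low_le.
- move=> c p c0 /BE[_ s0]; rewrite /orthant_to_ball heightZ ?ltW// dirZ scalerA invfM.
  by rewrite mulrAC mulVf ?gt_eqF// mul1r.
- move=> p Bp; have [p0 s0] := BE Bp; exists (height p)^-1; rewrite ?invr_gt0//.
  apply/funext => o; rewrite /scale /ball_to_orthant /orthant_to_ball.
  case: Bp => _ pE _; have [oE|oE] := boolP (o \in E); last by rewrite pE// mulr0.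
  rewrite lowZ ?invr_ge0 ?ltW// lenZ ?invr_ge0 ?ltW//.
  have e1 : 1 = (height p)^-1 * (len (dir p) + (p l + low (dir p))).
    by rewrite mulVf// lt0r_neq0.
  have -> : \sum_(i | e i == o) ((height p)^-1 *: dir p) ord0 i = (height p)^-1 * (p o - p l).
    have [->|ol] := eqVneq o l; first by rewrite suml subrr mulr0.
    have oS : o \in S by rewrite !inE ol.
    have {1 2}-> : o = e (enum_rank_in oS o) by rewrite /e enum_rankK_in.
    by rewrite sumE !mxE.
  by move: e1; move: (height p)^-1 => c; lra.
Qed.

End Ball.

(** * Links that are not balls *)

Section NotBall.
Variable R : realType.
Local Notation I01 := (`[0, 1]%classic : set R).

Lemma IVT_zero (phi : R -> R) : cont_on I01 phi ->
  Num.min (phi 0) (phi 1) <= 0 <= Num.max (phi 0) (phi 1) ->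
  exists2 t, 0 <= t <= 1 & phi t = 0.
Proof.
move=> /cont_onE cphi h; have [t] := IVT ler01 cphi h.
by rewrite in_itv /= => ht e; exists t.
Qed.

Variables (V N : finType) (K : {set {set V}}) (E : {set N}).

(** The cone, without origin, over a sphere of dimension one less than the size of [E]. *)
Definition punctured : set {ptws N -> R} :=
  [set z | (exists o, z o != 0) /\ forall o, o \notin E -> z o = 0].

Hypothesis cK : conic_homeo (cone_over (R := R) K) punctured.

(** Points of the realization are rays of the punctured space. Injectivity is recorded in both
    directions, because the direction that gets contradicted depends on the dimension [n] of the
    ball. *)
Lemma punctured_ball : topological_ball R K ->
  exists n (f : {ptws N -> R} -> 'rV[R]_n) (g : 'rV[R]_n -> {ptws N -> R}),
  [/\ cont_on punctured f /\ cont_on (unit_ball R n) g,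
      forall z, punctured z -> unit_ball R n (f z) /\ exists2 k, 0 < k & g (f z) = scale k z,
      forall y, unit_ball R n y -> punctured (g y) /\ f (g y) = y,
      forall z z', punctured z -> punctured z' -> f z = f z' -> exists2 k, 0 < k & z' = scale k z &
      forall y y' k, unit_ball R n y -> unit_ball R n y' -> 0 < k -> g y' = scale k (g y) -> y = y'].
Proof.
move=> [n [f [g [[/cont_onE cf /cont_onE cg] fB gA fK gK]]]].
have [F [G FG]] := cK; have [[cF cG] hF hG hZ] := FG.
have GZ k y := conic_isoZ (k := k) (y := y) (@conic_cone_over _ _ K) FG.
pose nrm (p : {ptws V -> R}) := scale (mass p)^-1 p.
have nrmP p : cone_over K p -> realization R K (nrm p).
  move=> Kp; have m0 := mass_gt0 Kp; apply/realizationE; split.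
    by apply: conic_cone_over; rewrite ?invr_gt0.
  by rewrite massZ mulVf// gt_eqF.
have fz z : punctured z -> realization R K (nrm (G z)) by move=> /hG[/nrmP].
have gy y : unit_ball R n y -> realization R K (g y) by move=> By; apply: gA; exists y.
have fgE z : punctured z -> exists2 k, 0 < k & F (nrm (G z)) = scale k z.
  move=> /hG[Kz FGz]; have m0 := mass_gt0 Kz; exists (mass (G z))^-1; rewrite ?invr_gt0//.
  by rewrite hZ ?invr_gt0// FGz.
have injg y y' k : unit_ball R n y -> unit_ball R n y' -> 0 < k ->
    F (g y') = scale k (F (g y)) -> y = y'.
  move=> By By' k0 e; have /realizationE[Ky my] := gy _ By; have /realizationE[Ky' my'] := gy _ By'.
  have e' : g y' = scale k (g y).
    by rewrite -(hF _ Ky').2 e GZ// ?(hF _ Ky).2//; case: (hF _ Ky).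
  have k1 : k = 1 by move: my'; rewrite e' massZ my mulr1.
  have : f (g y') = f (g y) by rewrite e' k1 scale1.
  by rewrite !gK// in_setE.
exists n, (fun z => f (nrm (G z))), (fun y => F (g y)); split => //.
- split.
    apply: (@cont_on_comp _ _ _ _ (realization R K) (fun z => nrm (G z)) f) => //.
    apply: cont_on_ptws => v; apply: cont_onM.
      apply: cont_onV; first by move=> z /hG[/mass_gt0/gt_eqF->].
      exact: (@cont_on_comp _ _ _ _ setT _ (@mass R V)) cG (@cont_on_mass _ _ _).
    exact: (@cont_on_comp _ _ _ _ setT _ (fun p : {ptws V -> R} => p v)) cG (@cont_on_proj _ _ _ v).
  apply: (@cont_on_comp _ _ _ _ (cone_over K)) => //.
  by move=> y /gy/realizationE[].
- move=> z pz; split; first by apply: fB; exists (nrm (G z)) => //; exact: fz.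
  by rewrite fK ?in_setE; [exact: fgE|exact: fz].
- move=> y By; have /realizationE[Ky my] := gy _ By; have [pz GF] := hF _ Ky.
  by split=> //; rewrite GF /nrm my invr1 scale1 gK// in_setE.
- move=> z z' pz pz' e.
  have /(congr1 g) := e; rewrite !fK ?in_setE; [move=> e'|exact: fz..].
  have [k k0 ek] := fgE _ pz; have [k' k0' ek'] := fgE _ pz'.
  exists (k'^-1 * k); first by rewrite mulr_gt0 ?invr_gt0.
  by rewrite -scaleA -ek e' ek' scaleV.
Qed.

(** Every ball, even for [n] = 0, contains its centre, while the punctured space is empty. *)
Lemma punctured0 : E = finset.set0 -> ~ topological_ball R K.
Proof.
move=> E0 /punctured_ball[n [f [g [_ _ h _ _]]]].
have [|[[j zj] zE] _] := h 0.
  by rewrite /unit_ball /= big1 ?ler01// => i _; rewrite mxE expr0n.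
by move: zj; rewrite zE ?eqxx// E0 inE.
Qed.

Lemma unit_ball_convex n (y y' : 'rV[R]_n) t : 0 <= t <= 1 ->
  unit_ball R n y -> unit_ball R n y' -> unit_ball R n ((1 - t) *: y + t *: y').
Proof.
move=> /andP[t0 t1]; rewrite /unit_ball /= => h h'.
apply: (@le_trans _ _ ((1 - t) * \sum_(i < n) y ord0 i ^+ 2 + t * \sum_(i < n) y' ord0 i ^+ 2)).
  rewrite !mulr_sumr -big_split /=; apply: ler_sum => i _; rewrite !mxE.
  rewrite -subr_ge0; set a := y _ _; set b := y' _ _.
  rewrite (_ : _ - _ = t * (1 - t) * (a - b) ^+ 2); last by ring.
  by rewrite mulr_ge0 ?sqr_ge0// mulr_ge0// subr_ge0.
rewrite -[leRHS](_ : (1 - t) * 1 + t * 1 = 1); last by ring.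
by apply: lerD; apply: ler_wpM2l => //; rewrite subr_ge0.
Qed.

(** Balls are convex: on the segment joining the images of the two opposite rays the single
    coordinate would have to vanish. *)
Lemma punctured1 l : E = [set l]%SET -> ~ topological_ball R K.
Proof.
move=> E1 /punctured_ball[n [f [g [[_ cg] hf hg _ _]]]].
pose z s : {ptws N -> R} := fun o => if o == l then s else 0.
have pz s : s != 0 -> punctured (z s).
  move=> s0; split; first by exists l; rewrite /z eqxx.
  by move=> o; rewrite E1 inE /z => /negbTE->.
have [B1 [k1 k1_gt0 e1]] := hf _ (pz 1 (oner_neq0 _)).
have m1 : (-1 : R) != 0 by rewrite oppr_eq0 oner_neq0.
have [B2 [k2 k2_gt0 e2]] := hf _ (pz (-1) m1).
pose y t := (1 - t) *: f (z 1) + t *: f (z (-1)).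
have By t : I01 t -> unit_ball R n (y t).
  by rewrite /= in_itv /= => ht; exact: unit_ball_convex.
have [t ht e0] : exists2 t, 0 <= t <= 1 & g (y t) l = 0.
  apply: IVT_zero.
    apply: (@cont_on_comp _ _ _ _ setT (fun t => g (y t)) (fun p : {ptws N -> R} => p l)) => //; last exact: cont_on_proj.
    apply: (@cont_on_comp _ _ _ _ (unit_ball R n) y g) => //.
    apply: cont_on_mx => i j.
    have -> : (fun t => y t i j) = (fun t => (1 - t) * f (z 1) i j + t * f (z (-1)) i j).
      by apply/funext => t; rewrite !mxE.
    apply: cont_onD; (apply: cont_onM; last exact: cont_on_cst); last exact: cont_on_id.
    by apply: cont_onB; [exact: cont_on_cst|exact: cont_on_id].
  rewrite /y subr0 subrr !scale0r !scale1r addr0 add0r e1 e2 /scale /z eqxx.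
  by rewrite ge_min le_max; apply/andP; split; apply/orP; [right|left]; lra.
have /hg[[[j yj] yE] _] : unit_ball R n (y t) by apply: By; rewrite /= in_itv.
have [jl|jl] := eqVneq j l; first by move: yj; rewrite jl e0 eqxx.
by move: yj; rewrite yE ?eqxx// E1 inE.
Qed.

(** The quotient is the stereographic projection of the unit circle from the point where the first
    coordinate is 1. *)
Lemma stereo_inj (a b c d : R) : c ^+ 2 + a ^+ 2 = 1 -> d ^+ 2 + b ^+ 2 = 1 ->
  c != 1 -> d != 1 -> a / (1 - c) = b / (1 - d) -> a = b /\ c = d.
Proof.
move=> h1 h2 c1 d1 /eqP.
have hc : 1 - c != 0 by rewrite subr_eq0 eq_sym.
have hd : 1 - d != 0 by rewrite subr_eq0 eq_sym.
rewrite eqr_div// => /eqP e.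
have e2 : (1 + c) * (1 - d) = (1 + d) * (1 - c).
  have := congr1 (fun x => x ^+ 2) e; rewrite /= !exprMn.
  have -> : a ^+ 2 = (1 + c) * (1 - c) by rewrite -[RHS]/(_) -{1}[1]h1; nra.
  have -> : b ^+ 2 = (1 + d) * (1 - d) by nra.
  move=> e'; apply: (mulIf (mulf_neq0 hc hd)); lra.
have cd : c = d by lra.
split=> //; apply: (mulIf hd); move: e; rewrite cd; lra.
Qed.

Lemma IVT_odd (phi : R -> R) : cont_on I01 phi -> phi 1 = - phi 0 ->
  exists2 t, 0 <= t <= 1 & phi t = 0.
Proof.
move=> cphi e; apply: IVT_zero => //; rewrite e ge_min le_max oppr_le0 oppr_ge0.
by have [h|/ltW h] := leP (phi 0) 0; rewrite ?h ?orbT.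
Qed.

(** Summing the coordinates gives one real function that covers [n] = 0 and [n] = 1 together. *)
Lemma row_sum n (y : 'rV[R]_n) i : (n <= 1)%N -> y ord0 i = \sum_j y ord0 j.
Proof.
by case: n y i => [|[|//]] y i _; [case: i|rewrite big_ord1 (ord1 i)].
Qed.

Section TwoCoordinates.
Variables a b : N.
Hypotheses (ab : a != b) (Eab : E = [set a; b]%SET).

Let pl (x y : R) : {ptws N -> R} := fun o => if o == a then x else if o == b then y else 0.

Let pl_a x y : pl x y a = x. Proof. by rewrite /pl eqxx. Qed.
Let pl_b x y : pl x y b = y. Proof. by rewrite /pl eq_sym (negbTE ab) eqxx. Qed.

Let pl_punctured x y : (x != 0) || (y != 0) -> punctured (pl x y).
Proof.
move=> h; split; last by move=> o; rewrite Eab !inE negb_or /pl => /andP[/negbTE-> /negbTE->].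
by case/orP: h => h; [exists a; rewrite pl_a|exists b; rewrite pl_b].
Qed.

Let plE z : punctured z -> z = pl (z a) (z b).
Proof.
move=> [_ zE]; apply/funext => o; rewrite /pl.
by case: eqVneq => [->//|oa]; case: eqVneq => [->//|ob]; rewrite zE// Eab !inE negb_or oa.
Qed.

(** The path (1 - 2t, t(1 - t)) leads from (1, 0) to (-1, 0) and avoids the origin; with its
    negative it forms a symmetric loop. Being polynomial, it keeps the estimates elementary. *)
Let arc_x (t : R) := 1 - 2 * t.
Let arc_y (t : R) := t * (1 - t).

Let arc_bound t : 0 <= t -> t <= 1 -> (arc_x t / 2) ^+ 2 + (arc_y t / 2) ^+ 2 <= 1.
Proof.
move=> t0 t1; rewrite /arc_x /arc_y.
have h1 : (1 - 2 * t) ^+ 2 <= 1 by nra.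
have h2 : 0 <= t * (1 - t) by nra.
have h4 : t * (1 - t) <= 1 by nra.
have h3 : (t * (1 - t)) ^+ 2 <= 1 by rewrite expr_le1.
lra.
Qed.

Let half_eq0 (x : R) : x / 2 = 0 -> x = 0.
Proof. by move=> h; lra. Qed.

Let half_self (x : R) : x / 2 = - (x / 2) -> x = 0.
Proof. by move=> h; lra. Qed.

Let arc_neq0 t : (arc_x t != 0) || (arc_y t != 0).
Proof.
rewrite -negb_and; apply/negP => /andP[/eqP h1 /eqP h2].
have : t = 2^-1 by rewrite /arc_x in h1; lra.
by move=> e; move: h2; rewrite e /arc_y; lra.
Qed.

Let cont_arc_x D : cont_on D arc_x.
Proof.
apply: cont_onB; first exact: cont_on_cst.
by apply: cont_onM; [exact: cont_on_cst|exact: cont_on_id].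
Qed.

Let cont_arc_y D : cont_on D arc_y.
Proof.
apply: cont_onM; first exact: cont_on_id.
by apply: cont_onB; [exact: cont_on_cst|exact: cont_on_id].
Qed.

Let cont_pl (D : set R) (x y : R -> R) : cont_on D x -> cont_on D y ->
  cont_on D (fun t => pl (x t) (y t)).
Proof.
move=> cx cy; apply: cont_on_ptws => o; rewrite /pl.
by case: (o == a) => //; case: (o == b) => //; exact: cont_on_cst.
Qed.

(** The one-dimensional Borsuk-Ulam argument: a real function on a symmetric loop agrees at some
    pair of opposite points, and these lie on different rays. *)
Let no_injection_1 n (f : {ptws N -> R} -> 'rV[R]_n) : (n <= 1)%N ->
  cont_on punctured f ->
  (forall z z', punctured z -> punctured z' -> f z = f z' -> exists2 k, 0 < k & z' = scale k z) ->
  False.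
Proof.
move=> n1 cf inj.
pose z t := pl (arc_x t) (arc_y t); pose z' t := pl (- arc_x t) (- arc_y t).
have pz t : punctured (z t) by exact/pl_punctured/arc_neq0.
have pz' t : punctured (z' t) by apply: pl_punctured; rewrite !oppr_eq0; exact: arc_neq0.
have csum (w : R -> {ptws N -> R}) : cont_on I01 w -> (forall t, punctured (w t)) ->
    cont_on I01 (fun t => \sum_i f (w t) ord0 i).
  move=> cw pw; apply: cont_on_sum => i _.
  apply: (@cont_on_comp _ _ _ _ setT (fun t => f (w t)) (fun y => y ord0 i)) => //; last exact: cont_on_mxproj.
  exact: (@cont_on_comp _ _ _ _ punctured).
have [||t _ /eqP] := @IVT_odd (fun t => \sum_i f (z t) ord0 i - \sum_i f (z' t) ord0 i).
    apply: cont_onB; apply: csum => //; apply: cont_pl => //; exact: cont_onN.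
  have -> : z 1 = z' 0 by rewrite /z /z' /arc_x /arc_y; congr pl; ring.
  have -> : z' 1 = z 0 by rewrite /z /z' /arc_x /arc_y; congr pl; ring.
  by rewrite opprB.
rewrite subr_eq0 => /eqP e.
have [k k0 ek] : exists2 k, 0 < k & z' t = scale k (z t).
  apply: inj => //; apply/rowP => i.
  by rewrite !(row_sum _ _ n1).
have ea : - arc_x t = k * arc_x t by have := congr1 (fun u => u a) ek; rewrite /= /scale /z /z' !pl_a.
have eb : - arc_y t = k * arc_y t by have := congr1 (fun u => u b) ek; rewrite /= /scale /z /z' !pl_b.
have h x : - x = k * x -> x = 0.
  move=> ex; have : (1 + k) * x = 0 by rewrite mulrDl mul1r -ex subrr.
  by move/eqP; rewrite mulf_eq0 gt_eqF ?addr_gt0//= => /eqP.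
by have := arc_neq0 t; rewrite (h _ ea) (h _ eb) eqxx.
Qed.

(** The centre of the ball uses up one direction [q] of the circle. The rest of the ball would then
    embed into a circle minus a point, that is, into a line by stereographic projection; a small
    symmetric loop around the centre contradicts this as in [no_injection_1]. *)
Let no_injection_2 n (g : 'rV[R]_n -> {ptws N -> R}) : (1 < n)%N ->
  cont_on (unit_ball R n) g -> (forall y, unit_ball R n y -> punctured (g y)) ->
  (forall y y' k, unit_ball R n y -> unit_ball R n y' -> 0 < k -> g y' = scale k (g y) -> y = y') ->
  False.
Proof.
case: n g => [|[|n]]// g _ cg pg inj.
have B0 : unit_ball R n.+2 0.
  by rewrite /unit_ball /= big1 ?ler01// => i _; rewrite mxE expr0n.
pose len (z : {ptws N -> R}) := Num.sqrt (z a ^+ 2 + z b ^+ 2).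
pose q := g 0.
(* Cosine and sine of the angle from [q] to [z]. *)
pose co z := (z a * q a + z b * q b) / (len z * len q).
pose si z := (z b * q a - z a * q b) / (len z * len q).
have len2 z : len z ^+ 2 = z a ^+ 2 + z b ^+ 2 by rewrite sqr_sqrtr// addr_ge0// sqr_ge0.
have len_gt0 z : punctured z -> 0 < len z.
  move=> pz; rewrite sqrtr_gt0 lt_neqAle eq_sym addr_ge0 ?sqr_ge0// andbT.
  rewrite paddr_eq0 ?sqr_ge0// !sqrf_eq0; apply/negP => /andP[/eqP za /eqP zb].
  have [[j zj] _] := pz; move: zj; rewrite (plE pz) za zb /pl.
  by case: (j == a); case: (j == b); rewrite eqxx.
have lq := len_gt0 _ (pg _ B0); rewrite -/q in lq.
have cs z : punctured z -> co z ^+ 2 + si z ^+ 2 = 1.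
  move=> /len_gt0 lz; rewrite /co /si !exprMn exprVn exprMn -mulrDl.
  rewrite (_ : _ + _ = (len z) ^+ 2 * (len q) ^+ 2); last by rewrite !len2; ring.
  by rewrite mulfV// mulf_neq0// sqrf_eq0 gt_eqF.
have ze z : punctured z -> z a = len z / len q * (co z * q a - si z * q b) /\
    z b = len z / len q * (co z * q b + si z * q a).
  move=> /len_gt0 lz; have := len2 q.
  rewrite /co /si; move: lz lq; move: (len z) (len q) => x y x0 y0 e.
  have yn : y != 0 by rewrite gt_eqF. have xn : x != 0 by rewrite gt_eqF.
  have y2 : q a ^+ 2 + q b ^+ 2 = y * y by rewrite -e expr2.
  split.
    rewrite [RHS](_ : _ = z a * (q a ^+ 2 + q b ^+ 2) / (y * y)); last by field; rewrite xn yn.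
    by rewrite y2; field; rewrite yn.
  rewrite [RHS](_ : _ = z b * (q a ^+ 2 + q b ^+ 2) / (y * y)); last by field; rewrite xn yn.
  by rewrite y2; field; rewrite yn.
have direction z z' : punctured z -> punctured z' -> co z = co z' -> si z = si z' ->
    exists2 k, 0 < k & z' = scale k z.
  move=> pz pz' ec es; exists (len z' / len z).
    by rewrite divr_gt0// len_gt0.
  have [ea eb] := ze _ pz; have [ea' eb'] := ze _ pz'.
  have zo o : z o = pl (z a) (z b) o by rewrite {1}(plE pz).
  have zo' o : z' o = pl (z' a) (z' b) o by rewrite {1}(plE pz').
  apply/funext => o; rewrite /scale zo zo' /pl.
  have lz : len z != 0 by rewrite gt_eqF// len_gt0.
  have lqn : len q != 0 by rewrite gt_eqF.
  case: (o == a); first by rewrite ea ea' ec es; field; rewrite lz lqn.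
  by case: (o == b); [rewrite eb eb' ec es; field; rewrite lz lqn|rewrite mulr0].
have lqq : len q * len q = q a ^+ 2 + q b ^+ 2 by rewrite -expr2 len2.
have coq : co q = 1.
  by rewrite /co lqq -!expr2 mulfV// -lqq mulf_neq0// gt_eqF.
have siq : si q = 0 by rewrite /si (_ : _ - _ = 0) ?mul0r//; ring.
have co_neq1 y : unit_ball R n.+2 y -> y != 0 -> co (g y) != 1.
  move=> By; apply: contraNneq => co1; apply/eqP.
  have s0 : si (g y) = 0.
    have := cs _ (pg _ By); rewrite co1 expr1n => h.
    by apply/eqP; rewrite -sqrf_eq0; apply/eqP; lra.
  have [||k k0 ek] := direction _ _ (pg _ B0) (pg _ By).
  - by rewrite -/q coq co1.
  - by rewrite -/q siq s0.
  by rewrite (inj _ _ _ B0 By k0 ek).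
pose chi y := si (g y) / (1 - co (g y)).
have chi_inj y y' : unit_ball R n.+2 y -> unit_ball R n.+2 y' -> y != 0 -> y' != 0 ->
    chi y = chi y' -> y = y'.
  move=> By By' y0 y0' e.
  have [es ec] := stereo_inj (cs _ (pg _ By)) (cs _ (pg _ By')) (co_neq1 _ By y0) (co_neq1 _ By' y0') e.
  have [k k0 ek] := direction _ _ (pg _ By) (pg _ By') ec es.
  exact: inj ek.
(* The loop is halved so as to fit into the unit ball; [s] = 1 and [s] = -1 give its two opposite
   halves. *)
pose y (s t : R) : 'rV[R]_n.+2 :=
  \row_i (if i == 0 then s * (arc_x t / 2) else if i == 1 then s * (arc_y t / 2) else 0).
have y0E s t : y s t ord0 0 = s * (arc_x t / 2) by rewrite mxE.
have y1E s t : y s t ord0 1 = s * (arc_y t / 2) by rewrite mxE.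
have yn0 s t : s ^+ 2 = 1 -> y s t != 0.
  move=> s2; apply/negP => /eqP e.
  have sn : s != 0 by rewrite -sqrf_eq0 s2 oner_neq0.
  have : s * (arc_x t / 2) = 0 by rewrite -y0E e mxE.
  have : s * (arc_y t / 2) = 0 by rewrite -y1E e mxE.
  move=> /eqP; rewrite mulf_eq0 (negbTE sn) /= => /eqP h1.
  move=> /eqP; rewrite mulf_eq0 (negbTE sn) /= => /eqP h2.
  by have := arc_neq0 t; rewrite (half_eq0 h1) (half_eq0 h2) eqxx.
have By s t : s ^+ 2 = 1 -> I01 t -> unit_ball R n.+2 (y s t).
  move=> s2; rewrite /= in_itv /= => /andP[t0 t1].
  rewrite /unit_ball /= !big_ord_recl big1; last first.
    by move=> i _; rewrite mxE /= expr0n.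
  by rewrite !mxE /= [_ ^+ 2]exprMn [(s * (arc_y t / 2)) ^+ 2]exprMn s2 !mul1r addr0; exact: arc_bound.
have one2 : (1 : R) ^+ 2 = 1 by rewrite expr1n.
have mone2 : (-1 : R) ^+ 2 = 1 by rewrite sqrrN expr1n.
have cchi s : s ^+ 2 = 1 -> cont_on I01 (fun t => chi (y s t)).
  move=> s2.
  have cgy : cont_on I01 (fun t => g (y s t)).
    apply: (@cont_on_comp _ _ _ _ (unit_ball R n.+2) (y s) g) => //; first by move=> t; exact: By.
    apply: cont_on_mx => i j.
    have -> : (fun t => y s t i j) = (fun t => if j == 0 then s * (arc_x t / 2) else if j == 1 then s * (arc_y t / 2) else 0).
      by apply/funext => t; rewrite mxE.
    case: (j == 0); [|case: (j == 1); last exact: cont_on_cst];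
      by apply: cont_onM; [exact: cont_on_cst|apply: cont_onM => //; exact: cont_on_cst].
  have cc o : cont_on I01 (fun t => g (y s t) o).
    by apply: (@cont_on_comp _ _ _ _ setT _ (fun p : {ptws N -> R} => p o)) cgy (@cont_on_proj _ _ _ o).
  have pgy t : I01 t -> punctured (g (y s t)) by move=> ht; exact/pg/By.
  have clen : cont_on I01 (fun t => len (g (y s t)) * len q).
    apply: cont_onM; last exact: cont_on_cst.
    by apply: cont_on_sqrt; apply: cont_onD; apply: cont_onM.
  have clV : cont_on I01 (fun t => (len (g (y s t)) * len q)^-1).
    by apply: cont_onV => // t ht; rewrite mulf_neq0// gt_eqF// len_gt0//; exact: pgy.
  have cco : cont_on I01 (fun t => co (g (y s t))).
    by apply: cont_onM => //; apply: cont_onD; apply: cont_onM => //; exact: cont_on_cst.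
  apply: cont_onM.
    by apply: cont_onM => //; apply: cont_onB; apply: cont_onM => //; exact: cont_on_cst.
  apply: cont_onV; last by apply: cont_onB => //; exact: cont_on_cst.
  by move=> t ht; rewrite subr_eq0 eq_sym co_neq1//; [exact: By|exact: yn0].
have [||t ht /eqP] := @IVT_odd (fun t => chi (y 1 t) - chi (y (-1) t)).
    by apply: cont_onB; exact: cchi.
  rewrite opprB; congr (chi _ - chi _); apply/rowP => i; rewrite !mxE /arc_x /arc_y;
    by case: (i == 0); [|case: (i == 1) => //]; ring.
rewrite subr_eq0 => /eqP /chi_inj.
have It : I01 t by rewrite /= in_itv.
move=> /(_ (By _ _ one2 It) (By _ _ mone2 It) (yn0 _ _ one2) (yn0 _ _ mone2)) e.
have h1 := congr1 (fun u : 'rV[R]_n.+2 => u ord0 0) e.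
have h2 := congr1 (fun u : 'rV[R]_n.+2 => u ord0 1) e.
move: h1 h2; rewrite !y0E !y1E !mulN1r !mul1r => /half_self h1 /half_self h2.
by have := arc_neq0 t; rewrite h1 h2 eqxx.
Qed.

Lemma punctured2 : ~ topological_ball R K.
Proof.
move=> /punctured_ball[n [f [g [[cf cg] _ hg injf injg]]]].
have [n1|n1] := leqP n 1; first exact: no_injection_1 n1 cf injf.
by apply: no_injection_2 n1 cg _ injg => y /hg[].
Qed.

End TwoCoordinates.

(** Attaching sets have at most two elements, so a link that turns out to be a whole sphere has
    dimension at most one. The intermediate value theorem thus does the work of invariance of
    domain. *)
Lemma punctured_not_ball : (#|E| <= 2)%N -> ~ topological_ball R K.
Proof.
rewrite leq_eqVlt ltnS leq_eqVlt ltnS leqn0 cards_eq0.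
case/or3P => [/cards2P[a [b [ab e]]]|/cards1P[l e]|/eqP e].
- exact: punctured2 ab e.
- exact: punctured1 e.
- exact: punctured0.
Qed.

End NotBall.

(** * Peeling off orthants *)

Section Peel.
Variables (O : finType).
Implicit Types (T Z B X E : {set O}) (P : {set {set O}}).

Lemma in_symdiff T B o : (o \in symdiff T B) = ((o \in T) != (o \in B)).
Proof. by rewrite inE. Qed.

Lemma symdiffC T B : symdiff (~: T) B = ~: symdiff T B.
Proof. by apply/setP => o; rewrite !inE; case: (o \in T); case: (o \in B). Qed.

Lemma symdiff_sub T B : B \subset T -> symdiff T B = T :\: B.
Proof.
move=> BT; apply/setP => o; rewrite !inE; have := fintype.subsetP BT o.
by case: (o \in B) => [->//|_]; case: (o \in T).
Qed.

(* X is attached to the earlier orthants along the coordinates in X. *)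
Definition peel E P T0 (rho : {set O} -> nat) : Prop :=
  forall T, T \in P -> T != T0 -> exists X,
  [/\ X \subset E, (#|X| <= 2)%N,
    forall B, B \subset X -> B != finset.set0 ->
      symdiff T B \in P /\ (rho (symdiff T B) < rho T)%N &
    forall Z, Z \in P -> Z != T -> (Z == T0) || (rho Z <= rho T)%N ->
      exists2 i, i \in X & (i \in T) != (i \in Z)].

Definition peelable E P : Prop := exists2 T0, T0 \in P & exists rho, peel E P T0 rho.

(** Complementing orthants is the antipodal map; it will exchange the x- and y-vertices of a
    face. *)
Lemma peelableC E P : peelable E P -> peelable E (finset (fun T => ~: T \in P)).
Proof.
move=> [T0 T0P [rho h]]; exists (~: T0); first by rewrite inE finset.setCK.
exists (fun T => rho (~: T)) => T; rewrite inE => TP TT0.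
have TT0' : ~: T != T0 by apply: contra TT0 => /eqP <-; rewrite finset.setCK.
have [X [XE X2 hX hZ]] := h _ TP TT0'; exists X; split=> //.
  by move=> B BX B0; rewrite inE -symdiffC; exact: hX.
move=> Z; rewrite inE => ZP ZT hr.
have [||i iX ne] := hZ _ ZP.
- by apply: contra ZT => /eqP e; rewrite -(finset.setCK Z) e finset.setCK.
- by case/orP: hr => [/eqP->|->]; rewrite ?finset.setCK ?eqxx ?orbT.
by exists i => //; move: ne; rewrite !inE; case: (i \in T); case: (i \in Z).
Qed.

(** The question is whether some attaching set is all of [E]. If so, the hypothesis on its subsets
    produces every orthant over [E]; if not, each attachment leaves a free wall and [build_fan]
    applies. *)
Lemma peelable_fan (R : realType) E P : peelable E P ->
  (forall T T', T \in P -> T' \in P -> symdiff T T' \subset E) ->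
  (exists T0, [/\ T0 \in P, conic_homeo (fan (R := R) E [set T0]%SET) (fan E P) &
     E != finset.set0 -> exists2 B : {set O}, B \subset E & symdiff T0 B \notin P]) \/
  ((#|E| <= 2)%N /\ exists2 T, T \in P & forall B, B \subset E -> symdiff T B \in P).
Proof.
move=> [T0 T0P [rho h]] hE.
have hX T : exists X, T \in P -> T != T0 -> [/\ X \subset E, (#|X| <= 2)%N,
    forall B, B \subset X -> B != finset.set0 ->
      symdiff T B \in P /\ (rho (symdiff T B) < rho T)%N &
    forall Z, Z \in P -> Z != T -> (Z == T0) || (rho Z <= rho T)%N ->
      exists2 i, i \in X & (i \in T) != (i \in Z)].
  have [TP|TP] := boolP (T \in P); last by exists finset.set0.
  have [->|TT0] := eqVneq T T0; first by exists finset.set0.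
  by have [X hX] := h _ TP TT0; exists X.
have [A hA] := choice hX.
have [[T [TP TT0 e]]|none] := pselect (exists T, [/\ T \in P, T != T0 & A T = E]).
  have [_ c hB _] := hA _ TP TT0; right; rewrite e in c hB; split=> //.
  exists T => // B BE; have [->|B0] := eqVneq B finset.set0.
    by rewrite (_ : symdiff _ _ = T)//; apply/setP => o; rewrite !inE; case: (o \in T).
  by have [] := hB _ BE B0.
left; exists T0; split=> //; last first.
  move=> /set0Pn[e eE]; apply: contrapT => all.
  have {}all Z : symdiff T0 Z \subset E -> Z \in P.
    move=> ZE; apply/negPn/negP => ZP; apply: all; exists (symdiff T0 Z) => //.
    by rewrite symdiffK.
  pose T1 := symdiff T0 [set e]%SET.
  have T1P : T1 \in P by apply: all; rewrite symdiffK finset.sub1set.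
  have T10 : (T1 \in P) && (T1 != T0).
    rewrite T1P; apply/eqP => /setP/(_ e); rewrite in_symdiff inE eqxx.
    by case: (e \in T0).
  (* If no orthant were missing, take one of largest rank and change a coordinate outside its
     attaching set: the result is an earlier orthant that this set does not separate from it. *)
  have [T /andP[TP TT0] maxT] := @arg_maxnP _ T1 (fun T => (T \in P) && (T != T0)) rho T10.
  have [XE _ _ hZ] := hA _ TP TT0.
  have /set0Pn[c] : E :\: A T != finset.set0.
    apply/negP; rewrite finset.setD_eq0 => EX; apply: none; exists T; split=> //.
    by apply/eqP; rewrite finset.eqEsubset XE.
  rewrite inE => /andP[cX cE].
  have ZP : symdiff T [set c]%SET \in P.
    apply: all; apply/fintype.subsetP => i; rewrite !in_symdiff inE.
    have := fintype.subsetP (hE _ _ T0P TP) i; rewrite in_symdiff.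
    case: (eqVneq i c) => [->//|_]; by case: (i \in T0); case: (i \in T) => //= ->.
  have ZT : symdiff T [set c]%SET != T.
    by apply/eqP => /setP/(_ c); rewrite in_symdiff inE eqxx; case: (c \in T).
  have [|i iX] := hZ _ ZP ZT.
    by case: eqVneq => //= ZT0; apply: maxT; rewrite /= ZP ZT0.
  rewrite in_symdiff inE; case: (eqVneq i c) => [ic|_]; first by rewrite -ic iX in cX.
  by case: (i \in T).
apply: (@build_fan R O E P T0 rho A) => //.
- move=> T TP TT0; have [XE _ hB _] := hA _ TP TT0; split=> //.
  by apply/negP => /eqP e; apply: none; exists T.
- by move=> T Z TP TT0 ZP ZT hr; have [_ _ _ hZ] := hA _ TP TT0; exact: hZ.
Qed.

Lemma card_symdiff_lt T B : B \subset T -> B != finset.set0 -> (#|symdiff T B| < #|T|)%N.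
Proof.
move=> BT B0; rewrite symdiff_sub// cardsDS// ltn_subrL !card_gt0 B0 /=.
by apply: contra B0 => /eqP e; rewrite -finset.subset0 -e.
Qed.

(* The members of J containing Ys and avoiding Xs form a convex geometry:
   they are peeled off by removing extreme points, largest members first. *)
Lemma hull_peel (J : {set {set O}}) (Xs Ys : {set O}) :
  (forall Y, Y \in J -> exists X, [/\ X \subset Y, (#|X| <= 2)%N,
    forall B, B \subset X -> Y :\: B \in J &
    forall Z, Z \in J -> X \subset Z -> Y \subset Z]) ->
  let P := finset (fun T : {set O} => [&& T \in J, Ys \subset T & [disjoint Xs & T]]) in
  (exists T, T \in P) -> peelable (~: (Xs :|: Ys)) P.
Proof.
move=> hJ P [T1 T1P].
have [T0 T0P minT0] := @arg_minnP _ T1 (mem P) (fun T => #|T|) T1P.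
exists T0 => //; exists (fun T : {set O} => #|T|) => T TP TT0.
have := TP; rewrite inE => /and3P[TJ YT XT].
have [X0 [X0T X02 hB hZ]] := hJ _ TJ; exists (X0 :\: Ys).
have XT' : X0 :\: Ys \subset T by apply: fintype.subset_trans X0T; exact: subsetDl.
split.
- apply/fintype.subsetP => o; rewrite !inE negb_or => /andP[-> oX0]; rewrite andbT.
  apply/negP => oXs; have := fintype.subsetP X0T _ oX0.
  by rewrite (disjointFr XT oXs).
- by apply: leq_trans X02; apply: subset_leq_card; exact: subsetDl.
- move=> B BX B0; have BT := fintype.subset_trans BX XT'.
  split; last exact: card_symdiff_lt.
  rewrite inE symdiff_sub//; apply/and3P; split.
  + by apply: hB; apply: fintype.subset_trans BX _; exact: subsetDl.
  + rewrite finset.subsetD YT /= disjoint_sym.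
    apply: (disjointWl BX); rewrite disjoint_subset; apply/fintype.subsetP => o.
    by rewrite !inE => /andP[].
  + by apply: disjointWr XT; exact: subsetDl.
- move=> Z ZP ZT hr.
  have cZ : (#|Z| <= #|T|)%N by case/orP: hr => [/eqP->|//]; exact: minT0.
  have := ZP; rewrite inE => /and3P[ZJ YZ XZ].
  have [//|none] := pselect (exists2 i, i \in X0 :\: Ys & (i \in T) != (i \in Z)).
  case/eqP: ZT; apply/esym/eqP; rewrite eqEcard cZ andbT; apply: hZ => //.
  apply/fintype.subsetP => o oX0; have [/(fintype.subsetP YZ)//|oY] := boolP (o \in Ys).
  apply/negPn/negP => oZ; apply: none; exists o; first by rewrite inE oY.
  by rewrite (negbTE oZ) (fintype.subsetP X0T).
Qed.

End Peel.

Local Close Scope classical_set_scope.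

(** * Two cones over a convex geometry and its complements *)

Section Suspend.
Variable N : finType.
Implicit Types (Y : {set N}) (T : {set option N}).

Definition base T : {set N} := finset (fun i => Some i \in T).
Definition lift_set (s : bool) Y : {set option N} :=
  finset (fun o => if o is Some i then i \in Y else s).

Lemma base_lift s Y : base (lift_set s Y) = Y.
Proof. by apply/setP => i; rewrite !inE. Qed.
Lemma None_lift s Y : (None \in lift_set s Y) = s. Proof. by rewrite inE. Qed.
Lemma in_base T i : (i \in base T) = (Some i \in T). Proof. by rewrite inE. Qed.
Lemma baseC T : base (~: T) = ~: base T.
Proof. by apply/setP => i; rewrite !inE. Qed.
Lemma base_symdiff T (B : {set option N}) : base (symdiff T B) = symdiff (base T) (base B).
Proof. by apply/setP => i; rewrite !inE. Qed.
Lemma base_inj T T' : (None \in T) = (None \in T') -> base T = base T' -> T = T'.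
Proof.
move=> e /setP h; apply/setP => -[i|]; last exact: e.
by have := h i; rewrite !inE.
Qed.
Lemma card_lift Y : #|lift_set false Y| = #|Y|.
Proof.
have inj : injective (@Some N) by move=> i j [].
rewrite -(card_imset _ inj); apply: eq_card => -[i|]; rewrite !inE.
  by rewrite mem_imset.
by apply/esym/negbTE/negP => /imsetP[].
Qed.
Lemma lift_sub Y T : (lift_set false Y \subset T) = (Y \subset base T).
Proof.
apply/fintype.subsetP/fintype.subsetP => h.
  by move=> i iY; rewrite in_base h// inE.
by case=> [i|]; rewrite inE// => /h; rewrite in_base.
Qed.
Lemma base_lift_eq T : None \notin T -> lift_set false (base T) = T.
Proof. by move=> h; apply: base_inj; rewrite ?base_lift// inE (negbTE h). Qed.

Variable I : {set {set N}}.

(* The facets of the cone over the members of I with apex x and of the cone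
   over their complements with apex y. *)
Definition suspension : {set {set option N}} :=
  finset (fun T => (if None \in T then ~: base T else base T) \in I).

(** The [Y] over which both signs of the apex coordinate give a facet of the suspension. *)
Definition middle : {set {set N}} := finset (fun Y => (Y \in I) && (~: Y \in I)).

Lemma suspensionC T : (~: T \in suspension) = (T \in suspension).
Proof. by rewrite !inE baseC finset.setCK; case: (None \in T). Qed.

Hypothesis I_extreme : forall Y, Y \in I -> exists X : {set N}, [/\ X \subset Y, (#|X| <= 2)%N,
    forall B : {set N}, B \subset X -> Y :\: B \in I &
    forall Z : {set N}, Z \in I -> X \subset Z -> Y \subset Z].

(** To be read for an arc and the two elements bordering it: each can be added, the two together
    force the arc, and an arc meeting the given one has to use one of them to get out. *)
Hypothesis I_outer : forall Y, Y \in I -> ~: Y \notin I -> Y != finset.set0 ->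
  exists X : {set N}, [/\ [disjoint X & Y], (#|X| <= 2)%N,
    forall B : {set N}, B \subset X -> Y :|: B \in I,
    forall Z : {set N}, Z \in I -> X \subset Z -> Y \subset Z &
    forall Z : {set N}, Z \in I -> ~~ [disjoint Z & Y] -> [disjoint Z & X] -> Z \subset Y].

(** Fixing one element [f] outside cuts the ring of middle members into a path. One step back along
    it switches a single [p], and this [p] separates [Y] from all earlier members. *)
Hypothesis middle_path : forall f, exists r : {set N} -> nat,
  forall Y Y', Y \in middle -> Y' \in middle -> f \notin Y -> f \notin Y' ->
    (r Y = r Y' -> Y = Y') /\
    ((r Y' < r Y)%N -> exists p, [/\ (p \in Y) != (p \in Y'),
      symdiff Y [set p]%SET \in middle, (r (symdiff Y [set p]%SET) < r Y)%N &
      forall Z : {set N}, Z \in middle -> f \notin Z -> (r Z <= r Y)%N -> Z != Y -> (p \in Y) != (p \in Z)]).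

Implicit Types (Xs Ys Z B X : {set option N}).

(** The facets around the face with x-vertices at [Xs] and y-vertices at [Ys]; its free coordinates
    are the complement of [Xs :|: Ys]. *)
Definition star Xs Ys : {set {set option N}} :=
  finset (fun T => [&& T \in suspension, Ys \subset T & [disjoint Xs & T]]).

Lemma starC Xs Ys : finset (fun T => ~: T \in star Ys Xs) = star Xs Ys.
Proof.
apply/setP => T; rewrite inE /star [LHS]inE [RHS]inE suspensionC.
congr (_ && _); rewrite -finset.disjoints_subset andbC; congr (_ && _).
by rewrite finset.disjoints_subset finset.setCK.
Qed.

Let J : {set {set option N}} := finset (fun T => (None \notin T) && (base T \in I)).

Let J_extreme T : T \in J -> exists X : {set option N}, [/\ X \subset T, (#|X| <= 2)%N,
    forall B : {set option N}, B \subset X -> T :\: B \in J &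
    forall Z, Z \in J -> X \subset Z -> T \subset Z].
Proof.
rewrite inE => /andP[nT TI]; have [X [XT X2 hB hZ]] := I_extreme TI.
exists (lift_set false X); split.
- by rewrite lift_sub.
- by rewrite card_lift.
- move=> B BX; have -> : T :\: B = lift_set false (base T :\: base B).
    by apply: base_inj; [rewrite !inE (negbTE nT) andbF|rewrite base_lift; apply/setP => i; rewrite !inE].
  rewrite !inE base_lift /=; apply: hB; apply/fintype.subsetP => i; rewrite in_base => /(fintype.subsetP BX).
  by rewrite inE.
- move=> Z; rewrite inE => /andP[nZ ZI]; rewrite lift_sub => /(hZ _ ZI).
  by rewrite -(base_lift_eq nT) lift_sub base_lift.
Qed.

(** A face containing the apex x meets only one of the two cones, and there the convex geometry is
    peeled directly. *)
Let peel_apex Xs Ys : None \in Xs -> (exists T, T \in star Xs Ys) ->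
  peelable (~: (Xs :|: Ys)) (star Xs Ys).
Proof.
move=> nX [T TP].
have e : star Xs Ys = finset (fun T : {set option N} => [&& T \in J, Ys \subset T & [disjoint Xs & T]]).
  apply/setP => Z; rewrite !inE.
  have [XZ|] := boolP ([disjoint Xs & Z]); last by rewrite !andbF.
  by rewrite (disjointFr XZ nX).
by rewrite e; apply: hull_peel => //; exists T; rewrite -e.
Qed.

(** Around a face without apex both cones occur. The order has three blocks: the facets with apex x
    by size, then those with apex y over a middle member along the path, then the remaining ones
    with apex y by size of their base. In each block the attaching set comes from one of the three
    hypotheses on [I]. *)
Let peel_base Xs Ys f : None \notin Xs -> None \notin Ys -> Some f \in Xs ->
  (exists T, T \in star Xs Ys) -> peelable (~: (Xs :|: Ys)) (star Xs Ys).
Proof.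
move=> nX nY fX [T1 T1P]; set P := star Xs Ys.
have [r hr] := middle_path f.
(* [m] exceeds all cardinalities and [M] bounds all path ranks, so the three blocks of [rho] do not
   overlap. *)
pose m := (#|{: option N}|).+1; pose M := \max_(Y : {set N}) r Y.
pose rho T : nat := if None \in T then
  (if base T \in I then m + r (base T) else m + M.+1 + #|base T|)%N else #|T|.
have rM Y : (r Y <= M)%N by exact: leq_bigmax.
have cm T : (#|T| < m)%N by rewrite ltnS max_card.
have big a T : (m + a <= #|T|)%N = false.
  by apply/negbTE; rewrite -ltnNge; apply: leq_trans (cm T) (leq_addr _ _).
have small a T : (#|T| < m + a)%N by apply: leq_trans (cm T) (leq_addr _ _).
have inP T : T \in P -> [/\ (if None \in T then ~: base T else base T) \in I,
    Ys \subset T, [disjoint Xs & T] & f \notin base T].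
  rewrite inE => /and3P[]; rewrite inE => h1 h2 h3; split=> //.
  by rewrite in_base (disjointFr h3 fX).
have symP T (B : {set option N}) : T \in P -> B \subset ~: (Xs :|: Ys) ->
    symdiff T B \in suspension -> symdiff T B \in P.
  move=> /inP[_ YT XT _] BE h; rewrite inE h /=; apply/andP; split.
    apply/fintype.subsetP => o oY; rewrite inE (fintype.subsetP YT _ oY).
    by case: (boolP (o \in B)) => // /(fintype.subsetP BE); rewrite !inE oY orbT.
  rewrite disjoint_subset; apply/fintype.subsetP => o oX; rewrite !inE.
  rewrite (disjointFr XT oX); case: (boolP (o \in B)) => // /(fintype.subsetP BE).
  by rewrite !inE oX.
(* If no facet has apex x, then none lies over a middle member either, because its apex could be
   switched; the third block is then peeled alone. *)
have [T0 [T0P T0min]] : exists T0, T0 \in P /\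
    ((None \notin T0 /\ forall T, T \in P -> None \notin T -> (#|T0| <= #|T|)%N) \/
     ((forall T, T \in P -> None \in T) /\ forall T, T \in P -> (#|base T0| <= #|base T|)%N)).
  have [[T2 T2P]|none] := pselect (exists T, (T \in P) && (None \notin T)).
    have [T0 /andP[T0P nT0] T0min] := @arg_minnP _ T2 (fun T => (T \in P) && (None \notin T)) (fun T => #|T|) T2P.
    by exists T0; split=> //; left; split=> // T TP nT; apply: T0min; rewrite TP.
  have [T0 T0P T0min] := @arg_minnP _ T1 (mem P) (fun T => #|base T|) T1P.
  exists T0; split=> //; right; split=> // T TP.
  by apply/negPn/negP => nT; apply: none; exists T; rewrite TP.
exists T0 => //; exists rho => T TP TT0.
have [TI YT XT fT] := inP _ TP.
have [nT|nT] := boolP (None \in T); last first.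
  (* T lies in the cone with apex x *)
  case: T0min => [[nT0 T0min]|[all _]]; last by rewrite all in nT.
  have TJ : T \in J by rewrite inE nT; move: TI; rewrite (negbTE nT).
  have [X0 [X0T X02 hB hZ]] := J_extreme TJ; exists (X0 :\: Ys).
  have XT' : X0 :\: Ys \subset T by apply: fintype.subset_trans X0T; exact: subsetDl.
  have XE : X0 :\: Ys \subset ~: (Xs :|: Ys).
    apply/fintype.subsetP => o; rewrite !inE negb_or => /andP[-> oX0]; rewrite andbT.
    by apply/negP => oXs; have := fintype.subsetP X0T _ oX0; rewrite (disjointFr XT oXs).
  split=> //.
  - by apply: leq_trans X02; apply: subset_leq_card; exact: subsetDl.
  - move=> B BX B0; have BT := fintype.subset_trans BX XT'.
    have : T :\: B \in J by apply: hB; apply: fintype.subset_trans BX _; exact: subsetDl.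
    rewrite inE -symdiff_sub// => /andP[nS SI]; split.
      by apply: symP => //; [exact: fintype.subset_trans XE|rewrite inE (negbTE nS)].
    by rewrite /rho (negbTE nS) (negbTE nT) card_symdiff_lt.
  - move=> Z ZP ZT hz; have [ZI YZ XZ fZ] := inP _ ZP.
    have [nZ cZ] : None \notin Z /\ (#|Z| <= #|T|)%N.
      case/orP: hz => [/eqP->|]; first by split=> //; exact: T0min.
      by rewrite /rho (negbTE nT); case: ifP => // _; case: ifP => _; rewrite -?addnA big.
    have ZJ : Z \in J by rewrite inE nZ; move: ZI; rewrite (negbTE nZ).
    have [//|none] := pselect (exists2 i, i \in X0 :\: Ys & (i \in T) != (i \in Z)).
    case/eqP: ZT; apply/esym/eqP; rewrite eqEcard cZ andbT; apply: hZ => //.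
    apply/fintype.subsetP => o oX0; have [/(fintype.subsetP YZ)//|oY] := boolP (o \in Ys).
    apply/negPn/negP => oZ; apply: none; exists o; first by rewrite inE oY.
    by rewrite (negbTE oZ) (fintype.subsetP X0T).
rewrite nT in TI.
have supp_free i T' : T' \in P -> (i \in T) != (i \in T') -> i \in ~: (Xs :|: Ys).
  move=> /inP[_ YT' XT' _] ne; rewrite !inE negb_or; apply/andP; split; apply/negP => h.
    by move: ne; rewrite (disjointFr XT h) (disjointFr XT' h).
  by move: ne; rewrite (fintype.subsetP YT _ h) (fintype.subsetP YT' _ h).
have nE : None \in ~: (Xs :|: Ys) by rewrite !inE negb_or nX.
have [TM|TnM] := boolP (base T \in I).
  (* T lies over a facet common to both cones *)
  have midT : base T \in middle by rewrite inE TM.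
  have T'P : symdiff T [set None]%SET \in P.
    apply: symP => //; first by rewrite finset.sub1set.
    rewrite inE base_symdiff in_symdiff nT !inE /=.
    by rewrite (_ : symdiff _ _ = base T)//; apply/setP => i; rewrite !inE; case: (_ \in T).
  case: T0min => [[nT0 T0min]|[all _]]; last first.
    by have := all _ T'P; rewrite in_symdiff nT !inE.
  have ZT0 Z : None \in Z -> (Z == T0) || (rho Z <= rho T)%N -> base Z \in I /\ (r (base Z) <= r (base T))%N.
    move=> nZ /orP[/eqP e|]; first by move: nT0; rewrite -e nZ.
    rewrite /rho nZ nT TM; case: ifP => _; first by rewrite leq_add2l.
    rewrite -addnA leq_add2l addSn => h.
    by have := leq_trans (leq_ltn_trans (leq_addr _ _) h) (rM (base T)); rewrite ltnn.
  (* A facet over a middle member is attached along the apex coordinate and, unless it is the first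
     on its path, also along the coordinate [p] of the step back. *)
  have [[T' [T'P' nT' T'I lt]]|first] := pselect (exists T', [/\ T' \in P, None \in T', base T' \in I & (r (base T') < r (base T))%N]).
    have [T'I' _ _ fT'] := inP _ T'P'; rewrite nT' in T'I'.
    have midT' : base T' \in middle by rewrite inE T'I.
    have [_ /(_ lt)[p [pne pM plt pZ]]] := hr _ _ midT midT' fT fT'.
    have pE : Some p \in ~: (Xs :|: Ys).
      by apply: supp_free T'P' _; move: pne; rewrite !in_base.
    exists [set None; Some p]%SET.
    have XE : [set None; Some p]%SET \subset ~: (Xs :|: Ys).
      by apply/fintype.subsetP => o; rewrite finset.in_set2 => /orP[] /eqP->.
    split=> //.
    + by rewrite cards2.
    + move=> B BX B0.
      have bB : base B = finset.set0 \/ base B = [set p]%SET.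
        have [pB|pB] := boolP (Some p \in B); [right|left]; apply/setP => i; rewrite !inE.
          apply/idP/eqP => [/(fintype.subsetP BX)|->//].
          by rewrite finset.in_set2 /= => /eqP[].
        apply/negP => iB; have := fintype.subsetP BX _ iB.
        by rewrite finset.in_set2 /= => /eqP[e]; move: pB; rewrite -e iB.
      have s0 : symdiff (base T) finset.set0 = base T.
        by apply/setP => i; rewrite !inE; case: (_ \in T).
      have bM : base (symdiff T B) \in middle.
        by rewrite base_symdiff; case: bB => ->; rewrite ?s0.
      move: (bM); rewrite inE => /andP[bI bCI]; split.
        by apply: symP => //; [exact: fintype.subset_trans XE|rewrite inE; case: ifP].
      rewrite /rho nT TM bI; case: ifP => [nB|_]; last exact: small.
      rewrite ltn_add2l base_symdiff; case: bB => eB; last by rewrite eB.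
      case/eqP: B0; apply: base_inj; last by rewrite eB; apply/setP => i; rewrite !inE.
      by move: nB; rewrite in_symdiff nT inE; case: (None \in B).
    + move=> Z ZP ZT hz; have [ZI YZ XZ fZ] := inP _ ZP.
      have [nZ|nZ] := boolP (None \in Z); last first.
        by exists None; rewrite ?finset.in_set2// nT (negbTE nZ).
      rewrite nZ in ZI; have [bZ rZ] := ZT0 _ nZ hz.
      exists (Some p); first by rewrite finset.in_set2 eqxx orbT.
      rewrite -!in_base; apply: pZ => //; first by rewrite inE bZ.
      by apply: contra ZT => /eqP e; apply/eqP/base_inj => //; rewrite nT nZ.
  exists [set None]%SET; split.
  - by rewrite finset.sub1set.
  - by rewrite cards1.
  - move=> B; rewrite finset.subset1 => /orP[/eqP->|/eqP->]; last by rewrite eqxx.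
    move=> _; split=> //; rewrite /rho nT TM in_symdiff nT inE eqxx /=.
    exact: small.
  - move=> Z ZP ZT hz; have [ZI YZ XZ fZ] := inP _ ZP.
    exists None; first by rewrite inE.
    rewrite nT; apply/negP => /eqP/esym nZ; rewrite nZ in ZI; have [bZ rZ] := ZT0 _ nZ hz.
    have midZ : base Z \in middle by rewrite inE bZ.
    move: rZ; rewrite leq_eqVlt => /orP[/eqP e|lt]; last by apply: first; exists Z.
    by case/eqP: ZT; apply: base_inj; [rewrite nT nZ|exact: (hr _ _ midZ midT fZ fT).1].
(* T lies over a facet of the cone with apex y only *)
have bT0 : ~: base T != finset.set0 by apply/set0Pn; exists f; rewrite inE.
have CCI : ~: ~: base T \notin I by rewrite finset.setCK.
have [X0 [X0T X02 hB hF6 hF5]] := I_outer TI CCI bT0.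
have X0T' : X0 \subset base T by rewrite finset.disjoints_subset finset.setCK in X0T.
have XT' : lift_set false X0 :\: Ys \subset T.
  by apply: fintype.subset_trans (_ : lift_set false X0 \subset T); [exact: subsetDl|rewrite lift_sub].
have XE : lift_set false X0 :\: Ys \subset ~: (Xs :|: Ys).
  apply/fintype.subsetP => o; rewrite inE => /andP[oY oX0]; rewrite !inE negb_or oY andbT.
  have oT : o \in T by apply: (fintype.subsetP XT'); rewrite inE oY.
  by apply/negP => oXs; move: oT; rewrite (disjointFr XT oXs).
exists (lift_set false X0 :\: Ys); split=> //.
- by rewrite -card_lift in X02; apply: leq_trans X02; apply: subset_leq_card; exact: subsetDl.
- move=> B BX B0; have BT := fintype.subset_trans BX XT'.
  have nB : None \notin B by apply/negP => /(fintype.subsetP BX); rewrite !inE andbF.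
  have bB0 : base B != finset.set0.
    apply: contra B0 => /eqP e; apply/eqP/base_inj; first by rewrite (negbTE nB) inE.
    by rewrite e; apply/setP => i; rewrite !inE.
  have bBX : base B \subset X0.
    apply/fintype.subsetP => i; rewrite in_base => /(fintype.subsetP BX).
    by rewrite inE => /andP[_]; rewrite inE.
  have nS : None \in symdiff T B by rewrite in_symdiff nT (negbTE nB).
  have bBT := fintype.subset_trans bBX X0T'.
  have cS : (#|base (symdiff T B)| < #|base T|)%N.
    by rewrite base_symdiff; exact: card_symdiff_lt.
  split.
    apply: symP => //; first exact: fintype.subset_trans XE.
    rewrite inE nS base_symdiff symdiff_sub// finset.setCD; exact: hB.
  rewrite /rho nS nT (negbTE TnM); case: ifP => _; last by rewrite ltn_add2l.
  by rewrite -addnA ltn_add2l addSn ltnS; apply: leq_trans (rM _) (leq_addr _ _).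
- move=> Z ZP ZT hz; have [ZI YZ XZ fZ] := inP _ ZP.
  have [//|none] := pselect (exists2 i, i \in lift_set false X0 :\: Ys & (i \in T) != (i \in Z)).
  have X0Z : X0 \subset base Z.
    rewrite -lift_sub; apply/fintype.subsetP => o oX0.
    have [/(fintype.subsetP YZ)//|oY] := boolP (o \in Ys).
    apply/negPn/negP => oZ; apply: none; exists o; first by rewrite inE oY.
    by rewrite (negbTE oZ) (fintype.subsetP XT')// inE oY.
  have nbZ : base Z \notin I.
    by apply/negP => bZ; have /fintype.subsetP/(_ f) := hF6 _ bZ X0Z; rewrite inE fT (negbTE fZ) => /(_ isT).
  have [nZ|nZ] := boolP (None \in Z); last by rewrite (negbTE nZ) (negbTE nbZ) in ZI.
  rewrite nZ in ZI.
  (* Both complements contain [f], so they meet and the last clause of [I_outer] applies. *)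
  have sub : ~: base Z \subset ~: base T.
    apply: hF5 => //.
      by apply/pred0Pn; exists f; rewrite !inE -!in_base fT fZ.
    by rewrite disjoint_sym finset.disjoints_subset finset.setCK.
  have cZ : (#|base Z| <= #|base T|)%N.
    case/orP: hz => [/eqP e|].
      case: T0min => [[nT0 _]|[_ T0min]]; first by move: nT0; rewrite -e nZ.
      by rewrite e; exact: T0min.
    by rewrite /rho nZ nT (negbTE nbZ) (negbTE TnM) leq_add2l.
  case/eqP: ZT; apply: base_inj; first by rewrite nT nZ.
  by apply/esym/eqP; rewrite eqEcard cZ andbT; rewrite finset.setCS in sub.
Qed.

(** Complementation exchanges [Xs] with [Ys] and the two apexes, which leaves the cases of
    [peel_apex] and [peel_base]. *)
Lemma peel_star Xs Ys : Xs :|: Ys != finset.set0 -> (exists T, T \in star Xs Ys) ->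
  peelable (~: (Xs :|: Ys)) (star Xs Ys).
Proof.
have swap Xs' Ys' : (exists T, T \in star Xs' Ys') -> (exists T, T \in star Ys' Xs').
  by move=> [T TP]; exists (~: T); rewrite -starC inE finset.setCK.
move=> /set0Pn[q hq] ex.
have [nX|nX] := boolP (None \in Xs); first exact: peel_apex.
have [nY|nY] := boolP (None \in Ys).
  by rewrite -starC finset.setUC; apply: peelableC; apply: peel_apex => //; exact: swap.
case: q hq => [f|]; last by rewrite inE (negbTE nX) (negbTE nY).
rewrite inE => /orP[fX|fY]; first exact: peel_base fX ex.
rewrite -starC finset.setUC; apply: peelableC; apply: peel_base fY _ => //; exact: swap.
Qed.

End Suspend.

Local Close Scope ring_scope.

(** * Cyclic arcs *)

Section ArcArithmetic.
Variables d h : nat.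
Hypotheses (d5 : 5 <= d) (dh : d <= h + h) (hd : h + h <= d.+1).

Definition arc_pat (w : bool) (u v p : nat) : bool :=
  if w then (p < v) || (u <= p) else (u <= p) && (p < v).

(** The flag [w] says that the arc passes from d - 1 to 0. The two bounds on the length, h and d + 1
    - h, agree for odd d; for even d the wrapping arcs of length d/2 + 1 are the facets added by the
    antipodes of [gamma]. *)
Definition arc_ok (w : bool) (u v : nat) : bool :=
  if w then [&& 0 < v, v + h <= u.+1 & u < d] else [&& u <= v, v <= d & v <= u + h].

(** An arc through both ends that went round the other way would contain the complement and the two
    ends, and be longer than [arc_ok] allows. *)
Lemma arc_hull w u v w' u' v' p : arc_ok w u v -> arc_ok w' u' v' -> p < d ->
  arc_pat w' u' v' u -> arc_pat w' u' v' v.-1 -> arc_pat w u v p -> arc_pat w' u' v' p.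
Proof. by rewrite /arc_ok /arc_pat; case: w; case: w'; lia. Qed.

Lemma arc_remove w u v (A B : bool) : arc_ok w u v -> w || (u < v) ->
  exists w' u' v', arc_ok w' u' v' /\ forall p, p < d -> arc_pat w' u' v' p =
    arc_pat w u v p && ~~ ((p == u) && A || (p == v.-1) && B).
Proof.
rewrite /arc_ok /arc_pat; case: w => /=.
  move=> h1 _.
  case: (altP (v - B =P 0)) => [e0|e0]; case: (altP (u + A =P d)) => [e1|e1].
  - exists false, 0, 0; split; first by lia.
    by move=> p pd; apply/idP/idP; case: A B e0 e1 => [] []; lia.
  - exists false, (u + A), d; split; first by lia.
    by move=> p pd; apply/idP/idP; case: A B e0 e1 => [] []; lia.
  - exists false, 0, (v - B); split; first by lia.
    by move=> p pd; apply/idP/idP; case: A B e0 e1 => [] []; lia.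
  - exists true, (u + A), (v - B); split; first by lia.
    by move=> p pd; apply/idP/idP; case: A B e0 e1 => [] []; lia.
move=> h1 h2; case: (leqP (u + A) (v - B)) => e.
  exists false, (u + A), (v - B); split; first by lia.
  by move=> p pd; apply/idP/idP; case: A B e => [] []; lia.
exists false, 0, 0; split; first by lia.
by move=> p pd; apply/idP/idP; case: A B e => [] []; lia.
Qed.

Definition before (w : bool) u := if ~~ w && (u == 0) then d.-1 else u.-1.
Definition after (w : bool) v := if ~~ w && (v == d) then 0 else v.

(* The complement of the arc is too long to be an arc. *)
Definition small_arc (w : bool) u v : bool :=
  if w then v + h < u
  else if u == 0 then v + h < d else if v == d then h < u else v.+1 < u + h.

Lemma arc_add w u v (A B : bool) : arc_ok w u v -> w || (u < v) -> small_arc w u v ->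
  exists w' u' v', arc_ok w' u' v' /\ forall p, p < d -> arc_pat w' u' v' p =
    arc_pat w u v p || ((p == before w u) && A || (p == after w v) && B).
Proof.
rewrite /arc_ok /arc_pat /small_arc /before /after; case: w => /=.
  move=> h1 _ h2; exists true, (u - A), (v + B); split; first by lia.
  by move=> p pd; apply/idP/idP; case: A; case: B; lia.
case: eqVneq => u0; last case: eqVneq => vd.
- move=> h1 h2 h3; have -> : (v == d) = false by lia.
  case: A.
    exists true, d.-1, (v + B); split; first by lia.
    by move=> p pd; apply/idP/idP; case: B; lia.
  exists false, 0, (v + B); split; first by lia.
  by move=> p pd; apply/idP/idP; case: B; lia.
- move=> h1 h2 h3; case: B.
    exists true, (u - A), 1; split; first by lia.
    by move=> p pd; apply/idP/idP; case: A; lia.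
  exists false, (u - A), d; split; first by lia.
  by move=> p pd; apply/idP/idP; case: A; lia.
- move=> h1 h2 h3; exists false, (u - A), (v + B); split; first by lia.
  by move=> p pd; apply/idP/idP; case: A; case: B; lia.
Qed.

Lemma neighbours w u v : arc_ok w u v -> w || (u < v) -> small_arc w u v ->
  [&& before w u < d, after w v < d, ~~ arc_pat w u v (before w u) & ~~ arc_pat w u v (after w v)].
Proof.
rewrite /arc_ok /arc_pat /small_arc /before /after.
by case: w => /=; [|case: eqVneq => u0; case: eqVneq => vd /=]; lia.
Qed.

(** The arc enlarged by both neighbours is still an arc, hence the hull of these two. *)
Lemma arc_surround w u v w' u' v' p : arc_ok w u v -> w || (u < v) -> small_arc w u v ->
  arc_ok w' u' v' -> p < d -> arc_pat w' u' v' (before w u) -> arc_pat w' u' v' (after w v) ->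
  arc_pat w u v p -> arc_pat w' u' v' p.
Proof.
rewrite /arc_ok /arc_pat /small_arc /before /after.
by case: w => /=; [|case: eqVneq => u0; case: eqVneq => vd /=]; case: w' => /=; lia.
Qed.

(** Arcs are connected on the circle, so one that meets the given arc and avoids both neighbours
    cannot leave it. *)
Lemma arc_inside w u v w' u' v' q p : arc_ok w u v -> w || (u < v) -> small_arc w u v ->
  arc_ok w' u' v' -> p < d -> q < d -> ~~ arc_pat w' u' v' (before w u) ->
  ~~ arc_pat w' u' v' (after w v) -> arc_pat w u v q -> arc_pat w' u' v' q ->
  arc_pat w' u' v' p -> arc_pat w u v p.
Proof.
rewrite /arc_ok /arc_pat /small_arc /before /after.
by case: w => /=; [|case: eqVneq => u0; case: eqVneq => vd /=]; case: w' => /=; lia.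
Qed.

(* The position of p among the crossings along the ring of facets common to
   both cones: 0, h, 1, h + 1, 2, ... *)
Definition crossing (p : nat) := if p < h then p.*2 else (p - h).*2.+1.

Lemma crossing_lt p : p < d -> crossing p < d.
Proof. by rewrite /crossing; case: ifP; lia. Qed.

Lemma crossing_inj p q : p < d -> q < d -> crossing p = crossing q -> p = q.
Proof. by rewrite /crossing; do 2!case: ifP; lia. Qed.

(** The ring starts at the arc [0, h) and alternately drops its first element and adds the next one
    at the end. After t = a + b crossings, a being b or b + 1, it has reached [a, h + b); the second
    claim concerns the complement, on the opposite side of the ring. *)
Lemma ring_arc t : t <= d -> 
  (exists w u v, arc_ok w u v /\ forall p, p < d -> arc_pat w u v p = ((crossing p < t) == (h <= p))) /\
  (exists w u v, arc_ok w u v /\ forall p, p < d -> arc_pat w u v p = ~~ ((crossing p < t) == (h <= p))).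
Proof.
move=> td; have [a [b [et tb]]] : exists a b, t = a + b /\ b <= a <= b.+1.
  by exists (t - t./2), t./2; lia.
rewrite /arc_ok /arc_pat /crossing; split.
  exists false, a, (h + b); split; first by lia.
  by move=> p pd; apply/idP/idP; case: (ltnP p h); lia.
case: (posnP a) => a0; last case: (leqP d (h + b)) => hb.
- exists false, h, d; split; first by lia.
  by move=> p pd; apply/idP/idP; case: (ltnP p h); lia.
- exists false, 0, a; split; first by lia.
  by move=> p pd; apply/idP/idP; case: (ltnP p h); lia.
- exists true, (h + b), a; split; first by lia.
  by move=> p pd; apply/idP/idP; case: (ltnP p h); lia.
Qed.

Lemma arc_ring w u v : arc_ok w u v -> w || (u < v) -> ~~ small_arc w u v ->
  exists s t, t <= d /\ forall p, p < d -> arc_pat w u v p = s (+) ((crossing p < t) == (h <= p)).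
Proof.
rewrite /arc_ok /arc_pat /crossing /small_arc; case: w => /=.
  move=> h1 _ h2; case: (eqVneq u (v + h)) => e.
    exists true, v.*2; split; first by lia.
    by move=> p pd; apply/idP/idP; case: (ltnP p h); lia.
  exists true, v.*2.-1; split; first by lia.
  by move=> p pd; apply/idP/idP; case: (ltnP p h); lia.
case: eqVneq => u0; last case: eqVneq => vd; move=> h1 h2 h3.
- case: (eqVneq v h) => e.
    exists false, 0; split; first by lia.
    by move=> p pd; apply/idP/idP; case: (ltnP p h); lia.
  exists true, d.-1; split; first by lia.
  by move=> p pd; apply/idP/idP; case: (ltnP p h); lia.
- case: (eqVneq u h) => e.
    exists false, d; split; first by lia.
    by move=> p pd; apply/idP/idP; case: (ltnP p h); lia.
  exists false, d.-1; split; first by lia.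
  by move=> p pd; apply/idP/idP; case: (ltnP p h); lia.
- case: (eqVneq v (u + h)) => e.
    exists false, u.*2; split; first by lia.
    by move=> p pd; apply/idP/idP; case: (ltnP p h); lia.
  exists false, u.*2.-1; split; first by lia.
  by move=> p pd; apply/idP/idP; case: (ltnP p h); lia.
Qed.

(* Along the members of the ring that avoid f every element is crossed at most
   once; turn is the order in which this happens. *)
Definition turn f p := if crossing f < crossing p then crossing p - (crossing f).+1
  else crossing p + d - (crossing f).+1.

Definition crossed f (y : nat -> bool) p :=
  ((y p == (h <= p)) (+) (f < h)) (+) (crossing p < crossing f).

Lemma turn_inj f p q : p < d -> q < d -> f < d -> p != f -> q != f -> turn f p = turn f q -> p = q.
Proof.
move=> pd qd fd pf qf.
have := crossing_lt pd; have := crossing_lt qd; have := crossing_lt fd.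
have hp : crossing p != crossing f by apply: contra pf => /eqP/(crossing_inj pd fd)->.
have hq : crossing q != crossing f by apply: contra qf => /eqP/(crossing_inj qd fd)->.
move=> h1 h2 h3 e; apply: crossing_inj => //; move: e; rewrite /turn.
by do 2!case: ifP; lia.
Qed.

(** The members avoiding [f] make up half of the ring, on which every other element switches exactly
    once; a single threshold [c] in the order [turn] therefore describes a member. *)
Lemma ring_turn f y s t : t <= d -> f < d -> y f = false ->
  (forall p, p < d -> y p = s (+) ((crossing p < t) == (h <= p))) ->
  exists c, c < d /\ forall p, p < d -> p != f -> crossed f y p = (c <= turn f p).
Proof.
move=> td fd yf hy; exists (if crossing f < t then t - (crossing f).+1 else t + d - (crossing f).+1).
have fc := crossing_lt fd; split; first by case: ifP; lia.
move=> p pd pf; have pc := crossing_lt pd.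
have hp : crossing p != crossing f by apply: contra pf => /eqP/(crossing_inj pd fd)->.
have boolE (b x z w y1 y2 : bool) : b (+) (z == w) = false ->
    ((b (+) (x == y1)) == y1) (+) ~~ w (+) y2 = z (+) x (+) y2.
  by case: b x z w y1 y2 => [] [] [] [] [] [].
move: yf; rewrite (hy _ fd) /crossed (hy _ pd) (ltnNge f h) => /boolE->.
rewrite /turn; move: (crossing p) (crossing f) fc pc hp => P F fc pc hp.
by case: (ltngtP P F) hp => // PF _; case: (ltnP F t) => Ft; case: (ltnP P t) => Pt;
  apply/esym; rewrite /=; lia.
Qed.

Lemma turn_ring f y c : c < d -> f < d -> y f = false ->
  (forall p, p < d -> p != f -> crossed f y p = (c <= turn f p)) ->
  exists s t, t <= d /\ forall p, p < d -> y p = s (+) ((crossing p < t) == (h <= p)).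
Proof.
move=> cd fd yf hy; have fc := crossing_lt fd.
pose t := if (crossing f).+1 + c <= d then (crossing f).+1 + c else (crossing f).+1 + c - d.
exists ((crossing f < t) == (h <= f)), t; split; first by rewrite /t; case: ifP; lia.
move=> p pd; have [->|pf] := eqVneq p f; first by rewrite yf addbb.
have pc := crossing_lt pd.
have hp : crossing p != crossing f by apply: contra pf => /eqP/(crossing_inj pd fd)->.
have boolE (a b w y1 y2 x z : bool) : ((a == y1) (+) ~~ w) (+) y2 = b -> b = z (+) x (+) y2 ->
    a = (z == w) (+) (x == y1).
  by case: a b w y1 y2 x z => [] [] [] [] [] [] [].
move: (hy _ pd pf); rewrite /crossed (ltnNge f h) => /boolE; apply.
rewrite /turn /t; move: (crossing p) (crossing f) fc pc hp => P F fc pc hp.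
by case: (ltngtP P F) hp => // PF _; (case: (leqP (F.+1 + c) d) => Fc;
  [case: (ltnP F (F.+1 + c)) => Ft; case: (ltnP P (F.+1 + c)) => Pt
  |case: (ltnP F (F.+1 + c - d)) => Ft; case: (ltnP P (F.+1 + c - d)) => Pt]);
  rewrite /=; lia.
Qed.

End ArcArithmetic.

(** * Arcs form a convex geometry whose middle members are a ring *)

Section Arcs.
Variable d : nat.
Hypothesis d5 : 5 <= d.
Let h := uphalf d.
Let dh : d <= h + h. Proof. by rewrite /h; lia. Qed.
Let hd : h + h <= d.+1. Proof. by rewrite /h; lia. Qed.
Implicit Types Y Z B X : {set 'I_d}.

Definition arcs : {set {set 'I_d}} :=
  finset (fun Y => [exists w : bool, exists u : 'I_d.+1, exists v : 'I_d.+1,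
    arc_ok d h w u v && [forall p : 'I_d, (p \in Y) == arc_pat w u v p]]).

Lemma arcsP Y : reflect (exists w u v, arc_ok d h w u v /\ forall p : 'I_d, (p \in Y) = arc_pat w u v p)
  (Y \in arcs).
Proof.
rewrite inE; apply: (iffP existsP) => [[w /existsP[u /existsP[v /andP[ok /forallP e]]]]|[w [u [v [ok e]]]]].
  by exists w, u, v; split=> // p; exact/eqP.
have ud : u < d.+1 by move: ok; rewrite /arc_ok; case: w {e}; lia.
have vd : v < d.+1 by move: ok; rewrite /arc_ok; case: w {e}; lia.
exists w; apply/existsP; exists (Ordinal ud); apply/existsP; exists (Ordinal vd).
by rewrite ok; apply/forallP => p; rewrite e.
Qed.

Lemma arcs0 : finset.set0 \in arcs.
Proof.
by apply/arcsP; exists false, 0, 0; split=> // p; rewrite inE /arc_pat ltn0 andbF.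
Qed.

Lemma arcsT : finset.setT \notin arcs.
Proof.
apply/negP => /arcsP[w [u [v [ok e]]]].
have d0 : 0 < d by exact: leq_trans d5.
have d1 : d.-1 < d by rewrite prednK.
case: w ok e => ok e.
  have vd : v < d by move: ok; rewrite /arc_ok; lia.
  by have := e (Ordinal vd); rewrite !inE /arc_pat /=; move: ok; rewrite /arc_ok; lia.
have := e (Ordinal d0); have := e (Ordinal d1); rewrite !inE /arc_pat /=.
by move: ok; rewrite /arc_ok; lia.
Qed.

Let nonempty_arc Y w u v : arc_ok d h w u v -> (forall p : 'I_d, (p \in Y) = arc_pat w u v p) ->
  Y != finset.set0 -> w || (u < v).
Proof.
move=> ok e /set0Pn[p]; rewrite e; move: ok; rewrite /arc_ok /arc_pat.
by case: w {e} => //=; lia.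
Qed.

Lemma arcs_extreme Y : Y \in arcs -> exists X, [/\ X \subset Y, #|X| <= 2,
    forall B, B \subset X -> Y :\: B \in arcs &
    forall Z, Z \in arcs -> X \subset Z -> Y \subset Z].
Proof.
move=> YI; have [->|Y0] := eqVneq Y finset.set0.
  exists finset.set0; rewrite cards0; split=> // B; rewrite finset.subset0 => /eqP->.
  by rewrite finset.setDv arcs0.
have /arcsP[w [u [v [ok e]]]] := YI.
have uv := nonempty_arc ok e Y0.
have ud : u < d by move: ok uv; rewrite /arc_ok; case: w {e} => /=; lia.
have vd : v.-1 < d by move: ok uv; rewrite /arc_ok; case: w {e} => /=; lia.
exists [set Ordinal ud; Ordinal vd]; split.
- apply/fintype.subsetP => p; rewrite finset.in_set2 => /orP[] /eqP->; rewrite e /= /arc_pat;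
    by move: ok uv; rewrite /arc_ok; case: w {e} => /=; lia.
- by rewrite cards2; case: (_ != _).
- move=> B BX.
  have [w' [u' [v' [ok' e']]]] := arc_remove d5 dh hd (Ordinal ud \in B) (Ordinal vd \in B) ok uv.
  apply/arcsP; exists w', u', v'; split=> // p; rewrite e' ?ltn_ord// inE e andbC; congr (_ && ~~ _).
  apply/idP/orP => [pB|[] /andP[/eqP ep]]; last 2 first.
  + by rewrite (_ : Ordinal ud = p)//; exact/val_inj.
  + by rewrite (_ : Ordinal vd = p)//; exact/val_inj.
  have := fintype.subsetP BX _ pB; rewrite finset.in_set2 => /orP[] /eqP ep; [left|right];
    by rewrite -ep pB ep /= eqxx.
- move=> Z /arcsP[w' [u' [v' [ok' e']]]] XZ; apply/fintype.subsetP => p; rewrite e e' => py.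
  apply: (arc_hull d5 dh hd ok ok' _ _ _ py) => //.
    by rewrite -(e' (Ordinal ud)); apply: (fintype.subsetP XZ); rewrite finset.in_set2 eqxx.
  by rewrite -(e' (Ordinal vd)); apply: (fintype.subsetP XZ); rewrite finset.in_set2 eqxx orbT.
Qed.

Lemma small_arc_outer Y w u v : arc_ok d h w u v -> (forall p : 'I_d, (p \in Y) = arc_pat w u v p) ->
  Y != finset.set0 -> small_arc d h w u v ->
  exists X, [/\ [disjoint X & Y], #|X| <= 2,
    forall B, B \subset X -> Y :|: B \in arcs,
    forall Z, Z \in arcs -> X \subset Z -> Y \subset Z &
    forall Z, Z \in arcs -> ~~ [disjoint Z & Y] -> [disjoint Z & X] -> Z \subset Y].
Proof.
move=> ok e Y0 sm; have uv := nonempty_arc ok e Y0.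
have /and4P[ad bd na nb] := neighbours d5 dh hd ok uv sm.
exists [set Ordinal ad; Ordinal bd]; split.
- rewrite disjoint_subset; apply/fintype.subsetP => p; rewrite finset.in_set2 !inE.
  by case/orP => /eqP->; rewrite e.
- by rewrite cards2; case: (_ != _).
- move=> B BX.
  have [w' [u' [v' [ok' e']]]] := arc_add d5 dh hd (Ordinal ad \in B) (Ordinal bd \in B) ok uv sm.
  apply/arcsP; exists w', u', v'; split=> // p; rewrite e' ?ltn_ord// inE e; congr (_ || _).
  apply/idP/orP => [pB|[] /andP[/eqP ep]]; last 2 first.
  + by rewrite (_ : Ordinal ad = p)//; exact/val_inj.
  + by rewrite (_ : Ordinal bd = p)//; exact/val_inj.
  have := fintype.subsetP BX _ pB; rewrite finset.in_set2 => /orP[] /eqP ep; [left|right];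
    by rewrite -ep pB ep /= eqxx.
- move=> Z /arcsP[w' [u' [v' [ok' e']]]] XZ; apply/fintype.subsetP => p; rewrite e e' => py.
  apply: (arc_surround d5 dh hd ok uv sm ok' _ _ _ py) => //.
    by rewrite -(e' (Ordinal ad)); apply: (fintype.subsetP XZ); rewrite finset.in_set2 eqxx.
  by rewrite -(e' (Ordinal bd)); apply: (fintype.subsetP XZ); rewrite finset.in_set2 eqxx orbT.
- move=> Z /arcsP[w' [u' [v' [ok' e']]]] /pred0Pn[q /andP[]] /=; rewrite e e' => qZ qY dZ.
  apply/fintype.subsetP => p; rewrite e e' => pZ.
  apply: (arc_inside d5 dh hd ok uv sm ok' _ _ _ _ qY qZ pZ) => //.
    by rewrite -(e' (Ordinal ad)) (disjointFl dZ)// finset.in_set2 eqxx.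
  by rewrite -(e' (Ordinal bd)) (disjointFl dZ)// finset.in_set2 eqxx orbT.
Qed.

(** The complement contains the outer neighbours of a small arc, so as an arc it would have to
    contain [Y] too. *)
Let compl_not_small Y w u v : arc_ok d h w u v -> (forall p : 'I_d, (p \in Y) = arc_pat w u v p) ->
  Y != finset.set0 -> ~: Y \in arcs -> ~~ small_arc d h w u v.
Proof.
move=> ok e Y0 CY; apply/negP => sm.
have [X [dX _ _ hX _]] := small_arc_outer ok e Y0 sm.
have /set0Pn[p pY] := Y0.
have : p \in ~: Y.
  by apply: (fintype.subsetP (hX _ CY _)) => //; rewrite -finset.disjoints_subset.
by rewrite inE pY.
Qed.

Lemma arcs_ring Y : Y \in middle arcs <->
  exists s t, t <= d /\ forall p : 'I_d, (p \in Y) = s (+) ((crossing h p < t) == (h <= p)).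
Proof.
split; last first.
  move=> [s [t [td e]]]; have [[w [u [v [ok e1]]]] [w' [u' [v' [ok' e2]]]]] := ring_arc d5 dh hd td.
  rewrite inE; apply/andP; split; apply/arcsP.
    case: s e => e; [exists w', u', v'|exists w, u, v]; split=> // p; rewrite e; [rewrite e2 //|rewrite e1 //].
  case: s e => e; [exists w, u, v|exists w', u', v']; split=> // p; rewrite inE e /= ?negbK;
    [rewrite e1 //|rewrite e2 //].
rewrite inE => /andP[YI CY].
have Y0 : Y != finset.set0.
  by apply: contraTneq CY => ->; rewrite finset.setC0 arcsT.
have /arcsP[w [u [v [ok e]]]] := YI.
have [s [t [td e']]] := arc_ring d5 dh hd ok (nonempty_arc ok e Y0) (compl_not_small ok e Y0 CY).
by exists s, t; split=> // p; rewrite e e'.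
Qed.

Lemma arcs_outer Y : Y \in arcs -> ~: Y \notin arcs -> Y != finset.set0 ->
  exists X, [/\ [disjoint X & Y], #|X| <= 2,
    forall B, B \subset X -> Y :|: B \in arcs,
    forall Z, Z \in arcs -> X \subset Z -> Y \subset Z &
    forall Z, Z \in arcs -> ~~ [disjoint Z & Y] -> [disjoint Z & X] -> Z \subset Y].
Proof.
move=> /arcsP[w [u [v [ok e]]]] CY Y0; apply: (small_arc_outer ok e Y0).
apply: contraR CY => nsm.
have [s [t [td e']]] := arc_ring d5 dh hd ok (nonempty_arc ok e Y0) nsm.
have : Y \in middle arcs by apply/arcs_ring; exists s, t; split=> // p; rewrite e e'.
by rewrite inE => /andP[].
Qed.

Lemma arcs_path (f : 'I_d) : exists r : {set 'I_d} -> nat,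
  forall Y Y', Y \in middle arcs -> Y' \in middle arcs -> f \notin Y -> f \notin Y' ->
    (r Y = r Y' -> Y = Y') /\
    (r Y' < r Y -> exists p, [/\ (p \in Y) != (p \in Y'),
      symdiff Y [set p] \in middle arcs, r (symdiff Y [set p]) < r Y &
      forall Z, Z \in middle arcs -> f \notin Z -> r Z <= r Y -> Z != Y -> (p \in Y) != (p \in Z)]).
Proof.
pose mem Y (i : nat) := (if insub i is Some p then p \in Y else false) : bool.
have memE Y (p : 'I_d) : mem Y p = (p \in Y) by rewrite /mem valK.
pose cr Y (p : 'I_d) := crossed h f (mem Y) p.
(* One more than the last turn not yet crossed, and 0 if there is none: this recovers the threshold
   of [ring_turn] from [Y] alone. *)
pose r Y := \max_(p | (p != f) && ~~ cr Y p) (turn d h f p).+1.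
have fd := ltn_ord f.
have neq (p : 'I_d) : p != f -> (p : nat) != f by [].
have crE Y (p : 'I_d) : p != f -> Y \in middle arcs -> f \notin Y -> cr Y p = (r Y <= turn d h f p).
  move=> pf /arcs_ring[s [t [td e]]] fY.
  have [||c [cd hc]] := @ring_turn d h d5 dh hd f (mem Y) s t td fd.
  - by rewrite memE (negbTE fY).
  - by move=> q qd; rewrite -[q]/(val (Ordinal qd)) memE e.
  have cE (q : 'I_d) : q != f -> cr Y q = (c <= turn d h f q).
    by move=> qf; rewrite /cr hc.
  apply/idP/idP => [crp|]; last first.
    by apply: contraLR => ncr; rewrite -ltnNge; apply: (@leq_bigmax_cond _ (fun q => (q != f) && ~~ cr Y q) (fun q => (turn d h f q).+1)); rewrite pf.
  apply/bigmax_leqP => q /andP[qf]; rewrite cE// -ltnNge => lt.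
  by rewrite cE// in crp; apply: leq_trans crp.
have crI Y Y' : f \notin Y -> f \notin Y' -> (forall p : 'I_d, p != f -> cr Y p = cr Y' p) -> Y = Y'.
  move=> fY fY' e; apply/setP => p; have [->|pf] := eqVneq p f.
    by rewrite (negbTE fY) (negbTE fY').
  have := e _ pf; rewrite /cr /crossed !memE.
  by case: (p \in Y); case: (p \in Y'); case: (h <= p); case: (f < h); case: (_ < _).
have inj Y Y' : Y \in middle arcs -> Y' \in middle arcs -> f \notin Y -> f \notin Y' -> r Y = r Y' -> Y = Y'.
  by move=> mY mY' fY fY' e; apply: crI => // p pf; rewrite !crE// e.
exists r => Y Y' mY mY' fY fY'; split; first exact: inj.
(* [p] is the uncrossed element of latest turn; switching it goes one step back on the path. *)
move=> lt; have [p /andP[pf ncr] rE] : exists2 p : 'I_d, (p != f) && ~~ cr Y p & r Y = (turn d h f p).+1.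
  have [q0 q0P|none] := pickP (fun q : 'I_d => (q != f) && ~~ cr Y q); last first.
    by move: lt; rewrite /r [X in _ < X]big_pred0.
  have c0 : 0 < #|[pred q : 'I_d | (q != f) && ~~ cr Y q]|.
    by apply/card_gt0P; exists q0.
  have [q qP e] := @eq_bigmax_cond _ [pred q : 'I_d | (q != f) && ~~ cr Y q] (fun q : 'I_d => (turn d h f q).+1) c0.
  by exists q.
have fS : f \notin symdiff Y [set p] by rewrite in_symdiff (negbTE fY) inE [f == p]eq_sym (negbTE pf).
have memS (q : 'I_d) : mem (symdiff Y [set p]) q = (mem Y q) (+) (q == p).
  by rewrite !memE in_symdiff inE; case: (q \in Y); case: (q == p).
have crS (q : 'I_d) : q != f -> cr (symdiff Y [set p]) q = (turn d h f p <= turn d h f q).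
  move=> qf; have -> : cr (symdiff Y [set p]) q = cr Y q (+) (q == p).
    rewrite /cr /crossed memS.
    by case: (mem Y q); case: (q == p); case: (h <= q); case: (f < h); case: (_ < _).
  rewrite crE// rE; have [->|qp] := eqVneq q p; first by rewrite leqnn ltnn.
  rewrite addbF ltn_neqAle; case: eqVneq => //= e; case/eqP: qp; apply/val_inj.
  by apply: (@turn_inj d h d5 dh hd f); [exact: ltn_ord|exact: ltn_ord|exact: ltn_ord|exact: qf|exact: pf|rewrite e].
have mS : symdiff Y [set p] \in middle arcs.
  apply/arcs_ring.
  have td : turn d h f p < d.
    have := crossing_lt d5 dh hd (ltn_ord p); have := crossing_lt d5 dh hd fd.
    have : crossing h p != crossing h f.
      by apply: contra pf => /eqP/(crossing_inj d5 dh hd (ltn_ord p) fd)/val_inj->.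
    by rewrite /turn; case: ifP; lia.
  have [||s [t [td' e]]] := @turn_ring d h d5 dh hd f (mem (symdiff Y [set p])) (turn d h f p) td fd.
  - by rewrite memE (negbTE fS).
  - by move=> q qd qf; have := crS (Ordinal qd); rewrite /cr /=; apply.
  by exists s, t; split=> // q; rewrite -memE e.
exists p; split=> //.
- by have := crE _ _ pf mY' fY'; have := crE _ _ pf mY fY; rewrite /cr /crossed !memE rE ltnn;
    rewrite rE ltnS in lt; rewrite lt; case: (p \in Y); case: (p \in Y'); case: (h <= p); case: (f < h); case: (_ < _).
- rewrite rE ltnS; apply/bigmax_leqP => q /andP[qf]; rewrite crS// -ltnNge; exact.
- move=> Z mZ fZ rZ ZY.
  have {rZ} : r Z < r Y.
    by rewrite ltn_neqAle rZ andbT; apply: contra ZY => /eqP/(inj _ _ mZ mY fZ fY)->.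
  rewrite rE ltnS => rZ.
  by have := crE _ _ pf mZ fZ; have := crE _ _ pf mY fY; rewrite /cr /crossed !memE rE ltnn rZ;
    case: (p \in Y); case: (p \in Z); case: (h <= p); case: (f < h); case: (_ < _).
Qed.

End Arcs.

(** * The facets of the complex *)

Lemma in_bigcup_seq (T : finType) (I : eqType) (r : seq I) (F : I -> {set T}) x :
  reflect (exists2 i, i \in r & x \in F i) (x \in \bigcup_(i <- r) F i).
Proof.
elim: r => [|i r IH]; first by rewrite big_nil inE; constructor => -[].
rewrite big_cons inE; apply: (iffP orP) => [[xi|/IH[j jr xj]]|[j]].
- by exists i; rewrite ?mem_head.
- by exists j; rewrite // in_cons jr orbT.
- by rewrite in_cons => /orP[/eqP->|jr xj]; [left|right; apply/IH; exists j].
Qed.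

Lemma coneP (T : finType) (K : {set {set T}}) (v : T) (F : {set T}) :
  (forall G G' : {set T}, G \in K -> G' \subset G -> G' \in K) ->
  (F \in cone K v) = (F :\ v \in K).
Proof.
move=> hK; rewrite inE; apply/orP/idP => [[FK|/imsetP[G GK ->]]|FK].
- by apply: hK FK _; exact: subD1set.
- apply: hK GK _; apply/fintype.subsetP => x; rewrite !inE => /andP[/negbTE->].
  by rewrite orFb.
- have [vF|vF] := boolP (v \in F); last first.
    left; rewrite (_ : F = F :\ v)//; apply/setP => x; rewrite !inE.
    by case: eqVneq vF => // -> /negbTE->.
  by right; apply/imsetP; exists (F :\ v) => //; rewrite finset.setD1K.
Qed.

Section Facets.
Variable d : nat.
Hypothesis d5 : 5 <= d.
Let h := uphalf d.
Let m := d./2.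
Let dE : d = h + m. Proof. by rewrite /h /m; lia. Qed.
Let hm : h = m + odd d. Proof. by rewrite /h /m; lia. Qed.
Let d0 : 0 < d. Proof. exact: leq_trans d5. Qed.

Lemma rot_subproof (p : 'I_d) : (if p.+1 == d then 0 else p.+1) < d.
Proof. by case: eqP => // ne; have := ltn_ord p; lia. Qed.
(** The shift puts x_k at position k modulo d. The arcs of [gamma], which start at 1, ..., d/2, then
    avoid both 0 and d - 1, so their complements are exactly the wrapping arcs of length d/2 + 1. *)
Definition rot (p : 'I_d) : 'I_d := Ordinal (rot_subproof p).
Lemma unrot_subproof (p : 'I_d) : (if p == 0 :> nat then d.-1 else p.-1) < d.
Proof. by have := ltn_ord p; case: eqP; lia. Qed.
Definition unrot (p : 'I_d) : 'I_d := Ordinal (unrot_subproof p).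

Lemma rotK : cancel rot unrot.
Proof.
move=> p; apply/val_inj => /=; have := ltn_ord p.
by case: (p.+1 =P d) => e pd /=; lia.
Qed.
Lemma unrotK : cancel unrot rot.
Proof.
move=> p; apply/val_inj => /=; have := ltn_ord p.
by case: (eqVneq (p : nat) 0) => e pd /=; case: eqP; lia.
Qed.

Definition coord (i : 'I_d.+1) : option 'I_d := omap rot (unlift ord_max i).
Definition uncoord (o : option 'I_d) : 'I_d.+1 :=
  if o is Some p then lift ord_max (unrot p) else ord_max.

Lemma coordK : cancel coord uncoord.
Proof. by move=> i; rewrite /coord; case: unliftP => [j ->|->] //=; rewrite rotK. Qed.
Lemma uncoordK : cancel uncoord coord.
Proof.
by case=> [p|]; rewrite /coord /uncoord ?unlift_none//= liftK /= unrotK.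
Qed.

(* The y-vertices of tau j k, in rotated coordinates. *)
Definition tau_pat (j k q : nat) : bool :=
  let s := if k == d then 0 else k in
  if s + j <= d then arc_pat false s (s + j) q else arc_pat true s (s + j - d) q.

Lemma mod_shift k a : 1 <= k <= d -> a < d ->
  let s := if k == d then 0 else k in
  ((k + a).-1 %% d).+1 %% d = if s + a < d then s + a else s + a - d.
Proof.
move=> k1 ad; rewrite -addn1 modnDml addn1 prednK; last by lia.
case: eqVneq => [->|kd] /=; first by rewrite modnDl modn_small// ad.
case: ltnP => ka; first by rewrite modn_small.
by rewrite -{1}(subnK ka) modnDr modn_small//; lia.
Qed.

Lemma rot_mod (p : 'I_d) : rot p = p.+1 %% d :> nat.
Proof.
rewrite /=; case: eqVneq => [->|ne]; first by rewrite modnn.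
by rewrite modn_small//; have := ltn_ord p; lia.
Qed.

Lemma tau_patP j k (q : 'I_d) : 1 <= k <= d -> j <= d ->
  reflect (exists2 a, a < j & unrot q = (k + a).-1 %% d :> nat) (tau_pat j k q).
Proof.
move=> k1 jd; have qd := ltn_ord q.
have eqa a : a < j -> (unrot q = (k + a).-1 %% d :> nat) <->
    q = ((k + a).-1 %% d).+1 %% d :> nat.
  move=> aj; split => [e|e].
    by rewrite -[q in LHS]unrotK rot_mod e.
  have lt : (k + a).-1 %% d < d by rewrite ltn_mod.
  have -> : unrot q = Ordinal lt; last by [].
  apply: (can_inj rotK); rewrite unrotK; apply/ord_inj.
  by rewrite rot_mod /= -e.
apply: (iffP idP) => [|[a aj /eqa]].
  rewrite /tau_pat /arc_pat /=; set s := (if k == d then 0 else k) => hq.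
  have sd : s < d by rewrite /s; case: eqVneq k1 => [_|]; lia.
  pose a := if s <= q then q - s else q + d - s.
  have aj : a < j by move: hq; rewrite /a; case: (leqP (s + j) d) => sj; case: (leqP s q) => sq; lia.
  exists a => //; apply/(eqa _ aj); rewrite mod_shift//; last exact: leq_trans jd.
  rewrite /= -/s; move: hq; rewrite /a; case: (leqP (s + j) d) => sj; case: (leqP s q) => sq;
    by case: (ltnP (s + _) d); lia.
move=> /(_ aj); rewrite mod_shift//; last exact: leq_trans jd.
rewrite /tau_pat /arc_pat /=; set s := (if k == d then 0 else k) => hq.
have sd : s < d by rewrite /s; case: eqVneq k1 => [_|]; lia.
by move: hq; case: (ltnP (s + a) d) => sa; case: (leqP (s + j) d) => sj hq; lia.
Qed.

Definition tau_set (j k : nat) : {set 'I_d} := finset (fun q : 'I_d => tau_pat j k q).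

Lemma inord_mod (q : 'I_d) (n : nat) :
  (lift ord_max q == inord (n %% d) :> 'I_d.+1) = (q == n %% d :> nat).
Proof.
rewrite -val_eqE /= inordK; last by rewrite ltnS ltnW// ltn_mod.
by rewrite /bump leqNgt ltn_ord add0n.
Qed.

Lemma in_tau j k (q : 'I_d) b : 1 <= k <= d -> j <= d ->
  ((lift ord_max q, b) \in tau d j k) = (b == (rot q \in tau_set j k)).
Proof.
move=> k1 jd; rewrite /tau !inE.
have y1 : ((lift ord_max q, b) \in [set base_y d (k + i) | i : 'I_j]) = b && (tau_pat j k (rot q)).
  apply/imsetP/andP => [[i _ [/eqP]]|[b1 /(tau_patP _ k1 jd)[a aj e]]].
    rewrite inord_mod => /eqP e ->; split=> //; apply/(tau_patP _ k1 jd).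
    by exists i => //; rewrite rotK.
  exists (Ordinal aj) => //; apply/pair_eqP; rewrite /= b1 eqxx andbT inord_mod /=.
  by rewrite -e rotK.
have y2 : ((lift ord_max q, b) \in [set base_x d (k + i) | i : 'I_j]) = ~~ b && (tau_pat j k (rot q)).
  apply/imsetP/andP => [[i _ [/eqP]]|[b1 /(tau_patP _ k1 jd)[a aj e]]].
    rewrite inord_mod => /eqP e ->; split=> //; apply/(tau_patP _ k1 jd).
    by exists i => //; rewrite rotK.
  exists (Ordinal aj) => //; apply/pair_eqP; rewrite /= (negbTE b1) eqxx andbT inord_mod /=.
  by rewrite -e rotK.
have y3 : ((lift ord_max q, b) \in [set base_x d i.+1 | i : 'I_d]) = ~~ b.
  apply/imsetP/idP => [[i _ [_ ->]]//|b1].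
  exists q => //; apply/pair_eqP; rewrite /= (negbTE b1) eqxx andbT inord_mod /=.
  by rewrite modn_small.
by rewrite y1 y2 y3; move: (tau_pat _ _ _) => c; clear; case: b c => [] [].
Qed.

Lemma apex_notin_tau j k b : ((ord_max, b) \in tau d j k) = false.
Proof.
have ne n : (inord (n %% d) == ord_max :> 'I_d.+1) = false.
  rewrite -val_eqE /= inordK; last by rewrite ltnS ltnW// ltn_mod.
  by apply/negbTE; rewrite neq_ltn ltn_mod d0.
apply/negbTE/negP; rewrite !inE => /orP[/andP[_ /imsetP[i _ [/esym/eqP]]]|/imsetP[i _ [/esym/eqP]]];
  by rewrite ne.
Qed.

Definition faces_of (s : bool) (Y : {set 'I_d}) (F : {set cross_vertex d.+1}) : Prop :=
  forall v, v \in F -> v.2 = (coord v.1 \in lift_set s Y).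

Lemma tau_faces s j k (F : {set cross_vertex d.+1}) : 1 <= k <= d -> j <= d ->
  (F :\ (ord_max, s) \subset tau d j k) <-> faces_of s (tau_set j k) F.
Proof.
move=> k1 jd; split => [/fintype.subsetP FT [i b] vF|hF].
  rewrite /coord /=; case: unliftP => [q iq|im] /=; last first.
    rewrite inE; apply/eqP/negPn/negP => bs.
    have /FT : (i, b) \in F :\ (ord_max, s) by rewrite !inE vF andbT im xpair_eqE eqxx.
    by rewrite im apex_notin_tau.
  have : (i, b) \in F :\ (ord_max, s).
    by rewrite !inE vF andbT iq xpair_eqE negb_and eq_sym neq_lift.
  by move=> /FT; rewrite iq in_tau// => /eqP ->; rewrite [RHS]inE.
apply/fintype.subsetP => -[i b]; rewrite finset.in_setD1 xpair_eqE negb_and => /andP[ne /hF].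
rewrite /coord /=; case: unliftP ne => [q -> _|->] /=.
  by rewrite [X in _ = X]inE => ->; rewrite in_tau.
by rewrite [X in _ = X]inE eqxx /= => /eqP ne /ne.
Qed.

Lemma in_Gamma j (F : {set cross_vertex d.+1}) :
  reflect (exists2 k, 1 <= k <= d & F \subset tau d j k) (F \in Gamma d j).
Proof.
apply: (iffP (in_bigcup_seq _ _ _)) => -[k].
  by rewrite mem_index_iota ltnS powersetE; exists k.
by exists k; rewrite ?mem_index_iota ?ltnS ?powersetE.
Qed.

Lemma in_Gammas a b (F : {set cross_vertex d.+1}) :
  reflect (exists j k, [/\ a <= j < b, 1 <= k <= d & F \subset tau d j k])
    (F \in \bigcup_(a <= j < b) Gamma d j).
Proof.
apply: (iffP (in_bigcup_seq _ _ _)) => [[j]|[j [k [jab kd FT]]]].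
  by rewrite mem_index_iota => jab /in_Gamma[k kd FT]; exists j, k.
by exists j; rewrite ?mem_index_iota//; apply/in_Gamma; exists k.
Qed.

Lemma in_gamma (F : {set cross_vertex d.+1}) :
  reflect (exists2 i, 1 <= i <= m & F \subset tau d m.-1 i) (F \in gamma d).
Proof.
apply: (iffP (in_bigcup_seq _ _ _)) => -[i].
  by rewrite mem_index_iota ltnS powersetE; exists i.
by exists i; rewrite ?mem_index_iota ?ltnS ?powersetE.
Qed.

Lemma antipodeK n : involutive (@antipode n).
Proof. by case=> i b; rewrite /antipode /= negbK. Qed.

Lemma in_antipode n (F : {set cross_vertex n}) v : (v \in @antipode n @: F) = (antipode v \in F).
Proof.
by rewrite -{1}(antipodeK v) mem_imset//; exact: (can_inj (@antipodeK n)).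
Qed.

Lemma antipode_imK n : involutive (fun F : {set cross_vertex n} => @antipode n @: F).
Proof. by move=> F; apply/setP => v; rewrite !in_antipode antipodeK. Qed.

Lemma in_image_antipode n (K : {set {set cross_vertex n}}) F :
  (F \in image_complex (@antipode n) K) = (@antipode n @: F \in K).
Proof.
apply/imsetP/idP => [[G GK ->]|FK]; first by rewrite antipode_imK.
by exists (@antipode n @: F) => //; rewrite antipode_imK.
Qed.

(** An arc of length at most h is the y-part of a facet of some [Gamma]. A longer one has to wrap,
    which happens only for even d, and is the complement of an arc of [gamma]. *)
Lemma arcs_tauP Y : Y \in arcs d <->
  (exists j k, [/\ j < if odd d then m.+2 else m.+1, 1 <= k <= d & Y = tau_set j k]) \/
  (~~ odd d /\ exists2 i, 1 <= i <= m & ~: Y = tau_set m.-1 i).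
Proof.
(* The two ranges in the definition of [D1] both end at j = h. *)
have -> : (if odd d then m.+2 else m.+1) = (h + 1) by move: hm; case: (odd d); lia.
split.
  move=> /(arcsP d5)[w [u [v [ok e]]]]; move: ok; rewrite -/h /arc_ok; case: w e => e ok.
    have [hj|hj] := leqP (d - u + v) h.
      left; exists (d - u + v), u; split; [lia|lia|].
      apply/setP => p; rewrite inE e /tau_pat /arc_pat.
      have -> : (u == d) = false by lia.
      have -> : u + (d - u + v) <= d = false by lia.
      by have -> : u + (d - u + v) - d = v by lia.
    right; split; first by move: hm hj; case: (odd d); lia.
    exists v; first by move: hm hj; case: (odd d); lia.
    apply/setP => p; rewrite inE e inE /tau_pat /arc_pat.
    have -> : (v == d) = false by lia.
    have -> : v + m.-1 <= d by lia.
    have -> : u = v + m.-1 by move: hm hj; case: (odd d); lia.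
    by rewrite negb_or -leqNgt -ltnNge.
  left; exists (v - u), (if (u == 0) || (u == d) then d else u); split; [lia|by case: ifP; lia|].
  apply/setP => p; rewrite inE e /tau_pat /arc_pat; have := ltn_ord p.
  case: (boolP ((u == 0) || (u == d))) => hu pd.
    rewrite eqxx; have -> : 0 + (v - u) <= d by lia.
    by apply/idP/idP; lia.
  have -> : (u == d) = false by lia.
  have -> : u + (v - u) = v by lia.
  by have -> : v <= d by lia.
case=> [[j [k [jh kd ->]]]|[ev [i im e]]]; apply/(arcsP d5).
  set s := if k == d then 0 else k; have sd : s < d by rewrite /s; case: eqVneq kd; lia.
  have [sj|sj] := leqP (s + j) d.
    exists false, s, (s + j); split; first by rewrite /arc_ok -/h; lia.
    by move=> p; rewrite inE /tau_pat -/s sj.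
  exists true, s, (s + j - d); split; first by rewrite /arc_ok -/h; move: hm; case: (odd d); lia.
  by move=> p; rewrite inE /tau_pat -/s leqNgt sj.
have hm' : h = m by move: hm; rewrite (negbTE ev) addn0.
exists true, (i + m.-1), i; split; first by rewrite /arc_ok -/h; lia.
move=> p; rewrite -[Y]finset.setCK e !inE /tau_pat /arc_pat.
have -> : (i == d) = false by lia.
have -> : i + m.-1 <= d by lia.
by rewrite negb_and -leqNgt -ltnNge.
Qed.

Lemma arcsC_tauP Y : ~: Y \in arcs d <->
  (exists j k, [/\ m <= j < d.+1, 1 <= k <= d & Y = tau_set j k]) \/
  (~~ odd d /\ exists2 i, 1 <= i <= m & Y = tau_set m.-1 i).
Proof.
split.
  move=> /(arcsP d5)[w [u [v [ok e]]]]; move: ok; rewrite -/h /arc_ok.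
  have eY (p : 'I_d) : (p \in Y) = ~~ arc_pat w u v p by rewrite -e inE negbK.
  case: w eY {e} => e ok.
    have [hj|hj] := leqP m (u - v).
      left; exists (u - v), v; split; [lia|lia|].
      apply/setP => p; rewrite inE e /tau_pat /arc_pat.
      have -> : (v == d) = false by lia.
      have -> : v + (u - v) <= d by lia.
      have -> : v + (u - v) = u by lia.
      by rewrite negb_or -leqNgt -ltnNge.
    right; split; first by move: hm hj; case: (odd d); lia.
    exists v; first by move: hm hj; case: (odd d); lia.
    apply/setP => p; rewrite inE e /tau_pat /arc_pat.
    have -> : (v == d) = false by lia.
    have -> : v + m.-1 <= d by lia.
    have -> : u = v + m.-1 by move: hm hj; case: (odd d); lia.
    by rewrite negb_or -leqNgt -ltnNge.
  left; exists (d - (v - u)), (if (v == 0) || (v == d) then d else v).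
  split; [by move: hm; case: (odd d); lia|by case: ifP; lia|].
  apply/setP => p; rewrite inE e /tau_pat /arc_pat; have := ltn_ord p.
  case: (boolP ((v == 0) || (v == d))) => hu pd.
    rewrite eqxx; have -> : 0 + (d - (v - u)) <= d by lia.
    by apply/idP/idP; lia.
  have -> : (v == d) = false by lia.
  case: (leqP (v + (d - (v - u))) d) => hh; first by apply/idP/idP; lia.
  have -> : v + (d - (v - u)) - d = u by lia.
      by rewrite negb_and -leqNgt -ltnNge.
case=> [[j [k [jh kd ->]]]|[ev [i im ->]]]; apply/(arcsP d5).
  set s := if k == d then 0 else k; have sd : s < d by rewrite /s; case: eqVneq kd; lia.
  have mh : d <= m + h /\ h <= m.+1 by move: hm; case: (odd d); lia.
  have [sj|sj] := leqP (s + j) d; last first.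
    exists false, (s + j - d), s; split; first by rewrite /arc_ok -/h; lia.
    move=> p; rewrite !inE /tau_pat -/s leqNgt sj /= /arc_pat.
    by rewrite negb_or -leqNgt -ltnNge.
  have e (p : 'I_d) : (p \in ~: tau_set j k) = ~~ ((s <= p) && (p < s + j)).
    by rewrite !inE /tau_pat -/s sj.
  case: (posnP s) => s0; last case: (eqVneq (s + j) d) => sjd.
  - exists false, j, d; split; first by rewrite /arc_ok -/h; lia.
    by move=> p; rewrite e /arc_pat; have := ltn_ord p; lia.
  - exists false, 0, s; split; first by rewrite /arc_ok -/h; lia.
    by move=> p; rewrite e /arc_pat; have := ltn_ord p; lia.
  - exists true, (s + j), s; split; first by rewrite /arc_ok -/h; lia.
    by move=> p; rewrite e /arc_pat; have := ltn_ord p; lia.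
have hm' : h = m by move: hm; rewrite (negbTE ev) addn0.
exists true, (i + m.-1), i; split; first by rewrite /arc_ok -/h; lia.
move=> p; rewrite !inE /tau_pat /arc_pat.
have -> : (i == d) = false by lia.
have -> : i + m.-1 <= d by lia.
by rewrite negb_and -leqNgt -ltnNge.
Qed.

Let down_Gammas a b (G G' : {set cross_vertex d.+1}) :
  G \in \bigcup_(a <= j < b) Gamma d j -> G' \subset G -> G' \in \bigcup_(a <= j < b) Gamma d j.
Proof.
move=> /in_Gammas[j [k [ja kd GT]]] GG; apply/in_Gammas; exists j, k; split=> //.
exact: fintype.subset_trans GT.
Qed.

Let down_gamma (G G' : {set cross_vertex d.+1}) : G \in gamma d -> G' \subset G -> G' \in gamma d.
Proof.
by move=> /in_gamma[i im GT] GG; apply/in_gamma; exists i => //; exact: fintype.subset_trans GT.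
Qed.

Lemma antipode_tau_faces s j k (F : {set cross_vertex d.+1}) : 1 <= k <= d -> j <= d ->
  (@antipode d.+1 @: (F :\ (ord_max, s)) \subset tau d j k) <-> faces_of s (~: tau_set j k) F.
Proof.
move=> k1 jd.
have -> : @antipode d.+1 @: (F :\ (ord_max, s)) = (@antipode d.+1 @: F) :\ (ord_max, ~~ s).
  apply/setP => -[i b]; rewrite in_antipode !inE in_antipode /antipode /= !xpair_eqE.
  by case: b; case: s.
rewrite (tau_faces _ _ k1 jd) /faces_of; split=> hF [i b] vF /=.
  have := hF (antipode (i, b)); rewrite in_antipode antipodeK => /(_ vF).
  rewrite /antipode /=; case: (coord i) => [q|]; rewrite !inE; last by case: b s {hF vF} => [] [].
  by move=> <-; rewrite negbK.
move: vF; rewrite in_antipode => /hF; rewrite /antipode /=.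
by case: (coord i) => [q|]; rewrite !inE; [case: b (tau_pat j k q) => [] []|case: b s {hF} => [] []].
Qed.

Lemma D1P (F : {set cross_vertex d.+1}) :
  F \in D1 d <-> exists2 Y, Y \in arcs d & faces_of false Y F.
Proof.
rewrite /D1; split.
  case: ifP => od; rewrite coneP; [|exact: down_Gammas| |]; last first.
  - move=> G G'; rewrite !inE !in_image_antipode => /orP[/down_Gammas h' /h'->//|h' GG].
    by rewrite (down_gamma h') ?orbT//; exact: imsetS.
  - rewrite inE in_image_antipode => /orP[/in_Gammas[j [k [ja kd FT]]]|/in_gamma[i im FT]].
      exists (tau_set j k); first by apply/arcs_tauP; left; exists j, k; rewrite od; split => //; lia.
      by apply/tau_faces => //; lia.
    exists (~: tau_set m.-1 i).
      by apply/arcs_tauP; right; rewrite od; split=> //; exists i => //; rewrite finset.setCK.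
    by apply/antipode_tau_faces => //; lia.
  - move=> /in_Gammas[j [k [ja kd FT]]]; exists (tau_set j k).
      by apply/arcs_tauP; left; exists j, k; rewrite od; split => //; lia.
    by apply/tau_faces => //; lia.
move=> [Y /arcs_tauP[[j [k [jd kd ->]]]|[ev [i im e]]] FY].
  have jd' : j <= d by move: jd; case: (odd d); lia.
  have FT : F :\ (ord_max, false) \in \bigcup_(0 <= k < if odd d then m.+2 else m.+1) Gamma d k.
    by apply/in_Gammas; exists j, k; split=> //; apply/tau_faces.
  case: ifP jd FT => od jd FT; rewrite coneP//; [exact: down_Gammas|by rewrite inE FT|].
  move=> G G'; rewrite !inE !in_image_antipode => /orP[/down_Gammas h' /h'->//|h' GG].
  by rewrite (down_gamma h') ?orbT//; exact: imsetS.
rewrite (negbTE ev) coneP.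
  rewrite inE in_image_antipode; apply/orP; right; apply/in_gamma; exists i => //.
  by apply/antipode_tau_faces; [lia|lia|rewrite -e finset.setCK].
move=> G G'; rewrite !inE !in_image_antipode => /orP[/down_Gammas h' /h'->//|h' GG].
by rewrite (down_gamma h') ?orbT//; exact: imsetS.
Qed.

Lemma D2P (F : {set cross_vertex d.+1}) :
  F \in D2 d <-> exists2 Y, ~: Y \in arcs d & faces_of true Y F.
Proof.
have down2 (G G' : {set cross_vertex d.+1}) : G \in (\bigcup_(m <= k < d.+1) Gamma d k) :|: gamma d ->
    G' \subset G -> G' \in (\bigcup_(m <= k < d.+1) Gamma d k) :|: gamma d.
  rewrite !inE => /orP[/down_Gammas h' /h'->//|h' GG].
  by rewrite (down_gamma h') ?orbT.
rewrite /D2 -/m; split.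
  case: ifP => od; rewrite coneP; [|exact: down_Gammas| |exact: down2].
    move=> /in_Gammas[j [k [ja kd FT]]]; exists (tau_set j k).
      by apply/arcsC_tauP; left; exists j, k.
    by apply/tau_faces => //; lia.
  rewrite inE => /orP[/in_Gammas[j [k [ja kd FT]]]|/in_gamma[i im FT]].
    exists (tau_set j k); first by apply/arcsC_tauP; left; exists j, k.
    by apply/tau_faces => //; lia.
  exists (tau_set m.-1 i).
    by apply/arcsC_tauP; right; rewrite od; split=> //; exists i.
  by apply/tau_faces => //; lia.
move=> [Y /arcsC_tauP[[j [k [jd kd ->]]]|[ev [i im ->]]] FY].
  have FT : F :\ (ord_max, true) \in \bigcup_(m <= k < d.+1) Gamma d k.
    by apply/in_Gammas; exists j, k; split=> //; apply/tau_faces => //; lia.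
  by case: ifP => od; rewrite coneP//; [exact: down_Gammas|rewrite inE FT].
rewrite (negbTE ev) coneP; last exact: down2.
rewrite inE; apply/orP; right; apply/in_gamma; exists i => //.
by apply/tau_faces => //; lia.
Qed.

Definition compatible (F : {set cross_vertex d.+1}) (T : {set option 'I_d}) : Prop :=
  forall v, v \in F -> v.2 = (coord v.1 \in T).

Lemma D12P (F : {set cross_vertex d.+1}) :
  F \in D1 d :|: D2 d <-> exists2 T, T \in suspension (arcs d) & compatible F T.
Proof.
rewrite inE; split.
  case/orP => [/D1P|/D2P] [Y YI FY].
    by exists (lift_set false Y) => //; rewrite inE None_lift base_lift.
  by exists (lift_set true Y) => //; rewrite inE None_lift base_lift.
move=> [T TD FT]; apply/orP; move: TD; rewrite inE; case: ifP => nT TI.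
  right; apply/D2P; exists (base T) => // v /FT ->.
  by case: (coord _) => [q|]; rewrite ?inE// nT.
left; apply/D1P; exists (base T) => // v /FT ->.
by case: (coord _) => [q|]; rewrite ?inE// nT.
Qed.

End Facets.

Local Open Scope classical_set_scope.
Local Open Scope ring_scope.

(** * The boundary complex *)

Section Boundary.
Variables (R : realType) (d : nat).
Hypothesis d5 : (5 <= d)%N.
Let K := D1 d :|: D2 d.
Let S := suspension (arcs d).
Local Notation V := (cross_vertex d.+1).

Let xs (F : {set V}) : {set option 'I_d} := finset (fun o => [exists i, (coord d5 i == o) && ((i, false) \in F)]).
Let ys (F : {set V}) : {set option 'I_d} := finset (fun o => [exists i, (coord d5 i == o) && ((i, true) \in F)]).

Let xsP (F : {set V}) i b : (i, b) \in F -> coord d5 i \in if b then ys F else xs F.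
Proof. by move=> iF; case: b iF => iF; rewrite inE; apply/existsP; exists i; rewrite eqxx. Qed.

Lemma in_star (F : {set V}) T : T \in star (arcs d) (xs F) (ys F) <-> T \in S /\ compatible d5 F T.
Proof.
rewrite inE; split.
  move=> /and3P[TS YT XT]; split=> // -[i b] iF /=.
  have := xsP iF; case: b iF => iF.
    by move=> /(fintype.subsetP YT)->.
  by move=> /(disjointFr XT)->.
move=> [TS FT]; rewrite TS /=; apply/andP; split.
  by apply/fintype.subsetP => o; rewrite inE => /existsP[i /andP[/eqP<- /FT]].
rewrite disjoint_subset; apply/fintype.subsetP => o; rewrite inE => /existsP[i /andP[/eqP<- /FT]].
by rewrite inE => /= <-.
Qed.

Let free (F : {set V}) : {set option 'I_d} := ~: (xs F :|: ys F).

Lemma compatible_sign_face (z : {ptws option 'I_d -> R}) T :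
  compatible d5 (sign_face (coord d5) z) T <-> compat T z.
Proof.
split.
  move=> h o; have := h (uncoord d5 o, true); have := h (uncoord d5 o, false).
  rewrite !inE /= (uncoordK d5); case: (o \in T).
    by case: (ltP 0 (z o)) => // _ /(_ isT).
  by case: (ltP (z o) 0) => // _ _ /(_ isT).
move=> h -[i b]; rewrite inE /=; have := h (coord d5 i).
by case: b; case: (coord d5 i \in T) => //; case: ltP => // h1 /(lt_le_trans h1); rewrite ltxx.
Qed.

Lemma signed_link (F : {set V}) z :
  signed_cone (R := R) (coord d5) (link K F) z <-> fan (free F) (star (arcs d) (xs F) (ys F)) z.
Proof.
split.
  move=> [z0]; rewrite inE => /andP[dFz /(D12P d5)[T TS cT]].
  have FT : compatible d5 F T by move=> v vF; apply: cT; rewrite inE vF.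
  have zT : compatible d5 (sign_face (coord d5) z) T by move=> v vF; apply: cT; rewrite inE vF orbT.
  split=> //; last first.
    by exists T; [apply/in_star|apply/compatible_sign_face].
  move=> o; rewrite !inE negbK => oF.
  have [i [b [eo iF]]] : exists i b, coord d5 i = o /\ (i, b) \in F.
    by case/orP: oF => /existsP[i /andP[/eqP e iF]]; exists i; [exists false|exists true].
  have := disjointFr dFz iF; have := zT (i, ~~ b); have /= := FT _ iF.
  rewrite !inE /= eo => <-.
  case: b {iF} => h1 h2; apply: contrapT => /eqP; rewrite neq_lt => /orP[] lt0; first [by have := h1 lt0|by rewrite lt0 in h2].
move=> [z0 zE [T /in_star[TS FT] cT]]; split=> //; rewrite inE; apply/andP; split.
  rewrite disjoint_subset; apply/fintype.subsetP => -[i b] iF; rewrite !inE /= zE; first by case: b iF => _; rewrite ltxx.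
  by rewrite finset.in_setC negbK finset.in_setU; have := xsP iF; case: b {iF} => -> //; rewrite orbT.
apply/(D12P d5); exists T => // v; rewrite inE => /orP[/FT//|]; exact: (compatible_sign_face _ _).2.
Qed.

Lemma conic_link (F : {set V}) (P : set {ptws option 'I_d -> R}) :
  (forall z, fan (free F) (star (arcs d) (xs F) (ys F)) z <-> P z) ->
  conic_homeo (cone_over (R := R) (link K F)) P.
Proof.
move=> hP; have -> : P = signed_cone (R := R) (coord d5) (link K F).
  by apply/seteqP; split=> z; [move/hP/signed_link|move/signed_link/hP].
exists (to_signed (uncoord d5)), (of_signed (coord d5)).
apply: cone_over_signed; [exact: coordK|exact: uncoordK|].
move=> G i; rewrite inE => /andP[_ /(D12P d5)[T _ cT]] h1 h2.
have := cT (i, false); have := cT (i, true); rewrite !inE h1 h2 !orbT => /(_ isT) /= <- /(_ isT)//.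
Qed.

Lemma xsysP (F : {set V}) : F != finset.set0 -> xs F :|: ys F != finset.set0.
Proof.
move=> /set0Pn[[i b] iF]; apply/set0Pn; exists (coord d5 i); rewrite inE.
by have := xsP iF; case: b {iF} => ->; rewrite ?orbT.
Qed.

Lemma same_star (F : {set V}) T T' : T \in star (arcs d) (xs F) (ys F) ->
  (T' \in star (arcs d) (xs F) (ys F) <-> T' \in S /\ symdiff T T' \subset free F).
Proof.
move=> /in_star[TS FT]; split.
  move=> /in_star[T'S FT']; split=> //; apply/fintype.subsetP => o; rewrite !inE; apply: contraNN => oF.
  have [i [b [eo iF]]] : exists i b, coord d5 i = o /\ (i, b) \in F.
    by case/orP: oF => /existsP[i /andP[/eqP e iF]]; exists i; [exists false|exists true].
  by have := FT _ iF; have := FT' _ iF; rewrite /= eo => <- <-.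
move=> [T'S sub]; apply/in_star; split=> // -[i b] iF; rewrite (FT _ iF) /=.
have := fintype.subsetP sub (coord d5 i); rewrite !inE.
have -> : [exists i0, (coord d5 i0 == coord d5 i) && ((i0, false) \in F)]
  || [exists i0, (coord d5 i0 == coord d5 i) && ((i0, true) \in F)].
  by have := xsP iF; rewrite /=; case: b {iF}; rewrite inE => ->; rewrite ?orbT.
by case: (_ =P _) => // + /(_ isT) => /eqP; case: (_ \in T); case: (_ \in T').
Qed.

Lemma boundaryP (F : {set V}) : F \in boundary R K <->
  (exists2 T, T \in S & compatible d5 F T) /\ (exists2 T, T \notin S & compatible d5 F T).
Proof.
(* For the empty face, which is in the boundary by definition, an orthant outside is provided by the
   full set, which is not an arc. *)
rewrite inE; have [->|F0] /= := eqVneq F finset.set0.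
  rewrite andbT; split=> [/(D12P d5)[T TS _]|[/(D12P d5)//]].
  split; first by exists T => // v; rewrite inE.
  exists (lift_set false finset.setT); last by move=> v; rewrite inE.
  by rewrite inE None_lift base_lift; exact: arcsT.
have key T : T \in star (arcs d) (xs F) (ys F) ->
   `[< topological_ball R (link K F) >] <-> exists2 T, T \notin S & compatible d5 F T.
  move=> TP.
  have cS T' : T' \in star (arcs d) (xs F) (ys F) -> forall B : {set option 'I_d}, B \subset free F ->
     (symdiff T' B \notin star (arcs d) (xs F) (ys F)) -> exists2 T, T \notin S & compatible d5 F T.
    move=> T'P B BE nB; exists (symdiff T' B).
      by apply: contra nB => nB; apply/(same_star _ T'P); rewrite symdiffK.
    move=> -[i b] iF; have /in_star[_ FT'] := T'P; rewrite (FT' _ iF) in_symdiff /=.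
    suff -> : (coord d5 i \in B) = false by case: (_ \in T').
    apply/negP => /(fintype.subsetP BE); rewrite !inE.
    by have := xsP iF; rewrite /=; case: b {iF}; rewrite inE => ->; rewrite ?orbT.
  have sE T1 T2 : T1 \in star (arcs d) (xs F) (ys F) -> T2 \in star (arcs d) (xs F) (ys F) ->
      symdiff T1 T2 \subset free F.
    by move=> h1 h2; have [+ _] := same_star T2 h1; case/(_ h2).
  have NS : @punctured R _ (free F) = fan (free F) (star (arcs d) (xs F) (ys F)) ->
      (#|free F| <= 2)%N -> ~ topological_ball R (link K F).
    move=> e c; apply: punctured_not_ball c; rewrite e; exact: conic_link.
  (* When all orthants around [F] are present, the link is a full sphere of dimension at most one
     and both sides of the equivalence fail. *)
  have whole T' : T' \in star (arcs d) (xs F) (ys F) ->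
      (forall B : {set option 'I_d}, B \subset free F -> symdiff T' B \in star (arcs d) (xs F) (ys F)) ->
      (#|free F| <= 2)%N ->
      `[< topological_ball R (link K F) >] <-> exists2 T, T \notin S & compatible d5 F T.
    move=> T'P all c; split.
      move/asboolP; move/NS: c => c /c; case.
      apply/seteqP; split=> z; last by case.
      move=> [z0 zE]; split=> //.
      exists (symdiff T' (finset (fun o => (o \in free F) && ((o \in T') != (z o < 0))))).
        by apply: all; apply/fintype.subsetP => o; rewrite !inE => /andP[].
      move=> o; rewrite in_symdiff inE; have [oE|/zE->] := boolP (o \in free F); last by rewrite /= lexx if_same.
      by case: (o \in T') => /=; case: (ltP (z o) 0) => //= zo; rewrite ltW.
    move=> [T1 T1S FT1]; case/negP: T1S.
    have h : symdiff T' T1 \subset free F.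
      have /in_star[_ FT'] := T'P.
      apply/fintype.subsetP => o; rewrite !inE; apply: contraNN => oF.
      have [i [b [eo iF]]] : exists i b, coord d5 i = o /\ (i, b) \in F.
        by case/orP: oF => /existsP[i /andP[/eqP e iF]]; exists i; [exists false|exists true].
      by have := FT1 _ iF; have := FT' _ iF; rewrite /= eo => <- <-.
    have := all _ h; rewrite symdiffK => /in_star[]//.
  have /(peelable_fan R)/(_ sE)[[T0 [T0P hc hn]]|[c [T1 T1P all]]] :
      peelable (free F) (star (arcs d) (xs F) (ys F)).
  - apply: peel_star; last by exists T.
    + exact: arcs_extreme.
    + exact: arcs_outer.
    + exact: arcs_path.
    + exact: xsysP.
  (* A facet has no free coordinate, so nothing can be missing around it; its link is empty rather
     than a ball. *)
  - have [E0|E0] := eqVneq (free F) finset.set0.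
      apply: (whole T0) => //; last by rewrite E0 cards0.
      move=> B; rewrite E0 finset.subset0 => /eqP->.
      by rewrite (_ : symdiff _ _ = T0)//; apply/setP => o; rewrite !inE; case: (o \in T0).
    split=> _; first by have [B BE nB] := hn E0; exact: cS nB.
    apply/asboolP; have /set0Pn[l lE] := E0.
    apply: (@orthant_ball R _ _ l lE).
    have h1 : conic_homeo (cone_over (R := R) (link K F))
        (fan (free F) (star (arcs d) (xs F) (ys F))) by exact: conic_link.
    have [a [b h]] := hc.
    have h2 := conic_iso_twist R T0 (free F) [set T0]%SET.
    apply: (conic_homeo_trans h1).
    apply: (@conic_homeo_trans _ _ _ _ _ (fan (free F) [set T0]%SET)).
      by exists b, a; apply: conic_iso_sym => //; exact: conic_fan.
    exists (twist T0), (twist T0); move: h2.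
    by rewrite imset_set1 symdiffxx.
  - exact: whole all c.
split.
  move=> /andP[/(D12P d5)[T TS FT] hb]; split; first by exists T.
  by apply/(key T) => //; apply/in_star.
move=> [[T TS FT] nS]; apply/andP; split; first by apply/(D12P d5); exists T.
by apply/(key T) => //; apply/in_star.
Qed.

Let B := boundary R K.

Lemma boundary_simplicial : simplicial_complex B.
Proof.
split.
  apply/boundaryP; split.
    exists finset.set0; last by move=> v; rewrite inE.
    rewrite inE finset.in_set0 (_ : base _ = finset.set0); first exact: arcs0.
    by apply/setP => i; rewrite !inE.
  exists (lift_set false finset.setT); last by move=> v; rewrite inE.
  by rewrite inE None_lift base_lift; exact: arcsT.
move=> F G /boundaryP[[T TS FT] [T' T'S FT']] /fintype.subsetP GF; apply/boundaryP.
by split; [exists T|exists T'] => // v /GF; [exact: FT|exact: FT'].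
Qed.

Lemma vertex_boundary v : v \in vertices B.
Proof.
rewrite inE; apply/boundaryP; case: v => i b; split.
  exists (finset (fun=> b)); last by move=> v; rewrite !inE => /eqP->.
  rewrite inE (_ : (if _ then _ else _) = finset.set0); first exact: arcs0.
  by case: b; rewrite inE; apply/setP => j; rewrite !inE.
(* Neither the full set with apex x nor the empty set with apex y is a facet; [s] selects the one
   with the required sign at [i]. *)
pose s := (coord d5 i == None) == b.
exists (lift_set s (if s then finset.set0 else finset.setT)).
  by rewrite inE None_lift base_lift /s; case: (_ == b); rewrite ?finset.setC0; exact: arcsT.
by move=> v; rewrite inE => /eqP-> /=; rewrite inE {}/s; case: (coord d5 i) => [q|]; case: b; rewrite ?inE.
Qed.

Lemma card_vertices_boundary : #|vertices B| = (2 * d + 2)%N.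
Proof.
rewrite (_ : vertices B = finset.setT); last by apply/setP => v; rewrite vertex_boundary inE.
by rewrite cardsT card_prod card_ord card_bool; lia.
Qed.

Lemma compatible_antipode F T : compatible d5 F T -> compatible d5 (@antipode d.+1 @: F) (~: T).
Proof. by move=> FT v; rewrite in_antipode => /FT /= e; rewrite inE -e negbK. Qed.

Lemma boundary_symmetric : centrally_symmetric_under (@antipode d.+1) B.
Proof.
split.
- by move=> v _; exact: antipodeK.
- by move=> [i b] _; split; [exact: vertex_boundary|case; case: b].
- move=> F /boundaryP[[T TS FT] [T' T'S FT']]; apply/boundaryP; split.
    by exists (~: T); [rewrite suspensionC|exact: compatible_antipode].
  by exists (~: T'); [rewrite suspensionC|exact: compatible_antipode].
- move=> F /boundaryP[[T TS FT] _] /eqP/set0Pn[v vF] e.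
  have := FT _ vF; rewrite -e in vF; rewrite in_antipode in vF.
  by rewrite (esym (FT _ vF)) /=; case: (v.2).
Qed.

End Boundary.

(** * Flips *)

Section Flip.
Variables (R : realType) (N : finType).
Local Notation rf := {ptws option N -> R}.
Implicit Types (u : rf) (Z T B A : {set N}) (M P : {set {set N}}) (S : {set option N}).

Definition floor (u : rf) : {ptws N -> R} := fun i => u (Some i).

(** At height zero these are the points over [P] that are not interior to the union over [M]; above
    them stand vertical walls over the frontier of the union over [P]. Enlarging [P] trades walls
    for floor, until no wall is left. *)
Definition sheet (M P : {set {set N}}) : set rf :=
  [set u | [/\ exists o, u o != 0, 0 <= u None,
    union_orthants P (floor u) /\ union_orthants (~: M) (floor u) &
    u None = 0 \/ union_orthants (~: P) (floor u)]].

Definition pmin S o u : R := Num.max 0 (fmin S (u o) u).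

Lemma pminP S o u : o \in S ->
  (pmin S o u = 0 /\ exists2 i, i \in S & u i <= 0) \/
  [/\ 0 < pmin S o u, forall i, i \in S -> pmin S o u <= u i & exists2 i, i \in S & u i = pmin S o u].
Proof.
move=> oS; have [i iS ei] := @fmin_attained R _ S o u oS; rewrite /pmin.
have [h|h] := ltP 0 (fmin S (u o) u).
  by right; split=> //; [move=> j jS; exact: fmin_le|exists i].
by left; split=> //; exists i => //; rewrite ei.
Qed.

Lemma pmin_eq S o u x : o \in S -> 0 <= x -> (forall i, i \in S -> x <= u i) ->
  (exists2 i, i \in S & u i = x) -> pmin S o u = x.
Proof.
move=> oS x0 h [i iS e]; rewrite /pmin.
have -> : fmin S (u o) u = x.
  by apply/eqP; rewrite eq_le -{1}e fmin_le//= fmin_ge// h.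
by rewrite max_r.
Qed.

Lemma pmin_eq0 S o u : (exists2 i, i \in S & u i <= 0) -> pmin S o u = 0.
Proof. by move=> [i iS ui]; rewrite /pmin max_l//; apply: le_trans ui; exact: fmin_le. Qed.

Lemma pminZ S o u k : 0 < k -> pmin S o (scale k u) = k * pmin S o u.
Proof. by move=> k0; rewrite /pmin maxr_pMr ?ltW// mulr0 -fminZ// ltW. Qed.

Lemma cont_on_pmin S o (D : set rf) : cont_on D (pmin S o).
Proof.
apply: cont_on_max; first exact: cont_on_cst.
by apply: cont_on_fmin => [|i]; exact: cont_on_proj.
Qed.

Section AtOrigin.
Variables (M P : {set {set N}}) (A : {set N}) (a0 : N).
Hypotheses (a0A : a0 \in A) (nM : finset.set0 \notin M) (nP : finset.set0 \notin P).
Hypothesis AP : forall B : {set N}, B \subset A -> B != finset.set0 -> B \in P.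
Hypothesis PA : forall Z, Z \in P -> exists2 i, i \in A & i \in Z.

Let A' : {set option N} := lift_set false A.
Let nu := pmin (~: A') None.
Let mu := pmin A' (Some a0).

(** Slides upwards on [A] and downwards on the other coordinates and on the height, until one of the
    latter vanishes. Over the orthant being added, this takes the walls along [A] to the floor and
    the walls along the other facets; [unflip0] slides back until a coordinate in [A] vanishes. *)
Definition flip0 (u : rf) : rf := fun o => if o \in A' then u o + nu u else u o - nu u.
Definition unflip0 (u : rf) : rf := fun o => if o \in A' then u o - mu u else u o + mu u.

Let noA : None \in ~: A'. Proof. by rewrite !inE. Qed.
Let a0A' : Some a0 \in A'. Proof. by rewrite inE. Qed.
Let inA i : (Some i \in A') = (i \in A). Proof. by rewrite inE. Qed.
Let inC i : (Some i \in ~: A') = (i \notin A). Proof. by rewrite inE inA. Qed.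

Let pos0 (z : {ptws N -> R}) : (forall i, 0 <= z i) -> compat finset.set0 z.
Proof. by move=> h i; rewrite inE. Qed.

(* Orthants next to the one being flipped, across a wall. *)
Let wallA (z : {ptws N -> R}) i : (forall i, 0 <= z i) -> i \in A -> z i = 0 -> union_orthants P z.
Proof.
move=> h iA zi; exists [set i]%SET.
  by apply: AP; [rewrite finset.sub1set|apply/set0Pn; exists i; rewrite inE].
by move=> j; rewrite inE; case: eqP => // ->; rewrite zi.
Qed.

Let wallC (z : {ptws N -> R}) i : (forall i, 0 <= z i) -> i \notin A -> z i = 0 ->
  union_orthants (~: (finset.set0 |: P)) z.
Proof.
move=> h iA zi; exists [set i]%SET.
  rewrite !inE negb_or; apply/andP; split; first by apply/set0Pn; exists i; rewrite inE.
  by apply/negP => /PA[j jA]; rewrite inE => /eqP e; rewrite -e jA in iA.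
by move=> j; rewrite inE; case: eqP => // ->; rewrite zi.
Qed.

Let in_old (z : {ptws N -> R}) : union_orthants P z -> exists2 i, i \in A & z i <= 0.
Proof. by move=> [Z /PA[i iA iZ] /(_ i)]; rewrite iZ; exists i. Qed.

Let old_new (z : {ptws N -> R}) : union_orthants P z -> union_orthants (finset.set0 |: P) z.
Proof. by move=> [Z ZP cZ]; exists Z => //; rewrite inE ZP orbT. Qed.

Let outC (z : {ptws N -> R}) : (forall i, i \notin A -> 0 < z i) -> ~ union_orthants (~: (finset.set0 |: P)) z.
Proof.
move=> h [Z + cZ]; rewrite !inE negb_or => /andP[Z0 /negP]; apply.
apply: AP => //; apply/fintype.subsetP => i iZ; apply/negPn/negP => iA.
by have := cZ i; rewrite iZ leNgt h.
Qed.

Let compat0 (z : {ptws N -> R}) : (forall i, i \in A -> 0 < z i) ->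
  union_orthants (finset.set0 |: P) z -> forall i, 0 <= z i.
Proof.
move=> h [Z]; rewrite !inE => /orP[/eqP-> /[swap] i /(_ i)|/PA[i iA iZ] /(_ i)]; rewrite ?inE//.
by rewrite iZ leNgt h.
Qed.

Lemma flip0_sheet u : sheet M P u -> sheet M (finset.set0 |: P) (flip0 u) /\ unflip0 (flip0 u) = u.
Proof.
move=> [u_neq0 e0 [uP uM] uE].
have key : mu (flip0 u) = nu u -> unflip0 (flip0 u) = u.
  move=> e; apply/funext => o; rewrite /unflip0 e /flip0.
  by case: (o \in A'); rewrite ?addrK ?subrK.
have [i0 i0A zi0] := in_old uP.
have [[n0 [q oC uo]] | [n0 nle [q oC uo]]] := pminP u noA.
  have id : flip0 u = u.
    by apply/funext => j; rewrite /flip0 /nu n0 addr0 subr0 if_same.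
  split; last first.
    by apply: key; rewrite id /nu n0; apply: pmin_eq0; exists (Some i0); rewrite ?inA.
  rewrite id; split=> //; first by split=> //; exact: old_new.
  case: uE => [->|[Z ZP cZ]]; first by left.
  have [e|e0'] := eqVneq (u None) 0; [by left|right].
  case: q oC uo => [j|] oC uo; last by case/eqP: e0'; apply/eqP; rewrite eq_le e0 uo.
  have [Z0|Z0] := eqVneq Z finset.set0; last first.
    by exists Z => //; move: ZP; rewrite !inE negb_or Z0.
  have pos i : 0 <= floor u i by have := cZ i; rewrite Z0 inE.
  apply: (@wallC _ j) => //; first by rewrite -inC.
  by apply/eqP; rewrite eq_le uo pos.
rewrite -/nu in n0 nle uo.
have uN : nu u <= u None by exact: nle.
have pC i : i \notin A -> 0 < u (Some i) by move=> iA; apply: lt_le_trans n0 (nle _ _); rewrite inC.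
have pos i : 0 <= u (Some i).
  case: uE => [e|[Z ZP cZ]]; first by move: uN; rewrite e leNgt n0.
  suff Z0 : Z = finset.set0 by have := cZ i; rewrite Z0 inE.
  apply/eqP/negPn/negP => Z0; move: ZP; rewrite inE => /negP; apply.
  apply: AP => //; apply/fintype.subsetP => j jZ; apply/negPn/negP => /pC.
  by have := cZ j; rewrite jZ => h; rewrite ltNge h.
have fA i : i \in A -> flip0 u (Some i) = u (Some i) + nu u by move=> iA; rewrite /flip0 inA iA.
have fC o' : o' \in ~: A' -> flip0 u o' = u o' - nu u.
  by rewrite inE /flip0; case: (o' \in A').
have fpos i : 0 <= flip0 u (Some i).
  have [iA|iA] := boolP (i \in A); first by rewrite fA// addr_ge0 ?pos ?ltW.
  by rewrite fC ?inC// subr_ge0; apply: nle; rewrite inC.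
split; last first.
  apply: key; apply: pmin_eq => //; first exact: ltW.
    by case=> [i|]; rewrite ?inA => iA; [rewrite fA// lerDr pos|rewrite inE in iA].
  exists (Some i0); rewrite ?inA// fA// (_ : u (Some i0) = 0) ?add0r//.
  by apply/eqP; rewrite eq_le pos zi0.
split.
- by exists (Some a0); rewrite fA// gt_eqF// ltr_wpDl// pos.
- by rewrite fC// subr_ge0.
- split; exists finset.set0; rewrite ?inE ?eqxx//; exact: pos0.
- case: q oC uo => [j|] oC uo; last by left; rewrite fC// uo subrr.
  right; apply: (@wallC _ j) => //; first by rewrite -inC.
  by rewrite /floor fC// uo subrr.
Qed.

Lemma unflip0_sheet u : sheet M (finset.set0 |: P) u -> sheet M P (unflip0 u) /\ flip0 (unflip0 u) = u.
Proof.
move=> [u_neq0 e0 [uP uM] uE].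
have key : nu (unflip0 u) = mu u -> flip0 (unflip0 u) = u.
  move=> e; apply/funext => o; rewrite /flip0 e /unflip0.
  by case: (o \in A'); rewrite ?addrK ?subrK.
have hC : exists2 o, o \in ~: A' & u o <= 0.
  case: uE => [e|h]; first by exists None => //; rewrite e.
  apply: contrapT => none; apply: (outC _ h) => i iA; rewrite ltNge; apply/negP => ui.
  by apply: none; exists (Some i); rewrite ?inC.
have [[m0 [q oA uo]]|[m0 mle [q oA uo]]] := pminP u a0A'.
  have id : unflip0 u = u.
    by apply/funext => j; rewrite /unflip0 /mu m0 addr0 subr0 if_same.
  split; last by apply: key; rewrite id /mu m0; exact: pmin_eq0.
  rewrite id; split=> //.
    split=> //; case: q oA uo => [i|] iA ui; last by rewrite inE in iA.
    rewrite inA in iA.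
    case: uP => Z; rewrite !inE => /orP[/eqP-> cZ|ZP cZ]; last by exists Z.
    have pos j : 0 <= floor u j by have := cZ j; rewrite inE.
    by apply: (@wallA _ i) => //; apply/eqP; rewrite eq_le pos andbT.
  case: uE => [->|[Z ZP cZ]]; [by left|right; exists Z => //].
  by move: ZP; rewrite !inE negb_or => /andP[].
rewrite -/mu in m0 mle uo.
have pos i : 0 <= u (Some i).
  by apply: (compat0 _ uP) => j jA; apply: lt_le_trans m0 (mle _ _); rewrite inA.
have fA i : i \in A -> unflip0 u (Some i) = u (Some i) - mu u by move=> iA; rewrite /unflip0 inA iA.
have fC o' : o' \in ~: A' -> unflip0 u o' = u o' + mu u.
  by rewrite inE /unflip0; case: (o' \in A').
have fpos i : 0 <= unflip0 u (Some i).
  have [iA|iA] := boolP (i \in A); first by rewrite fA// subr_ge0 mle// inA.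
  by rewrite fC ?inC// addr_ge0 ?pos ?ltW.
have eN : 0 < unflip0 u None by rewrite fC// ltr_wpDl.
split; last first.
  apply: key; apply: pmin_eq => //; first exact: ltW.
    by move=> o' oC; rewrite fC// lerDr; case: o' oC => [i|] _.
  have [q' oC uo'] := hC; exists q' => //; rewrite fC// (_ : u q' = 0) ?add0r//.
  by apply/eqP; rewrite eq_le uo'; case: q' {oC uo'}.
split.
- by exists None; rewrite gt_eqF.
- exact: ltW.
- split; last by exists finset.set0; rewrite ?inE//; exact: pos0.
  case: q oA uo => [i|] iA ui; last by rewrite inE in iA.
  rewrite inA in iA; apply: (@wallA _ i) => //.
  by rewrite /floor fA// ui subrr.
- by right; exists finset.set0; rewrite ?inE//; exact: pos0.
Qed.

Lemma conic_iso_flip0 : conic_iso (sheet M P) (sheet M (finset.set0 |: P)) flip0 unflip0.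
Proof.
split=> //; [|exact: flip0_sheet|exact: unflip0_sheet|].
  split; apply: cont_on_ptws => o; rewrite /flip0 /unflip0;
    case: (o \in A'); first [apply: cont_onB | apply: cont_onD];
    first [exact: cont_on_proj | exact: cont_on_pmin].
move=> k u k0 _; apply/funext => o; rewrite /flip0 /nu pminZ// /scale.
by case: (o \in A'); rewrite ?mulrDr ?mulrN.
Qed.

(** The two antipodal halves will meet at height zero, so the flips do not disturb their gluing. *)
Lemma flip0_id u : u None = 0 -> flip0 u = u.
Proof.
move=> uN; have n0 : nu u = 0 by apply: pmin_eq0; exists None; rewrite ?uN.
by apply/funext => j; rewrite /flip0 n0 addr0 subr0 if_same.
Qed.

End AtOrigin.

Lemma union_orthants_twist T (P : {set {set N}}) (z : {ptws N -> R}) :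
  union_orthants (symdiff T @: P) (twist T z) <-> union_orthants P z.
Proof.
split=> [[Z /imsetP[Z' Z'P ->] /compat_twist cZ]|[Z ZP cZ]]; first by exists Z'.
by exists (symdiff T Z); [exact: imset_f|exact/compat_twist].
Qed.

Lemma imset_symdiffC T P : symdiff T @: (~: P) = ~: (symdiff T @: P).
Proof.
have inj := can_inj (@symdiffK N T).
apply/setP => Z; rewrite -(symdiffK T Z) inE !(mem_imset _ _ inj) inE.
by [].
Qed.

Lemma floor_twist T u : floor (twist (lift_set false T) u) = twist T (floor u).
Proof. by apply/funext => i; rewrite /floor /twist inE. Qed.

Lemma sheet_twist T M P u :
  sheet (symdiff T @: M) (symdiff T @: P) (twist (lift_set false T) u) <-> sheet M P u.
Proof.
rewrite /sheet /= floor_twist -!imset_symdiffC.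
have -> : twist (lift_set false T) u None = u None by rewrite /twist None_lift.
have e : (exists o, twist (lift_set false T) u o != 0) <-> (exists o, u o != 0).
  by split=> -[q uq]; exists q; move: uq; rewrite twist_neq0.
split=> -[/e h1 h2 [/union_orthants_twist h3 /union_orthants_twist h4] h5];
  split=> //; case: h5 => [->|/union_orthants_twist h]; by [left|right].
Qed.

Lemma conic_iso_sheet_twist T M P :
  conic_iso (sheet M P) (sheet (symdiff T @: M) (symdiff T @: P))
    (twist (lift_set false T)) (twist (lift_set false T)).
Proof.
split.
- by split; exact: cont_on_twist.
- by move=> u uS; rewrite twistK; split=> //; exact/sheet_twist.
- by move=> u uS; rewrite twistK; split=> //; apply/(sheet_twist T); rewrite twistK.
- by move=> k u _ _; rewrite twistZ.
Qed.

Lemma conic_sheet M P : conic (sheet M P).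
Proof.
have cU Q k u : 0 < k -> union_orthants Q (floor u) -> union_orthants Q (floor (scale k u)).
  by move=> k0 [Z ZQ /(compatZ k0) cZ]; exists Z.
move=> k u k0 [[q uq] e0 [uP uM] uE]; split.
- by exists q; rewrite mulf_neq0// gt_eqF.
- by rewrite mulr_ge0// ltW.
- by split; exact: cU.
- by case: uE => [e|uE]; [left; rewrite /scale e mulr0|right; exact: cU].
Qed.

Lemma conic_iso_flip M P T A : A != finset.set0 -> T \notin M -> T \notin P ->
  (forall B : {set N}, B \subset A -> B != finset.set0 -> symdiff T B \in P) ->
  (forall Z, Z \in P -> exists2 i, i \in A & (i \in T) != (i \in Z)) ->
  exists F G, conic_iso (sheet M P) (sheet M (T |: P)) F G /\ forall u, u None = 0 -> F u = u.
Proof.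
move=> /set0Pn[a aA] TM TP h1 h2.
have inj := can_inj (@symdiffK N T).
have in0 (Q : {set {set N}}) : (finset.set0 \in symdiff T @: Q) = (T \in Q).
  by rewrite -(symdiffxx T) (mem_imset _ _ inj).
have h := @conic_iso_flip0 (symdiff T @: M) (symdiff T @: P) A a aA.
rewrite !in0 in h.
have {}h : conic_iso (sheet (symdiff T @: M) (symdiff T @: P))
    (sheet (symdiff T @: M) (symdiff T @: (T |: P))) (flip0 A) (unflip0 A a).
  rewrite finset.imsetU1 symdiffxx; apply: h => //.
    by move=> B BA B0; rewrite -(symdiffK T B) (mem_imset _ _ inj); exact: h1.
  move=> _ /imsetP[Z ZP ->]; have [i iA ne] := h2 _ ZP; exists i => //.
  by rewrite in_symdiff.
have t1 := conic_iso_sheet_twist T M P; have t2 := conic_iso_sheet_twist T M (T |: P).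
have t := conic_iso_trans (conic_iso_trans t1 h) (conic_iso_sym (@conic_sheet _ _) t2).
do 2!eexists; split; first exact: t.
by move=> u uN /=; rewrite flip0_id ?twistK// /twist None_lift.
Qed.

(** The orthants outside [I] are added by increasing rank, one flip for each. *)
Lemma sweep M (I : {set {set N}}) (rho : {set N} -> nat) : M \subset I ->
  (forall T, T \notin I -> exists A : {set N}, [/\ A != finset.set0,
     forall B : {set N}, B \subset A -> B != finset.set0 ->
       symdiff T B \in I \/ (rho (symdiff T B) < rho T)%N &
     forall Z, Z != T -> Z \in I \/ (rho Z <= rho T)%N ->
       exists2 i, i \in A & (i \in T) != (i \in Z)]) ->
  exists F G, conic_iso (sheet M I) (sheet M finset.setT) F G /\ forall u, u None = 0 -> F u = u.
Proof.
move=> MI h.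
suff H n : forall P : {set {set N}}, #|~: P| = n -> I \subset P ->
    (forall Z T, Z \in P -> T \notin P -> Z \in I \/ (rho Z <= rho T)%N) ->
    exists F G, conic_iso (sheet M P) (sheet M finset.setT) F G /\ forall u, u None = 0 -> F u = u.
  by apply: (H _ I) => // Z T ZI _; left.
elim: n => [|n IH] P cP IP hP.
  have -> : P = finset.setT.
    by move/eqP: cP; rewrite cards_eq0 => /eqP e; rewrite -(finset.setCK P) e finset.setC0.
  by exists id, id; split=> //; exact: conic_iso_id.
have /set0Pn[T1 T1P] : ~: P != finset.set0 by rewrite -card_gt0 cP.
have [T TP minT] := @arg_minnP _ T1 (mem (~: P)) rho T1P.
have {}TP : T \notin P by move: TP; rewrite /= inE.
have TI : T \notin I by apply: contra TP; exact: fintype.subsetP.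
have [A [A0 h1 h2]] := h _ TI.
have [|||F [G [iso Fid]]] := @conic_iso_flip M P T A A0 _ TP.
- by apply: contra TI; exact: fintype.subsetP.
- move=> B BA B0; have [/(fintype.subsetP IP)//|lt] := h1 _ BA B0.
  apply/negPn/negP => nP; have := minT (symdiff T B); rewrite /= inE nP leqNgt lt.
  by move=> /(_ isT).
- move=> Z ZP; apply: h2; first by apply: contraNneq TP => <-.
  exact: hP.
have [||| F' [G' [iso' Fid']]] := IH (T |: P).
- by have := cardsC P; have := cardsC (T |: P); rewrite cardsU1 TP; lia.
- by apply: fintype.subset_trans IP _; exact: finset.subsetUr.
- move=> Z T'; rewrite !inE negb_or => /orP[/eqP->|ZP] /andP[T'T T'P]; last exact: hP.
  by right; apply: minT; rewrite /= inE.
exists (F' \o F), (G \o G'); split; first exact: conic_iso_trans iso iso'.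
by move=> u uN /=; rewrite Fid// Fid'.
Qed.

(** Let H be the least member of [I] containing [Y]. Then [Y] contains the extreme points X of H,
    and its orthant is attached along X together with [H :\: Y]. If no member contains [Y], the
    orthant is attached along [Y] itself, after all those that have a hull. *)
Lemma sweep_geometry M (I : {set {set N}}) : M \subset I -> finset.set0 \in I ->
  (forall Y, Y \in I -> exists X : {set N}, [/\ X \subset Y, (#|X| <= 2)%N,
    forall B : {set N}, B \subset X -> Y :\: B \in I &
    forall Z : {set N}, Z \in I -> X \subset Z -> Y \subset Z]) ->
  exists F G, conic_iso (sheet M I) (sheet M finset.setT) F G /\ forall u, u None = 0 -> F u = u.
Proof.
move=> MI I0 ext; pose n := #|N|.
pose above (Y Z : {set N}) := (Z \in I) && (Y \subset Z).
pose hull (Y : {set N}) : nat :=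
  if [pick Z | above Y Z] is Some Z0 then #|[arg min_(Z < Z0 | above Y Z) #|Z|]| else n.+1.
have hull_le (Y Z : {set N}) : Z \in I -> Y \subset Z -> (hull Y <= #|Z|)%N.
  move=> ZI YZ; rewrite /hull; case: pickP => [Z0 h0|none].
    by case: arg_minnP => // W _; apply; rewrite /above ZI.
  by have := none Z; rewrite /above ZI YZ.
have hullP (Y : {set N}) : (hull Y <= n)%N -> exists Z, [/\ Z \in I, Y \subset Z & hull Y = #|Z|].
  rewrite /hull; case: pickP => [Z0 h0 _|none]; last by rewrite ltnn.
  by case: arg_minnP => // W /andP[WI YW] _; exists W.
have cn (Y : {set N}) : (#|Y| <= n)%N by exact: max_card.
have inI Y : Y \in I -> (hull Y <= n)%N by move=> YI; exact: leq_trans (hull_le _ _ YI _) (cn _).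
(* Lexicographic: smaller hulls come first and, for hulls of equal size, larger sets. The sets
   without hull, marked by the impossible size [n.+1], follow by increasing size. *)
pose rho (Y : {set N}) : nat := if (hull Y <= n)%N then (hull Y * n.+1 + (n - #|Y|))%N
                    else (n.+1 * n.+1 + #|Y|)%N.
have rho_lt Y : (hull Y <= n)%N -> (rho Y < n.+1 * n.+1)%N.
  by move=> hY; rewrite /rho hY; nia.
have rhoB (Y : {set N}) : (n < hull Y)%N -> rho Y = (n.+1 * n.+1 + #|Y|)%N.
  by rewrite /rho ltnNge => /negbTE->.
have rhoS (Y : {set N}) : (hull Y <= n)%N -> rho Y = (hull Y * n.+1 + (n - #|Y|))%N.
  by rewrite /rho => ->.
apply: (sweep (rho := rho)) => // Y YI.
have [hY|hY] := leqP (hull Y) n; last first.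
  exists Y; split.
  - by apply: contraNneq YI => ->.
  - move=> B BY B0; right; have lt := card_symdiff_lt BY B0.
    have [h'|h'] := leqP (hull (symdiff Y B)) n.
      by apply: leq_trans (rho_lt _ h') _; rewrite rhoB// leq_addr.
    by rewrite !rhoB// ltn_add2l.
  - move=> Z ZY hZ; apply: contrapT => none.
    have YZ : Y \subset Z.
      apply/fintype.subsetP => i iY; apply/negPn/negP => iZ; apply: none.
      by exists i => //; rewrite iY (negbTE iZ).
    have hZn : (n < hull Z)%N.
      rewrite ltnNge; apply/negP => /hullP[W [WI ZW _]].
      have := hull_le _ _ WI (fintype.subset_trans YZ ZW).
      by move/(leq_trans hY); rewrite ltnNge cn.
    case: hZ => [/inI|]; first by rewrite leqNgt hZn.
    rewrite !rhoB// leq_add2l => cZ.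
    by case/eqP: ZY; apply/esym/eqP; rewrite eqEcard YZ.
have [H [HI YH eH]] := hullP _ hY; have [X [XH _ hB hX]] := ext _ HI.
(* An extreme point of [H] missing from [Y] could be removed from [H], giving a smaller member
   around [Y]. *)
have XY : X \subset Y.
  apply/fintype.subsetP => x xX; apply/negPn/negP => xY.
  have xI : H :\ x \in I by apply: hB; rewrite finset.sub1set.
  have := hull_le Y _ xI; rewrite eH (cardsD1 x H) (fintype.subsetP XH)// ltnn => h.
  by have := h; rewrite finset.subsetD1 YH xY => /(_ isT).
have HY : H :\: Y != finset.set0.
  by apply: contraNneq YI => /eqP; rewrite finset.setD_eq0 => HY; rewrite (_ : Y = H)//;
    apply/eqP; rewrite finset.eqEsubset YH.
exists (X :|: (H :\: Y)); split.
- by apply: contraNneq HY => /eqP; rewrite finset.setU_eq0 => /andP[_ ->].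
- move=> B /fintype.subsetP BA B0; right.
  have subH : symdiff Y B \subset H.
    apply/fintype.subsetP => i; rewrite in_symdiff.
    have := BA i; have := fintype.subsetP YH i; have := fintype.subsetP XH i; rewrite !inE.
    by case: (i \in B); case: (i \in Y) => //=; case: (i \in X) => //= _ _ /(_ isT).
  (* Without extreme points in [B] the set grows inside the same hull; with one, the hull
     shrinks. *)
  have [BX|/set0Pn[x]] := eqVneq (B :&: X) finset.set0.
    have YB : Y \proper symdiff Y B.
      rewrite properE; apply/andP; split.
        apply/fintype.subsetP => i iY; rewrite in_symdiff iY.
        case iB: (i \in B) => //; have := BA _ iB; rewrite !inE iY /= orbF => iX.
        by move/setP/(_ i): BX; rewrite !inE iB iX.
      have /set0Pn[b bB] := B0; apply/negP => /fintype.subsetP/(_ b); rewrite in_symdiff bB.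
      have := BA _ bB; rewrite !inE; case bY: (b \in Y) => //=; last by move=> _ /(_ isT).
      by rewrite orbF => bX; move/setP/(_ b): BX; rewrite !inE bB bX.
    have := proper_card YB; have := hull_le _ _ HI subH; have := cn (symdiff Y B).
    move=> c1 c2 c3; rewrite -eH in c2; rewrite !rhoS ?(leq_trans c2)//; move: c1 c2 c3; clear; nia.
  rewrite inE => /andP[xB xX].
  have xI : H :\ x \in I by apply: hB; rewrite finset.sub1set.
  have sub : symdiff Y B \subset H :\ x.
    by rewrite finset.subsetD1 subH in_symdiff xB (fintype.subsetP XY).
  have := hull_le _ _ xI sub; have := cardsD1 x H; rewrite (fintype.subsetP XH)//= => e c.
  have lt : (hull (symdiff Y B) < hull Y)%N by rewrite eH; move: e c; clear; lia.
  rewrite !rhoS ?(leq_trans (ltnW lt))//.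
  by have := cn (symdiff Y B); move: lt; clear; nia.
- move=> Z ZY hZ; apply: contrapT => none.
  have agree i : i \in X :|: (H :\: Y) -> (i \in Y) = (i \in Z).
    by move=> iA; apply/eqP/negPn/negP => ne; apply: none; exists i.
  have XZ : X \subset Z.
    apply/fintype.subsetP => i iX; rewrite -agree ?inE ?iX//; exact: fintype.subsetP iX.
  have /set0Pn[y yHY] := HY; have yZ : y \notin Z.
    by rewrite -agree; [move: yHY; rewrite inE => /andP[]|rewrite inE yHY orbT].
  have yH : y \in H by move: yHY; rewrite inE => /andP[].
  case: hZ => [ZI|hZ]; first by have := fintype.subsetP (hX _ ZI XZ) _ yH; rewrite (negbTE yZ).
  have hZn : (hull Z <= n)%N.
    rewrite leqNgt; apply/negP => hZn; have := rho_lt _ hY.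
    by move: hZ; rewrite (rhoB _ hZn); clear; lia.
  have [W [WI ZW eW]] := hullP _ hZn.
  have HW := hX _ WI (fintype.subset_trans XZ ZW).
  have cHW : (hull Z <= hull Y)%N.
    by move: hZ; rewrite !rhoS//; have := cn Z; have := cn Y; clear; nia.
  have eHW : H = W by apply/eqP; rewrite eqEcard HW -eW -eH.
  have ZsY : Z \subset Y.
    apply/fintype.subsetP => i iZ; apply/negPn/negP => iY.
    have : i \in H :\: Y by rewrite inE iY eHW (fintype.subsetP ZW).
    by move=> h; have := agree i; rewrite inE h orbT iZ (negbTE iY) => /(_ isT).
  have : (#|Z| < #|Y|)%N by apply: proper_card; rewrite finset.properEneq ZY.
  move: hZ; rewrite !rhoS// eW eH eHW leq_add2l; have := cn Z; have := cn Y; clear; lia.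
Qed.

End Flip.

(** * The boundary as a double *)

Lemma cont_on_continuous (X Y : topologicalType) (f : X -> Y) : cont_on setT f -> continuous f.
Proof.
move=> cf x P nP; have := cf x I P nP; rewrite /nbhs/= /within /=.
by apply: filterS => z; exact.
Qed.

Section Closed.
Variable X : topologicalType.

Lemma closed_exists (I : finType) (P : pred I) (A : I -> set X) : (forall i, closed (A i)) ->
  closed [set x | exists2 i, P i & A i x].
Proof.
move=> cA; have -> : [set x | exists2 i, P i & A i x] = \bigcup_(i in [set` P]) A i by [].
by apply: closed_bigcup => // i _.
Qed.

Lemma closed_forall (I : Type) (A : I -> set X) : (forall i, closed (A i)) ->
  closed [set x | forall i, A i x].
Proof.
move=> cA; have -> : [set x | forall i, A i x] = \bigcap_(i in setT) A i.
  by apply/seteqP; split=> x h i; [move=> _|]; exact: h.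
by apply: closed_bigI => i _.
Qed.

Lemma closed_le0 (R : realType) (f : X -> R) : cont_on setT f -> closed [set x | f x <= 0].
Proof.
move=> /cont_on_continuous cf.
have -> : [set x | f x <= 0] = f @^-1` [set y | y <= 0] by [].
by apply: preimage_closed; [move=> x _; exact: cf|exact: closed_le].
Qed.

(** The pasting lemma for two pieces that are closed only relative to their union, as happens for
    cones without origin. *)
Lemma cont_on_union (Y : topologicalType) (A B A' B' : set X) (F : X -> Y) :
  closed A' -> closed B' -> (forall x, A x \/ B x -> (A x <-> A' x) /\ (B x <-> B' x)) ->
  cont_on A F -> cont_on B F -> cont_on [set x | A x \/ B x] F.
Proof.
move=> cA cB h fA fB.
have aux (C D C' : set X) x : closed C' -> (forall x, C x \/ D x -> (C x <-> C' x)) ->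
    cont_on C F -> C x \/ D x -> forall P, nbhs (F x) P ->
    \forall z \near x, C z \/ D z -> C z -> P (F z).
  move=> cC hC fC xCD P nP; have [Cx|nCx] := pselect (C x).
    by have := fC x Cx P nP; rewrite /nbhs/= /within /= => H; near=> z => _; near: z.
  have nC : nbhs x (~` C').
    by apply: open_nbhs_nbhs; split; [exact: closed_openC|move/hC => /(_ xCD)].
  near=> z => CDz Cz; have : (~` C') z by near: z.
  by case; apply/hC.
move=> x Cx P nP; rewrite /nbhs/= /within /=.
have h1 := aux A B A' x cA (fun x hx => (h x hx).1) fA Cx P nP.
have h2 := aux B A B' x cB (fun x hx => (h x ((or_comm _ _).1 hx)).2) fB ((or_comm _ _).1 Cx) P nP.
near=> z => Az.
have k1 : A z \/ B z -> A z -> P (F z) by near: z.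
have k2 : B z \/ A z -> B z -> P (F z) by near: z.
by case: (Az) => ?; [apply: k1|apply: k2 => //; apply/or_comm].
Unshelve. all: by end_near. Qed.

End Closed.

Section Glue.
Variable R : realType.
Local Notation rf I := {ptws I -> R}.

(** [F] is continued to the antipodal copy by x -> -F(-x). Oddness makes this consistent on the
    overlap, and the last hypothesis does the same for the inverse. The closed sets [Xc] and [Yc]
    feed the pasting lemma. *)
Lemma conic_iso_odd_union (I J : finType) (X Xc : set (rf I)) (Y Yc : set (rf J)) F G :
  closed Xc -> (forall x, X x <-> Xc x /\ exists i, x i != 0) ->
  closed Yc -> (forall y, Y y <-> Yc y /\ exists i, y i != 0) ->
  conic X -> conic_iso X Y F G ->
  (forall x, X x -> X (opp x) -> F (opp x) = opp (F x)) ->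
  (forall y, Y y -> Y (opp y) -> X (opp (G y))) ->
  conic_homeo [set x | X x \/ X (opp x)] [set y | Y y \/ Y (opp y)].
Proof.
move=> cX eX cY eY coX iso odd back.
have [[cF cG] hF hG hZ] := iso.
pose ext (K L : finType) (A : set (rf K)) (f : rf K -> rf L) x :=
  if `[< A x >] then f x else opp (f (opp x)).
have ext1 K L A f x : A x -> @ext K L A f x = f x by move=> Ax; rewrite /ext; case: asboolP.
have ext2 K L A f x : (A x -> A (opp x) -> f (opp x) = opp (f x)) -> A (opp x) ->
    @ext K L A f x = opp (f (opp x)).
  by move=> o Ax; rewrite /ext; case: asboolP => // A1; rewrite o// oppK.
have cext (K L : finType) (A Ac : set (rf K)) (f : rf K -> rf L) :
    closed Ac -> (forall x, A x <-> Ac x /\ exists i, x i != 0) ->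
    cont_on A f -> (forall x, A x -> A (opp x) -> f (opp x) = opp (f x)) ->
    cont_on [set x | A x \/ A (opp x)] (ext K L A f).
  move=> cA eA cf of_; apply: (@cont_on_union _ _ A (fun x => A (opp x)) Ac (fun x => Ac (opp x))) => //.
  - have -> : (fun x => Ac (opp x)) = (@opp R K) @^-1` Ac by [].
    by apply: preimage_closed => // x _; exact: cont_on_continuous (@cont_on_opp R K setT) _.
  - have nz (x : rf K) : (exists i, opp x i != 0) <-> (exists i, x i != 0).
      by split=> -[i h]; exists i; move: h; rewrite /opp oppr_eq0.
    move=> x; rewrite !eA nz => h; have x0 : exists i, x i != 0 by case: h => -[].
    by split; split=> [[]|].
  - by apply: cont_on_eq cf => x /ext1->.
  - apply: (@cont_on_eq _ _ _ (fun x => opp (f (opp x)))); first by move=> x Ax; rewrite ext2//; exact: of_.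
    apply: (@cont_on_comp _ _ _ _ setT (fun x => f (opp x))) => //; last exact: cont_on_opp.
    by apply: (@cont_on_comp _ _ _ _ A); [|exact: cont_on_opp|].
have oddG y : Y y -> Y (opp y) -> G (opp y) = opp (G y).
  move=> Yy Yoy; have [Xy Fy] := hG _ Yy; have Xoy := back _ Yy Yoy.
  by rewrite -{1}Fy -odd// (hF _ Xoy).2.
exists (ext _ _ X F), (ext _ _ Y G); split.
- by split; [exact: cext cX eX cF odd|exact: cext cY eY cG oddG].
- move=> x [Xx|Xx]; have [YF GF] := hF _ Xx.
    by rewrite ext1//; split; [left|rewrite ext1].
  rewrite (ext2 _ _ _ _ x)//; last exact: odd.
  split; first by right; rewrite /= oppK.
  by rewrite ext2; [rewrite oppK GF oppK|exact: oddG|rewrite oppK].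
- move=> y [Yy|Yy]; have [XG FG] := hG _ Yy.
    by rewrite ext1//; split; [left|rewrite ext1].
  rewrite (ext2 _ _ _ _ y)//; last exact: oddG.
  split; first by right; rewrite /= oppK.
  by rewrite ext2; [rewrite oppK FG oppK|exact: odd|rewrite oppK].
- move=> k x k0 [Xx|Xx]; first by rewrite !ext1 ?hZ//; exact: coX.
  have Xk : X (opp (scale k x)) by rewrite oppZ; exact: coX.
  rewrite (ext2 _ _ _ _ (scale k x) (@odd _) Xk) (ext2 _ _ _ _ x (@odd _) Xx).
  by rewrite oppZ hZ// oppZ.
Qed.

End Glue.

Section SheetClosed.
Variables (R : realType) (N : finType).
Implicit Types (M P : {set {set N}}).

Lemma closed_union_orthants (X : topologicalType) (f : X -> {ptws N -> R}) P :
  cont_on setT f -> closed [set x | union_orthants P (f x)].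
Proof.
move=> cf; apply: (@closed_exists X _ (mem P) (fun Z => [set x | compat Z (f x)])) => Z.
apply: (@closed_forall _ _ (fun o => [set x | if o \in Z then f x o <= 0 else 0 <= f x o])) => o.
have c : cont_on setT (fun x => f x o).
  by apply: (@cont_on_comp _ _ _ _ setT f (fun p : {ptws N -> R} => p o)) => //; exact: cont_on_proj.
case: (o \in Z); first exact: closed_le0.
have -> : [set x | 0 <= f x o] = [set x | - f x o <= 0].
  by apply/funext => x; rewrite /= oppr_le0.
by apply: closed_le0; exact: cont_onN.
Qed.

Definition closed_sheet M P : set {ptws option N -> R} :=
  [set u | - u None <= 0] `&`
  ([set u | union_orthants P (floor u)] `&` [set u | union_orthants (~: M) (floor u)]) `&`
  ([set u | `|u None| <= 0] `|` [set u | union_orthants (~: P) (floor u)]).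

Lemma closed_closed_sheet M P : closed (closed_sheet M P).
Proof.
have cN : cont_on setT (fun u : {ptws option N -> R} => u None) by exact: cont_on_proj.
have cU (Q : {set {set N}}) : closed [set u : {ptws option N -> R} | union_orthants Q (floor u)].
  by apply: closed_union_orthants; apply: cont_on_ptws => i; exact: cont_on_proj.
apply: closedI; first by apply: closedI; [exact/closed_le0/cont_onN|exact: closedI].
by apply: closedU => //; exact/closed_le0/cont_on_abs.
Qed.

Lemma sheetE M P u : sheet (R := R) M P u <-> closed_sheet M P u /\ exists o, u o != 0.
Proof.
split.
  move=> [u0 e0 uPM uE]; split=> //; split; first by split=> //=; rewrite oppr_le0.
  by case: uE => [e|]; [left; rewrite /= e normr0|right].
move=> [[[/= h1 h2] h3] h4]; split=> //; first by rewrite -oppr_le0.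
by case: h3 => [|h3]; [rewrite /= normr_le0 => /eqP; left|right].
Qed.

Lemma compatC Z (z : {ptws N -> R}) : compat (~: Z) (opp z) <-> compat Z z.
Proof.
by split=> h o; have := h o; rewrite inE; case: (o \in Z); rewrite /opp /= ?oppr_le0 ?oppr_ge0.
Qed.

End SheetClosed.

(** * The boundary as the union of two antipodal sheets *)

Section Double.
Variables (R : realType) (d : nat).
Hypothesis d5 : (5 <= d)%N.
Let I := arcs d.
Let M := middle I.

(** The inclusions say that [T] agrees with [Y] and [~: W] wherever these two agree, so its orthant
    contains every point common to theirs. [Y] and [W] are enlarged by outer neighbours until one of
    them is middle. *)
Lemma middle_between Y W : Y \in I -> W \in I ->
  exists T, [/\ T \in M, Y :\: W \subset T & T \subset Y :|: ~: W].
Proof.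
have [n] := ubnP (#|~: Y| + #|~: W|); elim: n Y W => // n IH Y W lt YI WI.
have [YM|YM] := boolP (~: Y \in I).
  by exists Y; rewrite inE YI YM finset.subsetDl finset.subsetUl.
have [WM|WM] := boolP (~: W \in I).
  by exists (~: W); rewrite inE finset.setCK WI WM finset.setDE finset.subsetIr finset.subsetUr.
have sub (U V : {set 'I_d}) : U \in I -> V \in I -> ~: U \notin I ->
    U \subset V \/ exists2 x, x \notin U :|: V & x |: U \in I.
  move=> UI VI nU; have [->|U0] := eqVneq U finset.set0; first by left; exact: finset.sub0set.
  have [X [XU _ hB hX _]] := arcs_outer d5 UI nU U0.
  have [XV|] := boolP (X \subset V); first by left; exact: hX.
  move=> /fintype.subsetPn[x xX xV]; right; exists x.
    by rewrite !inE negb_or xV (disjointFr XU).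
  by rewrite finset.setUC; apply: hB; rewrite finset.sub1set.
have grow (U : {set 'I_d}) x : x \notin U -> (#|~: (x |: U)| < #|~: U|)%N.
  move=> xU; apply: proper_card; rewrite finset.properC.
  by rewrite properE finset.subsetUr finset.subUset finset.sub1set (negbTE xU).
case: (sub Y W YI WI YM) => [YW|[x]]; last first.
  rewrite inE negb_or => /andP[xY xW] xI.
  have [|T [TM T1 T2]] := IH (x |: Y) W _ xI WI; first by have := grow _ _ xY; lia.
  exists T; split=> //.
    apply: fintype.subset_trans T1; apply: finset.setSD; exact: finset.subsetUr.
  apply: (fintype.subset_trans T2); rewrite !finset.subUset finset.subsetUl finset.subsetUr !andbT.
  by rewrite finset.sub1set !inE xW orbT.
case: (sub W Y WI YI WM) => [WY|[x]]; last first.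
  rewrite inE negb_or => /andP[xW xY] xI.
  have [|T [TM T1 T2]] := IH Y (x |: W) _ YI xI; first by have := grow _ _ xW; lia.
  exists T; split=> //.
    apply: fintype.subset_trans T1; apply/fintype.subsetP => y; rewrite !inE negb_or.
    by move=> /andP[yW yY]; rewrite yY yW !andbT; apply: contraNneq xY => <-.
  apply: (fintype.subset_trans T2); apply: finset.setUS; rewrite finset.setCS; exact: finset.subsetUr.
(* Neither set can be enlarged, so they coincide; the inclusions are then void and any middle member
   will do. *)
have e : Y = W by apply/eqP; rewrite finset.eqEsubset YW.
have [T TM] : exists T, T \in M.
  exists (finset (fun p : 'I_d => (crossing (uphalf d) p < 0)%N == (uphalf d <= p)%N)).
  by apply/(arcs_ring d5); exists false, 0%N; split=> // p; rewrite inE.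
exists T; split=> //; rewrite -e ?finset.setDv ?finset.setUCr ?finset.sub0set ?finset.subsetT//.
Qed.

Lemma sheet_both u : sheet (R := R) M I u -> sheet M I (opp u) ->
  u None = 0 /\ union_orthants M (floor u).
Proof.
move=> [_ e1 [[Y YI cY] _] _] [_ e2 [[W WI cW] _] _]; split.
  by apply/eqP; rewrite eq_le e1 -oppr_ge0; rewrite e2.
have [T [TM T1 T2]] := middle_between YI WI; exists T => // i.
have := cY i; have := cW i; rewrite /floor /opp.
have := fintype.subsetP T1 i; have := fintype.subsetP T2 i; rewrite !inE.
rewrite oppr_le0 oppr_ge0.
by case: (i \in T); case: (i \in Y); case: (i \in W) => a b c e;
  first [exact: c | exact: e | by have := a isT | by have := b isT].
Qed.

(** Up to the antipodal map the apex coordinate is nonnegative. At height zero an orthant outside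
    the suspension may have either apex sign, which amounts to not being middle; at positive height
    it has to lie over a set outside [I]. *)
Lemma signed_boundary z :
  signed_cone (R := R) (coord d5) (boundary R (D1 d :|: D2 d)) z <->
  sheet M I z \/ sheet M I (opp z).
Proof.
have half (u : {ptws option 'I_d -> R}) : (exists o, u o != 0) -> 0 <= u None ->
    (exists2 T, T \in suspension I & compat T u) -> (exists2 T, T \notin suspension I & compat T u) ->
    (exists2 Y, Y \in I & compat Y (floor u)) -> sheet M I u.
  move=> u0 uN _ [T TS cT] uI; split=> //.
    split=> //; move: TS; rewrite inE; case: ifP => nT TI.
      by exists (base T); [rewrite finset.in_setC [_ \in M]inE negb_and TI orbT|move=> i; have := cT (Some i); rewrite inE].
    by exists (base T); [rewrite finset.in_setC [_ \in M]inE negb_and TI|move=> i; have := cT (Some i); rewrite inE].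
  have [e|e] := eqVneq (u None) 0; [by left|right].
  have nT : None \notin T.
    by apply/negP => nT; case/eqP: e; apply/eqP; rewrite eq_le uN andbT; have := cT None; rewrite nT.
  move: TS; rewrite inE (negbTE nT) => TI; exists (base T); first by rewrite inE.
  by move=> i; have := cT (Some i); rewrite inE.
have oppS (u : {ptws option 'I_d -> R}) T : compat T u -> compat (~: T) (opp u).
  by move=> ?; apply/compatC.
rewrite /signed_cone /=; split.
  move=> [z0 /boundaryP[[T TS /compatible_sign_face cT] [T' T'S /compatible_sign_face cT']]].
  have [nT|nT] := boolP (None \in T); [right|left]; apply: half.
  - by have [q zq] := z0; exists q; rewrite /opp oppr_eq0.
  - by have := cT None; rewrite nT oppr_ge0.
  - by exists (~: T); [rewrite suspensionC|exact: oppS].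
  - by exists (~: T'); [rewrite suspensionC|exact: oppS].
  - exists (base (~: T)); first by move: TS; rewrite inE nT baseC.
    by move=> i; have := oppS _ _ cT (Some i); rewrite !inE.
  - exact: z0.
  - by have := cT None; rewrite (negbTE nT).
  - by exists T.
  - by exists T'.
  - exists (base T); first by move: TS; rewrite inE (negbTE nT).
    by move=> i; have := cT (Some i); rewrite !inE.
have back (u : {ptws option 'I_d -> R}) : sheet M I u ->
    (exists2 T, T \in suspension I & compat T u) /\ (exists2 T, T \notin suspension I & compat T u).
  move=> [u0 uN [[Y YI cY] [W WM cW]] uE]; split.
    exists (lift_set false Y); first by rewrite inE None_lift base_lift.
    by case=> [i|]; [have := cY i; rewrite inE|rewrite inE].
  case: uE => [e|[V VI cV]]; last first.
    exists (lift_set false V); first by rewrite inE None_lift base_lift -finset.in_setC.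
    by case=> [i|]; [have := cV i; rewrite inE|rewrite inE].
  move: WM; rewrite finset.in_setC [_ \in M]inE negb_and => /orP[WI|WI].
    exists (lift_set false W); first by rewrite inE None_lift base_lift.
    by case=> [i|]; [have := cW i; rewrite inE|rewrite inE].
  exists (lift_set true W); first by rewrite inE None_lift base_lift.
  by case=> [i|]; [have := cW i; rewrite inE|rewrite inE e].
have nz (u : {ptws option 'I_d -> R}) : sheet M I u -> exists o, u o != 0 by case.
case=> zS; have [[T TS cT] [T' T'S cT']] := back _ zS; have [q zq] := nz _ zS; split.
- by exists q.
- by apply/boundaryP; split; [exists T|exists T'] => //; apply/compatible_sign_face.
- by exists q; move: zq; rewrite /opp oppr_eq0.
- have cz (V : {set option 'I_d}) : compat V (opp z) -> compat (~: V) z by move=> /oppS; rewrite oppK.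
  by apply/boundaryP; split; [exists (~: T)|exists (~: T')]; rewrite ?suspensionC//;
    apply/compatible_sign_face; exact: cz.
Qed.

End Double.

(** * Spectrum of the path *)

Section Spectrum.
Variables (R : realType) (d : nat).
Let ang : R := pi / d.+1%:R.

(* The eigenvectors of the path on 1, ..., d with Dirichlet conditions at 0 and
   d + 1; lam k is the eigenvalue of mode k. *)
Definition mode (k n : nat) : R := sin ((k.+1 * n)%:R * ang).
Definition lam (k : nat) : R := 2 * cos (k.+1%:R * ang).

Let ang_gt0 : 0 < ang. Proof. by rewrite divr_gt0// pi_gt0. Qed.
Let angE : d.+1%:R * ang = pi. Proof. by rewrite /ang mulrCA divff ?mulr1// pnatr_eq0. Qed.

Let ang_lt n : (n < d.+1)%N -> n%:R * ang < pi.
Proof. by move=> h; rewrite -angE ltr_pM2r// ltr_nat. Qed.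

Lemma mode_rec k n : mode k n + mode k n.+2 = lam k * mode k n.+1.
Proof.
rewrite /mode /lam; set b := k.+1%:R * ang; set a := (k.+1 * n.+1)%:R * ang.
have -> : (k.+1 * n)%:R * ang = a - b by rewrite /a /b mulnS natrD; ring.
have -> : (k.+1 * n.+2)%:R * ang = a + b by rewrite /a /b !mulnS !natrD; ring.
by rewrite sinB sinD; ring.
Qed.

Lemma mode_left k : mode k 0 = 0.
Proof. by rewrite /mode muln0 mul0r sin0. Qed.

Lemma mode_right k : mode k d.+1 = 0.
Proof.
rewrite /mode natrM -mulrA angE; elim: k => [|k IH]; first by rewrite mul1r sinpi.
by rewrite -natr1 mulrDl mul1r sinDpi IH oppr0.
Qed.

Lemma mode0_gt0 n : (0 < n < d.+1)%N -> 0 < mode 0 n.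
Proof.
by move=> /andP[n0 nd]; rewrite /mode mul1n sin_gt0_pi// mulr_gt0 ?ltr0n//= ang_lt.
Qed.

Lemma mode_first k : (k < d)%N -> 0 < mode k 1.
Proof. by move=> kd; rewrite /mode muln1 sin_gt0_pi// mulr_gt0 ?ltr0n//= ang_lt. Qed.

Lemma cos_decr a b : (a < b < d.+2)%N -> cos (b%:R * ang) < cos (a%:R * ang).
Proof.
move=> /andP[ab bd]; have le n : (n <= d.+1)%N -> n%:R * ang \in `[0, pi].
  by move=> nd; rewrite in_itv /= mulr_ge0 ?ler0n ?(ltW ang_gt0)//= -angE ler_pM2r// ler_nat.
by rewrite ltr_cos ?le// ?ltr_pM2r ?ltr_nat//; lia.
Qed.

Lemma lam_decr k l : (k < l < d.+1)%N -> lam l < lam k.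
Proof. by move=> kl; rewrite ltr_pM2l// cos_decr//. Qed.

Lemma mode1E n : mode 1 n = 2 * cos (n%:R * ang) * mode 0 n.
Proof.
rewrite /mode mul1n natrM -mulrA mulr_natl sin_mulr2n.
by ring.
Qed.

Lemma mode_orthogonal k l : (k < d)%N -> (l < d)%N -> k != l ->
  \sum_(n < d) mode k n.+1 * mode l n.+1 = 0.
Proof.
move=> kd ld kl; have ne : lam k != lam l.
  have [h|h|e] := ltngtP k l; last by rewrite e eqxx in kl.
  - by rewrite gt_eqF// lam_decr// h ltnW.
  - by rewrite lt_eqF// lam_decr// h ltnW.
(* The discrete Wronskian: the recurrence makes its differences proportional to the summand, and it
   vanishes at both ends. *)
pose W n := mode k n * mode l n.+1 - mode k n.+1 * mode l n.
have : (lam k - lam l) * \sum_(n < d) mode k n.+1 * mode l n.+1 = 0.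
  rewrite mulr_sumr (eq_bigr (fun n : 'I_d => W n - W n.+1)); last first.
    move=> n _; transitivity (lam k * mode k n.+1 * mode l n.+1 - mode k n.+1 * (lam l * mode l n.+1)).
      by ring.
    by rewrite -!mode_rec /W; ring.
  rewrite -(big_mkord predT (fun n => W n - W n.+1)).
  under eq_bigr do rewrite -opprB.
  rewrite sumrN telescope_sumr// /W !mode_left !mode_right; ring.
by move/eqP; rewrite mulf_eq0 subr_eq0 (negbTE ne) => /eqP.
Qed.

Definition norm2 (k : 'I_d) : R := \sum_(n < d) mode k n.+1 ^+ 2.

Lemma norm2_gt0 k : 0 < norm2 k.
Proof.
have d0 : (0 < d)%N by exact: leq_ltn_trans (ltn_ord k).
rewrite /norm2 (bigD1 (Ordinal d0))//= ltr_pwDl//; first by rewrite exprn_gt0// mode_first.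
by apply: sumr_ge0 => i _; exact: sqr_ge0.
Qed.

(** [synth] and [coef] are the discrete sine transform and its inverse. *)
Definition synth (c : 'I_d -> R) (n : nat) : R := \sum_(k < d) c k * mode k n.
Definition coef (y : 'I_d -> R) (k : 'I_d) : R := (\sum_(n < d) y n * mode k n.+1) / norm2 k.

Lemma synthK c k : coef (fun n : 'I_d => synth c n.+1) k = c k.
Proof.
rewrite /coef /synth; under eq_bigr do rewrite mulr_suml.
rewrite exchange_big /= (bigD1 k)//= [X in _ + X]big1 ?addr0; last first.
  move=> l lk; under eq_bigr do rewrite -mulrA.
  by rewrite -mulr_sumr mode_orthogonal ?mulr0.
under eq_bigr do rewrite -mulrA -expr2.
by rewrite -mulr_sumr mulfK// gt_eqF// norm2_gt0.
Qed.

(** Orthogonality provides a one-sided inverse of a square matrix, which is then two-sided. *)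
Lemma coefK y (n : 'I_d) : synth (coef y) n.+1 = y n.
Proof.
pose U : 'M[R]_d := \matrix_(k, n) mode k n.+1.
pose V : 'M[R]_d := \matrix_(n, k) (mode k n.+1 / norm2 k).
have UV : U *m V = 1%:M.
  apply/matrixP => k l; rewrite !mxE.
  under eq_bigr do rewrite !mxE mulrA.
  rewrite -mulr_suml; have [->|kl] := eqVneq k l.
    by under eq_bigr do rewrite -expr2; rewrite divff// gt_eqF// norm2_gt0.
  by rewrite mode_orthogonal ?mul0r.
have VU m : (V *m U) m n = (1%:M : 'M[R]_d) m n by rewrite (mulmx1C UV).
rewrite /synth /coef; under eq_bigr do rewrite !mulr_suml.
rewrite exchange_big /=.
transitivity (\sum_m y m * (V *m U) m n).
  apply: eq_bigr => m _; rewrite mxE mulr_sumr; apply: eq_bigr => k _; rewrite !mxE; ring.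
under eq_bigr do rewrite VU mxE mulr_natr mulrb.
by rewrite -big_mkcond big_pred1_eq.
Qed.

Lemma synth_rec c n : synth c n + synth c n.+2 = synth (fun k => lam k * c k) n.+1.
Proof.
by rewrite /synth -big_split; apply: eq_bigr => k _ /=; rewrite -mulrDr mode_rec; ring.
Qed.

Lemma synth_left c : synth c 0 = 0.
Proof. by apply: big1 => k _; rewrite mode_left mulr0. Qed.

Lemma synth_right c : synth c d.+1 = 0.
Proof. by apply: big1 => k _; rewrite mode_right mulr0. Qed.

End Spectrum.

(** * Sign changes under smoothing *)

Section Signs.
Variables (R : realType) (d : nat).
Implicit Types (y : nat -> R).

(** A zero may count with either sign. In the notation of variation diminishing theory this is S^-
    <= 1, while [alternates] is S^+ >= 2; both can hold, and do so on the frontier. *)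
Definition monotone_signs y : Prop := exists (s : bool) t, (t <= d)%N /\
  forall n, (0 < n <= d)%N -> if (n <= t)%N then 0 <= (-1) ^+ s * y n else (-1) ^+ s * y n <= 0.

Definition alternates y : Prop := exists (s : bool) i j k, [/\ (0 < i < j)%N, (j < k <= d)%N,
  0 <= (-1) ^+ s * y i, (-1) ^+ s * y j <= 0 & 0 <= (-1) ^+ s * y k].

(** Away from the change at t all terms of the sum have one sign. In doubt are only the entries at t
    and t + 1, and these cannot both come out wrong, because the minor 1 - e^2 of the tridiagonal
    matrix is nonnegative. *)
Lemma smooth_signs y e : 0 <= e <= 1 -> y 0%N = 0 -> y d.+1 = 0 -> monotone_signs y ->
  monotone_signs (fun n => y n + e * (y n.-1 + y n.+1)).
Proof.
move=> /andP[e0 e1] yl yr [s [t [td h]]]; pose x n := (-1) ^+ s * y n.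
have xl : x 0%N = 0 by rewrite /x yl mulr0.
have xr : x d.+1 = 0 by rewrite /x yr mulr0.
have pos n : (n <= t)%N -> 0 <= x n.
  case: n => [_|n nt]; first by rewrite xl.
  by have := h n.+1; rewrite nt; apply; rewrite /= (leq_trans nt).
have neg n : (t < n <= d.+1)%N -> x n <= 0.
  move=> /andP[tn]; rewrite leq_eqVlt => /orP[/eqP->|nd]; first by rewrite xr.
  by have := h n; rewrite (ltn_geF tn); apply; lia.
pose z n := x n + e * (x n.-1 + x n.+1).
suff [t' [t'd h']] : exists t', (t' <= d)%N /\
    forall n, (0 < n <= d)%N -> if (n <= t')%N then 0 <= z n else z n <= 0.
  exists s, t'; split=> // n nd; have := h' n nd.
  by have -> : z n = (-1) ^+ s * (y n + e * (y n.-1 + y n.+1)) by rewrite /z /x; ring.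
have zpos n : (n < t)%N -> 0 <= z n.
  move=> nt; apply: addr_ge0; first by apply: pos; lia.
  by apply: mulr_ge0 => //; apply: addr_ge0; apply: pos; lia.
have zneg n : (t.+1 < n <= d)%N -> z n <= 0.
  move=> nd; have h1 : x n <= 0 by apply: neg; lia.
  have h2 : x n.-1 <= 0 by apply: neg; lia.
  have h3 : x n.+1 <= 0 by apply: neg; lia.
  have h4 : e * (x n.-1 + x n.+1) <= 0 by apply: mulr_ge0_le0 => //; lra.
  by rewrite /z; lra.
have zz : (0 < t)%N -> 0 <= z t \/ z t.+1 <= 0.
  move=> t0; have h1 : 0 <= x t.-1 by apply: pos; lia.
  have h2 := pos _ (leqnn t); have h3 : x t.+1 <= 0 by apply: neg; lia.
  have h4 : (t.+1 <= d)%N -> x t.+2 <= 0 by move=> ?; apply: neg; lia.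
  have [zt|zt] := leP 0 (z t); [by left|right].
  have tld : (t.+1 <= d)%N.
    rewrite ltn_neqAle td andbT; apply/eqP => e'; move: zt; rewrite /z e' xr addr0 ltNge => /negP; apply.
    by apply: addr_ge0; [rewrite -e'|apply: mulr_ge0; rewrite // -e'].
  have {}h4 := h4 tld; move: zt; rewrite /z /= => zt.
  clear -e0 e1 h1 h2 h3 h4 zt.
  have k1 : 0 <= e * x t.-1 by exact: mulr_ge0.
  have k2 : e * x t.+2 <= 0 by exact: mulr_ge0_le0.
  have k3 : e * x t <= x t by rewrite ler_piMl.
  have k4 : x t.+1 <= e * x t.+1 by rewrite -subr_ge0 -{2}[x _]mul1r -mulrBl mulr_le0//; lra.
  by lra.
(* The change moves by at most one place, so only the entries at t and t + 1 remain to be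
   examined. *)
have fin t' : (t' <= d)%N -> (forall n, (0 < n <= d)%N -> (n <= t')%N -> (t <= n)%N -> 0 <= z n) ->
    (forall n, (0 < n <= d)%N -> (t' < n)%N -> (n <= t.+1)%N -> z n <= 0) -> (t <= t'.+1 <= t.+2)%N ->
    exists t', (t' <= d)%N /\ forall n, (0 < n <= d)%N -> if (n <= t')%N then 0 <= z n else z n <= 0.
  move=> t'd h1 h2 h3; exists t'; split=> // n nd; case: leqP => c.
    by case: (ltnP n t) => c'; [exact: zpos|exact: h1].
  by case: (leqP n t.+1) => c'; [exact: h2|apply: zneg; lia].
have [t0|t0] := posnP t.
  apply: (fin 0%N) => //; first by move=> n; lia.
  - move=> n nd _ nt; have -> : n = 1%N by lia.
    have h1 : x 1%N <= 0 by apply: neg; lia.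
    have h2 : x 2%N <= 0 by apply: neg; lia.
    have h3 : e * x 2%N <= 0 by exact: mulr_ge0_le0.
    by rewrite /z /= xl add0r; lra.
  - by lia.
have [zt|zt] := leP 0 (z t); last first.
  have zt1 : z t.+1 <= 0 by case: (zz t0) => // /(lt_le_trans zt); rewrite ltxx.
  apply: (fin t.-1); [lia|by move=> n; lia| |lia].
  move=> n nd c1 c2; have [->|->] : n = t \/ n = t.+1 by lia.
    exact: ltW.
  by [].
have [zt1|zt1] := leP (z t.+1) 0.
  apply: (fin t); [by []| | |lia].
    by move=> n nd c1 c2; have -> : n = t by lia.
  by move=> n nd c1 c2; have -> : n = t.+1 by lia.
have [tld|] := ltnP t d; last first.
  move=> dt; apply: (fin t); [by []| | |lia].
    by move=> n nd c1 c2; have -> : n = t by lia.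
  by move=> n nd c1 c2; lia.
apply: (fin t.+1); [by []| | |lia]; last by move=> n nd c1 c2; lia.
move=> n nd c1 c2; have [->|->] : n = t \/ n = t.+1 by lia.
  by [].
exact: ltW.
Qed.

(** Inside a block of one sign the neighbours of a zero sum to zero, so both vanish, and two
    consecutive zeros spread to the whole sequence. Zeros thus occur only next to the change and
    cannot simulate a second one. *)
Lemma strict_signs y : y 0%N = 0 -> y d.+1 = 0 ->
  (forall n, (0 < n <= d)%N -> y n = 0 -> y n.-1 + y n.+1 = 0) ->
  (exists2 n, (0 < n <= d)%N & y n != 0) -> monotone_signs y -> ~ alternates y.
Proof.
move=> yl yr hz [n0 n0d yn0] [s [t [td h]]] [s' [i [j [k [ij jk]]]]].
pose x n := (-1) ^+ s * y n.
have s0 (b : bool) : (-1) ^+ b != 0 :> R by rewrite signr_eq0.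
have x0 n : (x n == 0) = (y n == 0) by rewrite /x mulf_eq0 (negbTE (s0 s)).
have xl : x 0%N = 0 by rewrite /x yl mulr0.
have xr : x d.+1 = 0 by rewrite /x yr mulr0.
have pos n : (n <= t)%N -> 0 <= x n.
  case: n => [_|n nt]; first by rewrite xl.
  by have := h n.+1; rewrite nt; apply; rewrite /= (leq_trans nt).
have neg n : (t < n <= d.+1)%N -> x n <= 0.
  move=> /andP[tn]; rewrite leq_eqVlt => /orP[/eqP->|nd]; first by rewrite xr.
  by have := h n; rewrite (ltn_geF tn); apply; lia.
have hx n : (0 < n <= d)%N -> x n = 0 -> x n.-1 + x n.+1 = 0.
  by move=> nd /eqP; rewrite x0 => /eqP /(hz _ nd); rewrite /x -mulrDr => ->; rewrite mulr0.
have consec m : (m <= d)%N -> x m = 0 -> x m.+1 = 0 -> False.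
  move=> md xm xm1; have up r : (m + r <= d)%N -> x (m + r)%N = 0 /\ x (m + r).+1 = 0.
    elim: r => [|r IH] rd; first by rewrite addn0.
    have [|e1 e2] := IH; first by lia.
    rewrite addnS; split=> //; have := hx (m + r).+1; rewrite /= e1 add0r; apply=> //; lia.
  have down r : (r <= m)%N -> x (m - r)%N = 0 /\ x (m - r).+1 = 0.
    elim: r => [|r IH] rm; first by rewrite subn0.
    have [|e1 e2] := IH; first by lia.
    have eq : (m - r.+1).+1 = (m - r)%N by lia.
    rewrite eq; split=> //; have := hx (m - r)%N; rewrite e2 addr0.
    have -> : (m - r).-1 = (m - r.+1)%N by lia.
    by apply => //; lia.
  move: yn0; rewrite -x0; case: (leqP m n0) => c.
    by have [|] := up (n0 - m)%N; rewrite subnKC//; [lia|move=> ->; rewrite eqxx].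
  have [|] := down (m - n0)%N; first by lia.
  by rewrite subKn ?(ltnW c)// => ->; rewrite eqxx.
have both n : (0 < n <= d)%N -> x n = 0 ->
    ((n < t)%N || (t.+1 < n)%N) -> False.
  move=> nd xn /orP c; have e := hx _ nd xn; have xn1 : x n.+1 = 0.
    case: c => c.
      have a1 := pos n.-1 (leq_trans (leq_pred n) (ltnW c)); have a2 := pos n.+1 c; lra.
    have a1 : x n.-1 <= 0 by apply: neg; lia.
    have a2 : x n.+1 <= 0 by apply: neg; lia.
    lra.
  by apply: (consec n) => //; case/andP: nd.
have [e|ne] := eqVneq s s'; rewrite -?e.
  rewrite -/(x i) -/(x j) -/(x k) => xi xj xk.
  have xj0 : (j <= t)%N -> x j = 0 by move=> jt; have := pos _ jt; lra.
  have xk0 : (t < k)%N -> x k = 0.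
    by move=> kt; have kn : x k <= 0 by [apply: neg; lia]; lra.
  have [kt|tk] := leqP k t; first by apply: (both j); [lia|apply: xj0; lia|lia].
  have [k1|k1] := ltnP t.+1 k; first by apply: (both k); [lia|exact: xk0|lia].
  have [jt|jt] := ltnP j t; first by apply: (both j); [lia|apply: xj0; lia|lia].
  have ejt : j = t by lia.
  have ekt : k = t.+1 by lia.
  apply: (consec t) => //; first by rewrite -{1}ejt; apply: xj0; lia.
  by rewrite -ekt; apply: xk0; lia.
have es : (-1) ^+ s' = - (-1) ^+ s :> R by move: ne; case: (s); case: (s') => //= _; rewrite ?expr1 ?expr0 ?opprK.
rewrite es !mulNr -/(x i) -/(x j) -/(x k) => xi xj xk.
have xi0 : (i <= t)%N -> x i = 0 by move=> it; have := pos _ it; lra.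
have xj0 : (t < j)%N -> x j = 0.
  by move=> jt; have jn : x j <= 0 by [apply: neg; lia]; lra.
have [ti|it] := ltnP t i; first by apply: (both j); [lia|apply: xj0; lia|lia].
have [it'|it'] := ltnP i t; first by apply: (both i); [lia|exact: xi0|lia].
have [jt|jt] := ltnP t.+1 j; first by apply: (both j); [lia|apply: xj0; lia|lia].
have eit : i = t by lia.
have ejt : j = t.+1 by lia.
apply: (consec t) => //; first by rewrite -{1}eit; apply: xi0; lia.
by rewrite -ejt; apply: xj0; lia.
Qed.

(** After division by the positive mode 0 there remains a + 2b cos, which is strictly monotone along
    the path, or a nonzero constant when b = 0. *)
Lemma low_modes_signs y a b : (a != 0) || (b != 0) ->
  (forall n, (0 < n <= d)%N -> y n = a * mode R d 0 n + b * mode R d 1 n) -> ~ alternates y.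
Proof.
move=> ab ey [s [i [j [k [ij jk xi xj xk]]]]].
pose g n := (-1) ^+ s * (a + b * 2 * cos (n%:R * (pi / d.+1%:R))).
have yg n : (0 < n <= d)%N -> (-1) ^+ s * y n = g n * mode R d 0 n.
  by move=> nd; rewrite ey// mode1E /g; ring.
have m0 n : (0 < n <= d)%N -> 0 < mode R d 0 n by move=> nd; apply: mode0_gt0; lia.
have ie : (0 < i <= d)%N by lia.
have je : (0 < j <= d)%N by lia.
have ke : (0 < k <= d)%N by lia.
move: xi xj xk; rewrite !yg// (pmulr_lge0 _ (m0 _ ie)) (pmulr_lle0 _ (m0 _ je)) (pmulr_lge0 _ (m0 _ ke)).
have cij := @cos_decr R d i j; have cjk := @cos_decr R d j k.
have {}cij : cos (j%:R * (pi / d.+1%:R)) < cos (i%:R * (pi / d.+1%:R)) :> R by apply: cij; lia.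
have {}cjk : cos (k%:R * (pi / d.+1%:R)) < cos (j%:R * (pi / d.+1%:R)) :> R by apply: cjk; lia.
rewrite /g; set ci := cos (i%:R * _) in cij *; set cj := cos (j%:R * _) in cij cjk *; set ck := cos (k%:R * _) in cjk *.
pose A := (-1) ^+ s * a; pose B := (-1) ^+ s * b.
have eg c : (-1) ^+ s * (a + b * 2 * c) = A + 2 * (B * c) by rewrite /A /B; ring.
rewrite !eg => h1 h2 h3.
have AB : (A != 0) || (B != 0) by rewrite !mulf_eq0 !signr_eq0.
clear -AB h1 h2 h3 cij cjk; clearbody A B ci cj ck.
have [B0|B0|B0] := ltgtP 0 B.
- have : B * ck < B * cj by rewrite ltr_pM2l.
  by move=> ?; lra.
- have : B * ci < B * cj by rewrite ltr_nM2l.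
  by move=> ?; lra.
- rewrite -B0 eqxx orbF in AB; move: h1 h2; rewrite -B0 !mul0r mulr0 addr0 => h1 h2.
  by case/eqP: AB; lra.
Qed.

(** The combination [q] of the two modes is chosen to change sign exactly between t and t + 1, as
    [y] does. The products then all have one sign, and their sum vanishes by orthogonality. *)
Lemma monotone_low_modes y : (0 < d)%N -> monotone_signs y -> (exists2 n, (0 < n <= d)%N & y n != 0) ->
  \sum_(n < d) y n.+1 * mode R d 0 n.+1 = 0 -> \sum_(n < d) y n.+1 * mode R d 1 n.+1 = 0 -> False.
Proof.
move=> d0 [s [t [td h]]] [n0 n0d yn0] e0 e1.
pose c n : R := cos (n%:R * (pi / d.+1%:R)).
pose g := c t + c t.+1.
pose q n := mode R d 1 n - g * mode R d 0 n.
have qE n : q n = (2 * c n - g) * mode R d 0 n by rewrite /q mode1E /c; ring.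
have le a b : (a <= b < d.+2)%N -> c b <= c a.
  move=> /andP[]; rewrite leq_eqVlt => /orP[/eqP->//|ab] bd.
  by apply: ltW; apply: cos_decr; rewrite ab.
have gt : c t.+1 < c t by apply: cos_decr; lia.
have qs n : (0 < n <= d)%N -> if (n <= t)%N then 0 < q n else q n < 0.
  move=> nd; have m0 : 0 < mode R d 0 n by apply: mode0_gt0; lia.
  rewrite qE; case: leqP => nt.
    have cn : c t <= c n by apply: le; lia.
    by rewrite pmulr_lgt0// /g; lra.
  have cn : c n <= c t.+1 by apply: le; lia.
  by rewrite pmulr_llt0// /g; lra.
pose x n := (-1) ^+ s * y n.
have xq n : (0 < n <= d)%N -> 0 <= x n * q n.
  move=> nd; have := qs n nd; have := h n nd; case: ifP => _ h1 h2.
    by rewrite mulr_ge0// ltW.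
  by rewrite mulr_le0// ltW.
have : \sum_(n < d) x n.+1 * q n.+1 = 0.
  transitivity ((-1) ^+ s * (\sum_(n < d) y n.+1 * mode R d 1 n.+1 - g * \sum_(n < d) y n.+1 * mode R d 0 n.+1)).
    by rewrite mulr_sumr -sumrB mulr_sumr; apply: eq_bigr => n _; rewrite /x /q; ring.
  by rewrite e0 e1 mulr0 subrr mulr0.
move/eqP; rewrite psumr_eq0 => [/allP hq|n _]; last by apply: xq; rewrite /= ltn_ord.
have n1 : (n0.-1 < d)%N by lia.
have := hq (Ordinal n1) (mem_index_enum _); rewrite /= prednK; last by case/andP: n0d.
rewrite !mulf_eq0 signr_eq0 (negbTE yn0) /= => /eqP qn.
by have := qs n0 n0d; rewrite qn ltxx if_same.
Qed.

End Signs.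

Lemma sign_pattern (b : nat -> bool) d :
  (exists s t, (t <= d)%N /\ forall m, (m < d)%N -> b m = s (+) (m < t)%N) \/
  (exists i j k, [/\ (i < j)%N, (j < k < d)%N, b k = b i & b j = ~~ b i]).
Proof.
have [hb|] := boolP [forall m : 'I_d, b m == b 0%N].
  left; exists (~~ b 0%N), d; split=> // m md; rewrite md addbT negbK.
  by have /forallP/(_ (Ordinal md))/eqP := hb.
move=> /forallPn[m0 bm0].
have ex : exists m, b m != b 0%N by exists m0.
pose t := ex_minn ex.
have [bt mint] : b t != b 0%N /\ forall m, b m != b 0%N -> (t <= m)%N by rewrite /t; case: ex_minnP.
have td : (t <= d)%N by rewrite (leq_trans (mint _ bm0))// ltnW.
have [/forallP hk|] := boolP [forall k : 'I_d, (t < k)%N ==> (b k != b 0%N)].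
  left; exists (~~ b 0%N), t; split=> // m md; case: ltnP => mt.
    rewrite addbT negbK; apply/eqP/negPn/negP => /mint; lia.
  have : b m != b 0%N.
    move: mt; rewrite leq_eqVlt => /orP[/eqP<-//|mt].
    by have := hk (Ordinal md); rewrite /= mt.
  by rewrite addbF; case: (b m); case: (b 0%N).
move=> /forallPn[k]; rewrite negb_imply negbK => /andP[tk /eqP bk].
right; exists 0%N, t, (val k); split=> //; last by move: bt; case: (b t); case: (b 0%N).
  by rewrite lt0n; apply: contraNneq bt => ->.
by rewrite tk ltn_ord.
Qed.

(** * Crossing times of a diagonal flow *)

Section Flow.
Variables (R : realType) (J : finType).
Local Notation rf := {ptws J -> R}.
Implicit Types (c : rf) (t r : R) (H M : set rf).

Definition flow (mu : J -> R) t c : rf := fun k => expR (t * mu k) * c k.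

Lemma flowD mu t r c : flow mu t (flow mu r c) = flow mu (t + r) c.
Proof. by apply/funext => k; rewrite /flow mulrA -expRD mulrDl. Qed.

Lemma flow0 mu c : flow mu 0 c = c.
Proof. by apply/funext => k; rewrite /flow mul0r expR0 mul1r. Qed.

Lemma flowZ mu t k c : flow mu t (scale k c) = scale k (flow mu t c).
Proof. by apply/funext => i; rewrite /flow /scale mulrCA. Qed.

Lemma flow_opp mu t c : flow mu t (opp c) = opp (flow mu t c).
Proof. by apply/funext => i; rewrite /flow /opp mulrN. Qed.

Lemma flowN mu t c : flow mu (- t) c = flow (fun k => - mu k) t c.
Proof. by apply/funext => i; rewrite /flow mulNr mulrN. Qed.

Lemma flow_neq0 mu t c k : (flow mu t c k != 0) = (c k != 0).
Proof. by rewrite /flow mulf_eq0 expR_eq0. Qed.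

Lemma cont_on_flow (X : topologicalType) (A : set X) mu (f : X -> R) (g : X -> rf) :
  cont_on A f -> cont_on A g -> cont_on A (fun x => flow mu (f x) (g x)).
Proof.
move=> cf cg; apply: cont_on_ptws => k; apply: cont_onM.
  by apply: (cont_on_comp_real (@continuous_expR R)); apply: cont_onM => //; exact: cont_on_cst.
by apply: (@cont_on_comp _ _ _ _ setT g (fun p : rf => p k)) => //; exact: cont_on_proj.
Qed.

Lemma closed_ptws_cvg (T : Type) (F : set_system T) (PF : ProperFilter F) (S : set rf)
    (f : T -> rf) c : closed S -> (\forall x \near F, S (f x)) ->
  (forall k, f x k @[x --> F] --> c k) -> S c.
Proof.
move=> cS hS hc; apply: (@closed_cvg T rf F PF f S cS) => //.
apply/cvg_sup => j; apply/cvg_image; first by rewrite eqEsubset; split=> // y _; exists (fun=> y).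
move=> P HP; exists ((fun f : rf => f j) @^-1` P); first exact: hc HP.
by rewrite eqEsubset; split=> [y [g Pg <-]//|y Py]; exists (fun=> y).
Qed.

(** Rescaled by the growth of coordinate [j], the flow converges to that coordinate alone, and a
    closed cone contains the limit. *)
Lemma dominant_mode (S : set rf) mu c j : closed S -> conic S ->
  (forall k, c k != 0 -> k != j -> mu k < mu j) -> (forall t, S (flow mu t c)) ->
  S (fun k => if k == j then c j else 0).
Proof.
move=> cS coS hj hS.
apply: (@closed_ptws_cvg R (pinfty_nbhs R) _ S (fun t => scale (expR (- (t * mu j))) (flow mu t c))) => //.
  by near=> t; apply: coS => //; exact: expR_gt0.
move=> k; have e t : scale (expR (- (t * mu j))) (flow mu t c) k = expR (- (t * (mu j - mu k))) * c k.
  by rewrite /scale /flow mulrA -expRD; congr (expR _ * _); ring.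
case: (eqVneq k j) e => [->|kj] e.
  have -> : (fun t => scale (expR (- (t * mu j))) (flow mu t c) j) = fun=> c j.
    by apply/funext => t; rewrite e subrr mulr0 oppr0 expR0 mul1r.
  exact: cvg_cst.
have [ck|ck] := eqVneq (c k) 0.
  have -> : (fun t => scale (expR (- (t * mu j))) (flow mu t c) k) = fun=> 0.
    by apply/funext => t; rewrite e ck mulr0.
  exact: cvg_cst.
have -> : (fun t => scale (expR (- (t * mu j))) (flow mu t c) k) =
    fun t => expR (- (t * (mu j - mu k))) * c k by apply/funext => t; rewrite e.
rewrite -[X in _ --> X](mul0r (c k)); apply: cvgMl.
have h : (t * (mu j - mu k))%R @[t --> +oo] --> +oo.
  by apply: gt0_cvgMly; [rewrite subr_gt0 hj|exact: cvg_id].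
exact: (cvg_comp _ _ h (@cvgr_expR R)).
Unshelve. all: by end_near. Qed.

Variables (mu : J -> R) (low : pred J).
Hypotheses (mu_inj : injective mu) (low_mu : forall j k, low j -> ~~ low k -> mu k < mu j).

(* H is left and M is entered, once and for all, along the flow. *)
Record barrier H M : Prop := Barrier {
  barrier_closedH : closed H;
  barrier_closedM : closed M;
  barrier_cover : forall c, H c \/ M c;
  barrier_conicH : conic H;
  barrier_conicM : conic M;
  barrier_opp : forall c, H c -> H (opp c);
  barrier_strict : forall c t, 0 < t -> M c -> (exists k, c k != 0) -> ~ H (flow mu t c);
  barrier_low : forall c, (exists k, c k != 0) -> (forall k, ~~ low k -> c k = 0) -> ~ H c;
  barrier_high : forall c, (exists k, c k != 0) -> (forall k, low k -> c k = 0) -> ~ M c }.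

(** A nonzero vector with low coordinates only stays out of [H] for all times, one with high
    coordinates only stays out of [M]; the mixed ones are those that cross. *)
Definition mixed c := (exists2 k, low k & c k != 0) /\ (exists2 k, ~~ low k & c k != 0).

Definition is_exit_time H M c t : Prop :=
  forall s, (H (flow mu s c) <-> s <= t) /\ (M (flow mu s c) <-> t <= s).

Lemma exit_time_uniq H M c t r : is_exit_time H M c t -> is_exit_time H M c r -> t = r.
Proof.
move=> h1 h2; apply/eqP; rewrite eq_le.
have := (h1 t).1; have := (h2 t).1; have := (h1 r).1; have := (h2 r).1.
rewrite !lexx => -[_ a] [b _] [a' _] [_ b'].
by rewrite (b (a isT)) (a' (b' isT)).
Qed.

Lemma cont_flow_time c : cont_on setT (fun t : R => flow mu t c).
Proof. by apply: cont_on_flow; [exact: cont_on_id|exact: cont_on_cst]. Qed.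

Lemma cont_flow t : cont_on setT (flow mu t).
Proof. by apply: (@cont_on_flow _ _ mu (fun=> t) id); [exact: cont_on_cst|exact: cont_on_id]. Qed.

Lemma closed_flow_time S c : closed S -> closed [set t | S (flow mu t c)].
Proof.
move=> cS; apply: (@preimage_closed _ _ (fun t => flow mu t c) S) => // t _.
have h := cont_on_continuous (@cont_flow_time c); exact: h.
Qed.

Lemma closed_flow S t : closed S -> closed [set c | S (flow mu t c)].
Proof.
move=> cS; apply: (@preimage_closed _ _ (flow mu t) S) => // c _.
exact: cont_on_continuous (@cont_flow t) c.
Qed.

(** For large positive times the dominant mode is low, which excludes [H]; for large negative times
    it is high, which excludes [M]. The supremum of the times spent in [H] is then the time of
    crossing. *)
Lemma exists_exit_time H M c : barrier H M -> mixed c -> exists t, is_exit_time H M c t.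
Proof.
move=> b [[kl lkl ckl] [kh lkh ckh]].
have c0 t : exists k, flow mu t c k != 0 by exists kl; rewrite flow_neq0.
have extreme (nu : J -> R) S : injective nu -> closed S -> conic S ->
    (forall j, c j != 0 -> (forall k, c k != 0 -> nu k <= nu j) ->
       ~ S (fun k => if k == j then c j else 0)) -> exists t, ~ S (flow nu t c).
  move=> nu_inj cS coS hS; apply: contrapT => all.
  have {}all t : S (flow nu t c) by apply: contrapT => h; apply: all; exists t.
  have [j cj maxj] := @arg_maxP _ _ J kl (fun k => c k != 0) nu ckl.
  have {}maxj k : c k != 0 -> nu k <= nu j by exact: maxj.
  apply: (hS j cj maxj); apply: dominant_mode all => // k ck kj.
  by rewrite lt_neqAle (inj_eq nu_inj) kj maxj.
have single j : c j != 0 -> exists k, (fun k => if k == j then c j else 0) k != 0.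
  by move=> cj; exists j; rewrite eqxx.
have [t1 Ht1] : exists t, ~ H (flow mu t c).
  apply: extreme => //; [exact: barrier_closedH b|exact: barrier_conicH b|].
  move=> j cj maxj; apply: (barrier_low b); first exact: single.
  move=> k lk; case: eqP => // kj; have := maxj _ ckl; rewrite leNgt low_mu// -kj//.
have [t0 Mt0] : exists t, ~ M (flow mu t c).
  have [||||t ht] := @extreme (fun k => - mu k) M.
  - by move=> j k /oppr_inj/mu_inj.
  - exact: barrier_closedM b.
  - exact: barrier_conicM b.
  - move=> j cj maxj; apply: (barrier_high b); first exact: single.
    move=> k lk; case: eqP => // kj; have := maxj _ ckh; rewrite lerN2 leNgt low_mu// -kj//.
  by exists (- t); rewrite flowN.
have strict t r : t < r -> M (flow mu t c) -> ~ H (flow mu r c).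
  move=> tr Mt; rewrite -(subrK t r) -flowD; apply: (barrier_strict b) => //.
  by rewrite subr_gt0.
have Mt1 : M (flow mu t1 c) by case: (barrier_cover b (flow mu t1 c)).
have Ht0 : H (flow mu t0 c) by case: (barrier_cover b (flow mu t0 c)).
pose S := [set t | H (flow mu t c)].
have ubS : ubound S t1 by move=> t St; rewrite leNgt; apply/negP => /strict/(_ Mt1).
have supS : has_sup S by split; [exists t0|exists t1].
have cS : closed S by apply: closed_flow_time; exact: barrier_closedH b.
have cM : closed [set t | M (flow mu t c)] by apply: closed_flow_time; exact: barrier_closedM b.
have HS : H (flow mu (sup S) c).
  by apply: cS; apply: closure_sup; case: supS.
have MS : M (flow mu (sup S) c).
  apply: contrapT => nM.
  have /(_ (sup S) nM) := closed_openC cM; rewrite /interior /= => /nbhs_ballP[e /= e0 he].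
  have lt : sup S < sup S + e / 2 by rewrite ltrDl divr_gt0.
  have nMe : ~ M (flow mu (sup S + e / 2) c).
    by apply: he; rewrite /ball /= opprD addNKr normrN gtr0_norm ?divr_gt0// ltr_pdivrMr// ltr_pMr// ltr1n.
  case: (barrier_cover b (flow mu (sup S + e / 2) c)) => // He.
  have : sup S + e / 2 <= sup S by apply: sup_ubound => //; case: supS.
  by rewrite leNgt lt.
exists (sup S) => t; split; split.
- by move=> Ht; apply: sup_ubound => //; case: supS.
- rewrite le_eqVlt => /orP[/eqP->//|lt]; case: (barrier_cover b (flow mu t c)) => // Mt.
  by case: (strict _ _ lt Mt).
- by move=> Mt; rewrite leNgt; apply/negP => /strict/(_ Mt).
- rewrite le_eqVlt => /orP[/eqP<-//|lt]; case: (barrier_cover b (flow mu t c)) => // Ht.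
  have : t <= sup S by apply: sup_ubound => //; case: supS.
  by rewrite leNgt lt.
Qed.

Definition exit_time H M c : R := xget 0 [set t | is_exit_time H M c t].

Lemma exit_timeP H M c : barrier H M -> mixed c -> is_exit_time H M c (exit_time H M c).
Proof. by move=> b m; have := xgetPex 0 (exists_exit_time b m). Qed.

Lemma exit_time_eq H M c t : is_exit_time H M c t -> exit_time H M c = t.
Proof.
move=> h; apply: (exit_time_uniq _ h).
exact: (xgetPex 0 (ex_intro _ t h)).
Qed.

Lemma mixed_flow t c : mixed c -> mixed (flow mu t c).
Proof.
by move=> [[k lk ck] [l ll cl]]; split; [exists k|exists l]; rewrite ?flow_neq0.
Qed.

Lemma exit_time_flow H M t c : barrier H M -> mixed c ->
  exit_time H M (flow mu t c) = exit_time H M c - t.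
Proof.
move=> b m; apply: exit_time_eq => s; rewrite flowD.
have [h1 h2] := exit_timeP b m (s + t).
by split; [rewrite h1 -lerBrDr|rewrite h2 lerBlDr].
Qed.

Lemma mixedZ k c : 0 < k -> mixed c -> mixed (scale k c).
Proof.
move=> k0 [[i li ci] [j lj cj]].
by split; [exists i|exists j]; rewrite // mulf_neq0// gt_eqF.
Qed.

Lemma mixed_opp c : mixed (opp c) <-> mixed c.
Proof.
by split=> -[[i li ci] [j lj cj]]; split; [exists i|exists j|exists i|exists j];
  move: ci cj; rewrite /opp ?oppr_eq0.
Qed.

Lemma exit_timeZ H M k c : barrier H M -> 0 < k -> mixed c ->
  exit_time H M (scale k c) = exit_time H M c.
Proof.
move=> b k0 m; apply: exit_time_eq => s; have [<- <-] := exit_timeP b m s.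
have kV : 0 < k^-1 by rewrite invr_gt0.
rewrite flowZ; split; split=> h.
- by rewrite -(scaleV (flow mu s c) k0); exact: (barrier_conicH b).
- exact: (barrier_conicH b).
- by rewrite -(scaleV (flow mu s c) k0); exact: (barrier_conicM b).
- exact: (barrier_conicM b).
Qed.

Lemma exit_time_opp H M c : barrier H M -> mixed c -> exit_time H M (opp c) = exit_time H M c.
Proof.
move=> b m; have m' : mixed (opp c) by apply/mixed_opp.
have h1 := exit_timeP b m; have h2 := exit_timeP b m'.
have e s : s <= exit_time H M (opp c) <-> s <= exit_time H M c.
  rewrite -(h1 s).1 -(h2 s).1 flow_opp; split; last exact: (barrier_opp b).
  by move/(barrier_opp b); rewrite oppK.
apply/eqP; rewrite eq_le; apply/andP; split; [by apply/(e _).1|by apply/(e _).2].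
Qed.

Lemma open_mixed : open mixed.
Proof.
have cl (P : pred J) : closed [set c : rf | forall k, P k -> `|c k| <= 0].
  apply: (@closed_forall _ _ (fun k => [set c : rf | P k -> `|c k| <= 0])) => k.
  case: (P k).
    have -> : [set c : rf | true -> `|c k| <= 0] = [set c : rf | `|c k| <= 0].
      by apply/seteqP; split=> c h; [exact: h|move=> _].
    by apply: closed_le0; apply: cont_on_abs; exact: cont_on_proj.
  have -> : [set c : rf | false -> `|c k| <= 0] = setT by apply/seteqP; split=> c.
  exact: closedT.
have op (P : pred J) : open [set c : rf | exists2 k, P k & c k != 0].
  have -> : [set c : rf | exists2 k, P k & c k != 0] = ~` [set c : rf | forall k, P k -> `|c k| <= 0].
    apply/seteqP; split=> c.
      by move=> [k Pk ck] /(_ k Pk); rewrite normr_le0 (negbTE ck).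
    move=> h; apply: contrapT => h'; apply: h => k Pk.
    by rewrite normr_le0; apply/negPn/negP => ck; apply: h'; exists k.
  exact/closed_openC/cl.
exact: openI (op low) (op (fun k => ~~ low k)).
Qed.

(** Being outside [M] shortly before the exit time and outside [H] shortly after are open
    conditions, and they trap the exit times of nearby vectors. *)
Lemma cont_on_exit_time H M : barrier H M -> cont_on mixed (exit_time H M).
Proof.
move=> b x mx; apply/cvgrPdist_lt => e e0; rewrite /prop_near1 /nbhs/= /within /=.
have cx := exit_timeP b mx; set t := exit_time H M x in cx *.
have e2 : 0 < e / 2 by rewrite divr_gt0.
have h1 : nbhs x (~` [set c | M (flow mu (t - e / 2) c)]).
  apply: open_nbhs_nbhs; split; first by apply: closed_openC; apply: closed_flow; exact: barrier_closedM b.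
  by move=> /(cx _).2; rewrite leNgt ltrBlDr ltrDl e2.
have h2 : nbhs x (~` [set c | H (flow mu (t + e / 2) c)]).
  apply: open_nbhs_nbhs; split; first by apply: closed_openC; apply: closed_flow; exact: barrier_closedH b.
  by move=> /(cx _).1; rewrite leNgt ltrDl e2.
near=> y => my; have cy := exit_timeP b my; set s := exit_time H M y in cy *.
have y1 : (~` [set c | M (flow mu (t - e / 2) c)]) y by near: y.
have y2 : (~` [set c | H (flow mu (t + e / 2) c)]) y by near: y.
have l1 : t - e / 2 < s by rewrite ltNge; apply/negP => /(cy _).2.
have l2 : s < t + e / 2 by rewrite ltNge; apply/negP => /(cy _).1.
rewrite ltr_norml; move: l1 l2 e0; clear; lra.
Unshelve. all: by end_near. Qed.

Section TwoBarriers.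
Variables H1 M1 H2 M2 : set rf.
Hypotheses (b1 : barrier H1 M1) (b2 : barrier H2 M2).

Let a c := exit_time H1 M1 c.
Let b c := exit_time H2 M2 c.
(** Subtracting 1 keeps the intervals [m, a] and [m, b] nondegenerate. The vector [c] sits at time 0
    of its orbit, and the affine map of the first interval onto the second sends 0 to m (a - b) / (a
    - m). *)
Let m c := Num.min (a c) (b c) - 1.

(* On each orbit, the time before H1 is left is mapped piecewise linearly onto
   the time before H2 is left, fixing all times before m. *)
Definition shift_time c : R :=
  if `[< mixed c >] then Num.min (m c) 0 * (a c - b c) / (a c - m c) else 0.

Definition transfer c : rf := flow mu (shift_time c) c.

Let am c : 0 < a c - m c.
Proof. rewrite /m; have : Num.min (a c) (b c) <= a c by rewrite ge_min lexx.
by move=> ?; lra. Qed.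

Let bm c : 0 < b c - m c.
Proof. rewrite /m; have : Num.min (a c) (b c) <= b c by rewrite ge_min lexx orbT.
by move=> ?; lra. Qed.

Lemma shift_mixed c : mixed c -> shift_time c = Num.min (m c) 0 * (a c - b c) / (a c - m c).
Proof. by move=> mc; rewrite /shift_time; case: asboolP. Qed.

Lemma shift_nmixed c : ~ mixed c -> shift_time c = 0.
Proof. by move=> mc; rewrite /shift_time; case: asboolP. Qed.

Lemma shift_late c : (mixed c -> 0 <= m c) -> shift_time c = 0.
Proof.
move=> h; have [mc|/shift_nmixed//] := pselect (mixed c).
by rewrite shift_mixed// min_r ?mul0r//; exact: h.
Qed.

Lemma shift_le c : mixed c -> 0 <= a c -> shift_time c <= b c.
Proof.
move=> mc a0; rewrite shift_mixed//; have [m0|m0] := leP 0 (m c).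
  by rewrite !mul0r; have := bm c; lra.
rewrite ler_pdivrMr ?am//; have : 0 <= (b c - m c) * a c by rewrite mulr_ge0// ltW// bm.
by lra.
Qed.

Lemma shift_boundary c : mixed c -> a c = 0 -> shift_time c = b c.
Proof.
move=> mc a0; have m0 : m c < 0 by have := am c; rewrite a0; lra.
rewrite shift_mixed// a0 min_l ?(ltW m0)// !sub0r invrN !mulrN mulNr opprK.
by rewrite mulrAC divff ?mul1r// lt_eqF.
Qed.

Lemma nonmixed_H c : H1 c -> (exists k, c k != 0) -> ~ mixed c -> forall k, low k -> c k = 0.
Proof.
move=> Hc c0 nm k lk; apply/eqP/negPn/negP => ck; apply: nm; split; first by exists k.
apply: contrapT => h; apply: (barrier_low b1 c0 _ Hc) => l ll.
by apply/eqP/negPn/negP => cl; apply: h; exists l.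
Qed.

(** An unmixed vector of [H1] has high coordinates only. Near it both exit times exceed 1, hence [m]
    is nonnegative and nothing moves, which gives continuity where exit times do not exist. *)
Lemma nonmixed_shift c : H1 c -> (exists k, c k != 0) ->
  exists U, [/\ open U, mixed c \/ U c & forall x, U x -> ~ mixed c -> shift_time x = 0].
Proof.
move=> Hc c0; pose U := ~` [set x | M1 (flow mu 1 x)] `&` ~` [set x | M2 (flow mu 1 x)].
exists U; split.
- by apply: openI; apply: closed_openC; apply: closed_flow; [exact: barrier_closedM b1|exact: barrier_closedM b2].
- have [mc|nm] := pselect (mixed c); [by left|right].
  have low0 := nonmixed_H Hc c0 nm.
  have f0 : exists k, flow mu 1 c k != 0 by have [k ck] := c0; exists k; rewrite flow_neq0.
  have fl k : low k -> flow mu 1 c k = 0 by move=> /low0 ck; rewrite /flow ck mulr0.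
  by split; [exact: (barrier_high b1)|exact: (barrier_high b2)].
- move=> x [U1 U2] _; apply: shift_late => mx.
  have h1 : 1 < a x by rewrite ltNge; apply/negP => /(exit_timeP b1 mx 1).2.
  have h2 : 1 < b x by rewrite ltNge; apply/negP => /(exit_timeP b2 mx 1).2.
  by rewrite /m subr_ge0 le_min !ltW.
Qed.

Lemma cont_on_shift : cont_on [set c | H1 c /\ exists k, c k != 0] shift_time.
Proof.
apply: cont_on_local => x [Hx x0]; have [mx|nm] := pselect (mixed x).
  exists mixed; split; [exact: open_mixed|by []|].
  apply: (@cont_on_sub _ _ _ mixed); first by move=> y [].
  apply: (cont_on_eq (fun y my => esym (shift_mixed my))).
  have ca := cont_on_exit_time b1; have cb := cont_on_exit_time b2.
  have cm : cont_on mixed m by apply: cont_onB; [exact: cont_on_min|exact: cont_on_cst].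
  apply: cont_onM; last first.
    by apply: cont_onV; [move=> y _; rewrite gt_eqF ?am|exact: cont_onB].
  by apply: cont_onM; [apply: cont_on_min => //; exact: cont_on_cst|exact: cont_onB].
have [U [oU [//|Ux] hU]] := nonmixed_shift Hx x0.
exists U; split=> //; apply: (cont_on_eq (F := fun=> 0)); last exact: cont_on_cst.
by move=> y [_ Uy]; rewrite hU.
Qed.

Lemma transferZ k c : 0 < k -> transfer (scale k c) = scale k (transfer c).
Proof.
move=> k0; rewrite /transfer -flowZ; congr (flow mu _ _).
have [mc|nm] := pselect (mixed c).
  have mk := mixedZ k0 mc.
  by rewrite !shift_mixed// /m /a /b !exit_timeZ.
rewrite !shift_nmixed// => mk; apply: nm; rewrite -(scaleV c k0); apply: mixedZ => //.
by rewrite invr_gt0.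
Qed.

Lemma transfer_opp c : transfer (opp c) = opp (transfer c).
Proof.
rewrite /transfer -flow_opp; congr (flow mu _ _).
have [mc|nm] := pselect (mixed c).
  have mk := (mixed_opp c).2 mc.
  by rewrite !shift_mixed// /m /a /b !exit_time_opp.
by rewrite !shift_nmixed// => /mixed_opp.
Qed.

Lemma transfer_barrier c : H1 c -> (exists k, c k != 0) ->
  [/\ H2 (transfer c), exists k, transfer c k != 0 & M1 c -> M2 (transfer c)].
Proof.
move=> Hc c0; have [mc|nm] := pselect (mixed c).
  have [ha ha'] := exit_timeP b1 mc 0; have [hb hb'] := exit_timeP b2 mc (shift_time c).
  rewrite flow0 in ha ha'; have a0 := ha.1 Hc; split.
  - by apply/hb; exact: shift_le.
  - by have [k ck] := c0; exists k; rewrite flow_neq0.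
  - by move=> /ha' a0'; apply/hb'; rewrite shift_boundary//; apply/eqP; rewrite eq_le a0'.
have low0 := nonmixed_H Hc c0 nm.
rewrite /transfer shift_nmixed// flow0; split=> //.
  by case: (barrier_cover b2 c) => // /(barrier_high b2 c0 low0).
by move=> /(barrier_high b1 c0 low0).
Qed.

End TwoBarriers.

(** Flowing by r lowers both exit times and the breakpoint [m] by r. The breakpoint does not change
    side relative to the vector, so the same affine piece is applied backwards. *)
Lemma transferK H1 M1 H2 M2 c : barrier H1 M1 -> barrier H2 M2 ->
  transfer H2 M2 H1 M1 (transfer H1 M1 H2 M2 c) = c.
Proof.
move=> b1 b2; have [mc|nm] := pselect (mixed c); last first.
  have e : transfer H1 M1 H2 M2 c = c by rewrite /transfer shift_nmixed// flow0.
  by rewrite e /transfer shift_nmixed// flow0.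
rewrite [in LHS]/transfer flowD [X in flow mu X _](_ : _ = 0) ?flow0//.
set r := shift_time H1 M1 H2 M2 c.
have mr := mixed_flow r mc; rewrite (shift_mixed _ _ _ _ mr) !exit_time_flow//.
rewrite /r shift_mixed//; set a := exit_time H1 M1 c; set b := exit_time H2 M2 c.
rewrite (minC (b - _)).
set m := Num.min a b - 1.
have ma : Num.min a b <= a by rewrite ge_min lexx.
have mb : Num.min a b <= b by rewrite ge_min lexx orbT.
have am : 0 < a - m by rewrite /m; lra.
have bm : 0 < b - m by rewrite /m; lra.
set k := _ / (a - m).
have -> : Num.min (a - k) (b - k) - 1 = m - k.
  rewrite /m; case: (leP a b) => h; [rewrite min_l ?lerD2r//|rewrite min_r ?lerD2r ?ltW//]; ring.
have -> : b - k - (a - k) = b - a by ring.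
have -> : b - k - (m - k) = b - m by ring.
have [m0|m0] := leP 0 m.
  have k0 : k = 0 by rewrite /k min_r// !mul0r.
  by rewrite k0 subr0 min_r// !mul0r addr0.
have ek : k = m * (a - b) / (a - m) by rewrite /k min_l// ltW.
have emk : m - k = m * ((b - m) / (a - m)).
  by rewrite ek; field; rewrite gt_eqF.
rewrite min_l; last by rewrite emk mulr_le0_ge0 ?(ltW m0)// divr_ge0// ltW.
rewrite emk ek; field; rewrite !gt_eqF//.
Qed.

Lemma conic_iso_transfer H1 M1 H2 M2 : barrier H1 M1 -> barrier H2 M2 ->
  conic_iso [set c | H1 c /\ exists k, c k != 0] [set c | H2 c /\ exists k, c k != 0]
    (transfer H1 M1 H2 M2) (transfer H2 M2 H1 M1).
Proof.
move=> b1 b2.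
have ct H M H' M' : barrier H M -> barrier H' M' ->
    cont_on [set c | H c /\ exists k, c k != 0] (transfer H M H' M').
  by move=> b b'; apply: cont_on_flow; [exact: cont_on_shift|exact: cont_on_id].
split.
- by split; exact: ct.
- by move=> c [Hc c0]; rewrite transferK//; have [] := transfer_barrier b1 b2 Hc c0.
- by move=> c [Hc c0]; rewrite transferK//; have [] := transfer_barrier b2 b1 Hc c0.
- by move=> k c k0 _; exact: transferZ.
Qed.

End Flow.

(** * The orthants as a barrier *)

Lemma bernoulli_le (R : realDomainType) (a : R) n : 0 <= a <= 1 -> 1 - n%:R * a <= (1 - a) ^+ n.
Proof.
move=> /andP[a0 a1]; elim: n => [|n IH]; first by rewrite mul0r subr0 expr0.
rewrite exprS -natr1.
have h : (1 - a) * (1 - n%:R * a) <= (1 - a) * (1 - a) ^+ n by rewrite ler_wpM2l// subr_ge0.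
have n0 : 0 <= n%:R * (a * a) :> R by rewrite !mulr_ge0.
apply: le_trans h; rewrite -subr_ge0.
by have -> : (1 - a) * (1 - n%:R * a) - (1 - (n%:R + 1) * a) = n%:R * (a * a) by ring.
Qed.

(** With u = x / N the power is at most e^x because 1 + u <= e^u. From below, 1 - u^2 <= (1 + u)
    e^(-u), and Bernoulli bounds (1 - u^2)^N by 1 - x^2 / N. *)
Lemma cvg_exp_power (R : realType) (x : R) :
  (1 + x / n.+1%:R) ^+ n.+1 @[n --> \oo] --> expR x.
Proof.
have h1 : (fun n : nat => expR x * (1 - x ^+ 2 * n.+1%:R^-1)) @ \oo --> expR x.
  rewrite -[X in _ --> X]mulr1; apply: cvgMr.
  rewrite -[X in _ --> X]subr0; apply: cvgB; first exact: cvg_cst.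
  rewrite -(mulr0 (x ^+ 2)); apply: cvgMr; exact: cvg_harmonic.
apply: (@squeeze_cvgr _ _ _ _ (fun n : nat => expR x * (1 - x ^+ 2 * n.+1%:R^-1)) (fun=> expR x));
  [|exact: h1|exact: cvg_cst].
have := @nbhs_infty_gtr R `|x|; apply: filterS => n xn.
set N := n.+1; have N0 : 0 < N%:R :> R by rewrite ltr0n.
have xN : `|x| < N%:R by apply: lt_trans xn _; rewrite ltr_nat.
set u := x / N%:R; have u1 : `|u| < 1 by rewrite normrM normfV (gtr0_norm N0) ltr_pdivrMr// mul1r.
have u1' : 0 < 1 + u by move: u1; rewrite ltr_norml => /andP[]; lra.
have ex : expR x = expR u ^+ N by rewrite -expRM_natl mulrC divfK// gt_eqF.
apply/andP; split; last first.
  by rewrite ex; apply: lerXn2r; rewrite ?nnegrE ?expR_ge0 ?(ltW u1')//; exact: expR_ge1Dx.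
have h : 1 - u ^+ 2 <= (1 + u) * expR (- u).
  have -> : 1 - u ^+ 2 = (1 + u) * (1 - u) by ring.
  by apply: ler_wpM2l; [exact: ltW|exact: expR_ge1Dx].
have u2 : 0 <= u ^+ 2 <= 1.
  by rewrite sqr_ge0 -(real_normK (num_real u)) exprn_ile1// ltW.
have h2 : (1 - u ^+ 2) ^+ N <= (1 + u) ^+ N * expR (- x).
  have -> : expR (- x) = expR (- u) ^+ N by rewrite !expRN ex exprVn.
  rewrite -exprMn; apply: lerXn2r => //; rewrite nnegrE.
    by rewrite subr_ge0; case/andP: u2.
  by rewrite mulr_ge0 ?expR_ge0// ltW.
have := le_trans (bernoulli_le N u2) h2; rewrite expRN ler_pdivlMr ?expR_gt0// mulrC.
by apply: le_trans; rewrite le_eqVlt; apply/orP; left; apply/eqP; congr (_ * (1 - _)); rewrite /u; field; rewrite gt_eqF.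
Qed.

(** * Coordinates vanishing on an interval of time *)

Section Subinterval.
Variable R : realType.

(** Stands in for analyticity: at a time in the subinterval a coordinate is either nonzero or
    vanishes along with its time derivative. *)
Lemma vanishing_subinterval (f : nat -> R -> R) (a b : R) m : a < b ->
  (forall n, continuous (f n)) -> exists a' b', [/\ a <= a', a' < b', b' <= b &
    forall n, (n <= m)%N -> (forall s, a' < s < b' -> f n s = 0) \/ (forall s, a' < s < b' -> f n s != 0)].
Proof.
move=> ab cf; have step n a1 b1 : a1 < b1 -> exists a2 b2, [/\ a1 <= a2, a2 < b2, b2 <= b1 &
    (forall s, a2 < s < b2 -> f n s = 0) \/ (forall s, a2 < s < b2 -> f n s != 0)].
  move=> ab1; have [z|/existsNP[s /not_implyP[/andP[as_ sb] fs]]] :=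
      pselect (forall s, a1 < s < b1 -> f n s = 0).
    by exists a1, b1; split=> //; left.
  have nf : nbhs (f n s) [set y | y != 0].
    by apply: open_nbhs_nbhs; split; [exact: open_neq|exact/eqP].
  have /nbhs_ballP[e /= e0 he] := cf n s _ nf.
  exists (Num.max a1 (s - e)), (Num.min b1 (s + e)); split.
  - by rewrite le_max lexx.
  - by rewrite gt_max !lt_min ab1 /=; apply/andP; split; [|apply/andP; split]; lra.
  - by rewrite ge_min lexx.
  - right=> r; rewrite gt_max lt_min => /andP[/andP[_ h1] /andP[_ h2]]; apply: he.
    by rewrite /ball /= ltr_norml; apply/andP; split; lra.
elim: m => [|m [a1 [b1 [h1 h2 h3 h4]]]].
  have [a2 [b2 [h1 h2 h3 h4]]] := step 0%N _ _ ab.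
  by exists a2, b2; split=> // n; rewrite leqn0 => /eqP->.
have [a2 [b2 [k1 k2 k3 k4]]] := step m.+1 _ _ h2.
exists a2, b2; split=> //; [exact: le_trans k1|exact: le_trans k3 _|].
move=> n; rewrite leq_eqVlt => /orP[/eqP->//|]; rewrite ltnS => /h4.
have sub s : a2 < s < b2 -> a1 < s < b1.
  by move=> /andP[l1 l2]; rewrite (le_lt_trans k1)//= (lt_le_trans l2).
by case=> h; [left|right] => s /sub; exact: h.
Qed.

Lemma exponential_sum_zero n (c mu : 'I_n -> R) (a b : R) :
  (forall s, a < s < b -> \sum_k c k * expR (s * mu k) = 0) ->
  forall s, a < s < b -> \sum_k c k * mu k * expR (s * mu k) = 0.
Proof.
move=> h s /andP[as_ sb].
have D k : is_derive s 1 (fun t => c k * expR (t * mu k)) (c k * mu k * expR (s * mu k)).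
  have D1 := is_derive1_comp (is_derive_expR (mu k * s)) (is_deriveZ (mu k) (is_derive_id s 1)).
  have e : (c k \*: (expR \o (mu k \*: id)))%R = (fun t => c k * expR (t * mu k)).
    by apply/funext => t; rewrite /= /GRing.scale /= (mulrC t).
  rewrite -e; apply: (is_derive_eq (is_deriveZ (c k) D1)).
  by rewrite /GRing.scale /= mulr1 (mulrC s); ring.
have D1 := is_derive_sum D.
have D2 : is_derive s 1 (\sum_k (fun t => c k * expR (t * mu k))) 0.
  apply: (near_eq_is_derive (f := cst 0)).
  have := near_in_itvoo (x := s) (a := a) (b := b).
  rewrite in_itv /= as_ sb => /(_ isT); apply: filterS => t.
  by rewrite in_itv /= fct_sumE => /h ->.
by have [_ <-] := D1; have [_ ->] := D2.
Qed.

End Subinterval.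

(** * The heat flow on the union of orthants *)

Section OrthantBarrier.
Variables (R : realType) (d : nat).
Hypothesis d5 : (5 <= d)%N.
Let h := uphalf d.
Let M := middle (arcs d).
Local Notation rf := {ptws 'I_d -> R}.

(** The midpoint of the second and third eigenvalues, so that the two low modes grow and all others
    decay, as the quadric requires. On cones this shift of the spectrum is only a rescaling. *)
Let lam0 : R := (lam R d 1 + lam R d 2) / 2.
Definition rate (k : 'I_d) : R := lam R d k - lam0.
Definition low (k : 'I_d) : bool := (k < 2)%N.

Let lam_ord k l : (k < l < d.+1)%N -> lam R d l < lam R d k.
Proof. exact: lam_decr. Qed.

Lemma rate_inj : injective rate.
Proof.
move=> k l /addIr e; apply/val_inj/eqP; case: (ltngtP k l) => // kl.
  by have := @lam_ord k l; rewrite e ltxx => -> //; have := ltn_ord l; lia.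
by have := @lam_ord l k; rewrite e ltxx => -> //; have := ltn_ord k; lia.
Qed.

Lemma lam_le k l : (k <= l < d.+1)%N -> lam R d l <= lam R d k.
Proof.
move=> /andP[]; rewrite leq_eqVlt => /orP[/eqP->//|kl] ld.
by apply: ltW; apply: lam_ord; rewrite kl.
Qed.

Lemma rate_low k : low k -> 0 < rate k.
Proof.
move=> lk; have h1 : lam R d 2 < lam R d 1 by apply: lam_ord; lia.
have h2 : lam R d 1 <= lam R d k by apply: lam_le; move: lk; rewrite /low; lia.
by rewrite /rate /lam0; lra.
Qed.

Lemma rate_high k : ~~ low k -> rate k < 0.
Proof.
rewrite -leqNgt => lk; have h1 : lam R d 2 < lam R d 1 by apply: lam_ord; lia.
have h2 : lam R d k <= lam R d 2 by apply: lam_le; have := ltn_ord k; lia.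
by rewrite /rate /lam0; lra.
Qed.

Lemma low_rate j k : low j -> ~~ low k -> rate k < rate j.
Proof. by move=> /rate_low hj /rate_high hk; lra. Qed.

Lemma uncross_subproof (m : 'I_d) : ((if odd m then h + m./2 else m./2) < d)%N.
Proof. by have := ltn_ord m; rewrite /h; case: ifP; lia. Qed.
Definition uncross (m : 'I_d) : 'I_d := Ordinal (uncross_subproof m).

Lemma uncrossK (m : 'I_d) : crossing h (uncross m) = m.
Proof. by rewrite /crossing /=; have := ltn_ord m; rewrite /h; case: ifP; case: ifP; lia. Qed.

Lemma cross_lt (p : 'I_d) : (crossing h p < d)%N.
Proof. by rewrite /crossing; have := ltn_ord p; rewrite /h; case: ifP; lia. Qed.

Definition cross (p : 'I_d) : 'I_d := Ordinal (cross_lt p).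

Lemma crossK p : uncross (cross p) = p.
Proof. by apply: val_inj; rewrite /= /crossing /h; have := ltn_ord p; case: ifP; case: ifP; lia. Qed.

Definition flip_sign (p : 'I_d) : R := (-1) ^+ (h <= p)%N.

Lemma flip_signK p : flip_sign p * flip_sign p = 1.
Proof. by rewrite /flip_sign -signr_addb addbb. Qed.

(* In the crossing order, and after changing the sign of the second half of the
   coordinates, the middle orthants are those with at most one sign change. *)
Definition orth (c : rf) : rf := fun p => flip_sign p * synth c (crossing h p).+1.
Definition unorth (z : rf) : rf := coef (fun n => flip_sign (uncross n) * z (uncross n)).

Lemma orthK c : unorth (orth c) = c.
Proof.
apply/funext => k; rewrite -[RHS]synthK; congr (coef _ k); apply/funext => n.
by rewrite /orth mulrA flip_signK mul1r uncrossK.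
Qed.

Lemma unorthK z : orth (unorth z) = z.
Proof.
apply/funext => p; rewrite /orth /unorth -[crossing h p]/(val (cross p)) coefK.
by rewrite crossK mulrA flip_signK mul1r.
Qed.

Lemma synth_linear k (c e : rf) n : synth (fun i => c i + k * e i) n = synth c n + k * synth e n.
Proof. by rewrite /synth mulr_sumr -big_split; apply: eq_bigr => i _ /=; ring. Qed.

Lemma synthZ k (c : rf) n : synth (scale k c) n = k * synth c n.
Proof. by rewrite /synth mulr_sumr; apply: eq_bigr => i _ /=; rewrite /scale mulrA. Qed.

Lemma orthZ k c : orth (scale k c) = scale k (orth c).
Proof. by apply/funext => p; rewrite /orth synthZ /scale mulrCA. Qed.

Lemma orth_opp c : orth (opp c) = opp (orth c).
Proof.
have e (b : rf) : opp b = scale (- 1) b by apply/funext => p; rewrite /opp /scale mulN1r.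
by rewrite !e orthZ.
Qed.

Lemma cont_on_orth (A : set rf) : cont_on A orth.
Proof.
apply: cont_on_ptws => p; apply: cont_onM; first exact: cont_on_cst.
by apply: cont_on_sum => k _; apply: cont_onM; [exact: cont_on_proj|exact: cont_on_cst].
Qed.

Lemma cont_on_unorth (A : set rf) : cont_on A unorth.
Proof.
apply: cont_on_ptws => k; rewrite /unorth /coef; apply: cont_onM; last exact: cont_on_cst.
apply: cont_on_sum => n _; apply: cont_onM; last exact: cont_on_cst.
by apply: cont_onM; [exact: cont_on_cst|exact: cont_on_proj].
Qed.

Definition orthM (c : rf) := union_orthants M (orth c).
Definition orthH (c : rf) := union_orthants (~: M) (orth c).

Let flip_le (x : R) p : (flip_sign p * x <= 0) = if (h <= p)%N then 0 <= x else x <= 0.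
Proof. by rewrite /flip_sign; case: (h <= p)%N; rewrite ?expr1 ?expr0 ?mulN1r ?mul1r ?oppr_le0. Qed.
Let flip_ge (x : R) p : (0 <= flip_sign p * x) = if (h <= p)%N then x <= 0 else 0 <= x.
Proof. by rewrite /flip_sign; case: (h <= p)%N; rewrite ?expr1 ?expr0 ?mulN1r ?mul1r ?oppr_ge0. Qed.

Lemma orthM_monotone c : orthM c <-> monotone_signs d (synth c).
Proof.
split.
  move=> [Z /(arcs_ring d5)[s [t [td eZ]]] cZ]; exists s, t; split=> // n nd.
  have nd' : (n.-1 < d)%N by lia.
  have := cZ (uncross (Ordinal nd')); rewrite eZ /orth uncrossK /= prednK; last by case/andP: nd.
  rewrite flip_le flip_ge /= -/h.
  by case: s {eZ}; case: (n <= t)%N; case: (h <= _)%N => //=; rewrite ?expr1 ?expr0 ?mulN1r ?mul1r ?oppr_le0 ?oppr_ge0.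
move=> [s [t [td ht]]].
exists (finset (fun p : 'I_d => s (+) ((crossing h p < t)%N == (h <= p)%N))).
  by apply/(arcs_ring d5); exists s, t; split=> // p; rewrite inE.
move=> p; rewrite inE /orth flip_le flip_ge; have := ht (crossing h p).+1; rewrite /= cross_lt => /(_ isT).
by case: s {ht}; case: (crossing h p < t)%N; case: (h <= p)%N => //=;
  rewrite ?expr1 ?expr0 ?mulN1r ?mul1r ?oppr_le0 ?oppr_ge0.
Qed.

(** A sign vector off the ring changes sign at least twice in the crossing order, and the points of
    its closed orthant inherit this weakly. *)
Lemma orthH_alternates c : orthH c -> alternates d (synth c).
Proof.
move=> [Z ZM cZ].
pose b m := if insub m is Some m' then (uncross m' \in Z) == (h <= uncross m')%N else false.
have bP m (md : (m < d)%N) : if b m then 0 <= synth c m.+1 else synth c m.+1 <= 0.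
  rewrite /b insubT /=; have := cZ (uncross (Ordinal md)); rewrite /orth uncrossK /= flip_le flip_ge /=.
  by case: (_ \in Z); case: (h <= _)%N.
have [[s [t [td hb]]]|[i [j [k [ij jk bk bj]]]]] := sign_pattern b d.
  move: ZM; rewrite finset.in_setC => /negP; case; apply/(arcs_ring d5); exists s, t; split=> // p.
  have := hb (crossing h p) (cross_lt p); rewrite /b -[crossing h p]/(val (cross p)) valK crossK /=.
  rewrite -/h; case: (p \in Z); case: (h <= p)%N; case: s {hb}; case: (crossing h p < t)%N => //.
exists (~~ b i), i.+1, j.+1, k.+1.
have id : (i < d)%N by lia.
have jd : (j < d)%N by lia.
have kd : (k < d)%N by lia.
have := bP _ id; have := bP _ jd; have := bP _ kd; rewrite bk bj.
by case: (b i) => /= h1 h2 h3; rewrite ?expr1 ?expr0 ?mulN1r ?mul1r ?oppr_le0 ?oppr_ge0; split=> //; lia.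
Qed.

Lemma orth_cover c : orthH c \/ orthM c.
Proof.
pose Z := finset (fun p => orth c p < 0).
have cZ : compat Z (orth c) by move=> p; rewrite inE; case: ltP => // /ltW.
by have [ZM|ZM] := boolP (Z \in M); [right|left]; exists Z; rewrite // inE.
Qed.

Lemma closed_orth (P : {set {set 'I_d}}) : closed [set c : rf | union_orthants P (orth c)].
Proof. by apply: closed_union_orthants; exact: cont_on_orth. Qed.

Lemma conic_orth (P : {set {set 'I_d}}) : conic [set c : rf | union_orthants P (orth c)].
Proof. by move=> k c k0 [Z ZP cZ]; exists Z => //; rewrite orthZ; exact: compatZ. Qed.

Lemma middleC Z : (~: Z \in M) = (Z \in M).
Proof. by rewrite [~: Z \in M]inE [Z \in M]inE finset.setCK andbC. Qed.

Lemma orthM_step c (e : R) : 0 <= e <= 1 -> orthM c -> orthM (fun k : 'I_d => (1 + e * lam R d k) * c k).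
Proof.
move=> e01 /orthM_monotone/(smooth_signs e01 (synth_left _) (synth_right _))[s [t [td hs]]].
apply/orthM_monotone; exists s, t; split=> // n nd; have := hs n nd.
suff -> : synth (fun k : 'I_d => (1 + e * lam R d k) * c k) n = synth c n + e * (synth c n.-1 + synth c n.+1) by [].
have [m ->] : exists m, n = m.+1 by exists n.-1; rewrite prednK//; case/andP: nd.
rewrite /= synth_rec -synth_linear; congr (synth _ _); apply/funext => k; ring.
Qed.

(** Euler steps of size t / N <= 1 preserve [orthM] by [smooth_signs], and the closed set contains
    their limit. *)
Lemma orthM_flow c t : 0 <= t -> orthM c -> orthM (flow rate t c).
Proof.
move=> t0 Mc; have {Mc}power n (e : R) : 0 <= e <= 1 -> orthM (fun k : 'I_d => (1 + e * lam R d k) ^+ n * c k).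
  move=> e01; elim: n => [|n IH].
    by have -> : (fun k : 'I_d => (1 + e * lam R d k) ^+ 0 * c k) = c by apply/funext => k; rewrite expr0 mul1r.
  have -> : (fun k : 'I_d => (1 + e * lam R d k) ^+ n.+1 * c k) =
      (fun k : 'I_d => (1 + e * lam R d k) * ((1 + e * lam R d k) ^+ n * c k)).
    by apply/funext => k; rewrite exprS mulrA.
  exact: orthM_step.
have lim : orthM (fun k : 'I_d => expR (t * lam R d k) * c k).
  apply: (@closed_ptws_cvg R 'I_d nat \oo _ orthM
    (fun n (k : 'I_d) => (1 + t * lam R d k / n.+1%:R) ^+ n.+1 * c k) _ (@closed_orth M)).
    have := @nbhs_infty_gtr R t; apply: filterS => n tn /=.
    have -> : (fun k : 'I_d => (1 + t * lam R d k / n.+1%:R) ^+ n.+1 * c k) =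
        (fun k : 'I_d => (1 + t / n.+1%:R * lam R d k) ^+ n.+1 * c k).
      by apply/funext => k; rewrite mulrAC.
    apply: power; rewrite divr_ge0//= ler_pdivrMr ?ltr0n// mul1r ltW//.
    by apply: lt_trans tn _; rewrite ltr_nat.
  by move=> k; apply: cvgMl; exact: cvg_exp_power.
have := @conic_orth M (expR (- (t * lam0))) _ (expR_gt0 _) lim; congr orthM; apply/funext => k.
by rewrite /scale /flow mulrA -expRD /rate; congr (expR _ * _); ring.
Qed.

(** The end point is pushed by multiples of [v] into the interior of its orthant, hence off [orthM].
    Flowing back cannot enter [orthM], which is preserved forwards, and the limit remains in the
    closed set [orthH]. *)
Lemma orthH_flow c t : 0 <= t -> orthH (flow rate t c) -> orthH c.
Proof.
move=> t0 [Z ZM cZ].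
pose v := unorth (fun p => if p \in Z then - 1 else 1).
pose z (n : nat) : rf := fun k => flow rate t c k + n.+1%:R^-1 * v k.
have nz n : ~ orthM (z n).
  move=> [Z' Z'M cZ']; move: ZM; rewrite finset.in_setC => /negP; case; suff -> : Z = Z' by [].
  apply/setP => p; have := cZ' p; have := cZ p.
  have -> : orth (z n) p = orth (flow rate t c) p + n.+1%:R^-1 * (if p \in Z then - 1 else 1).
    by rewrite /orth synth_linear mulrDr mulrCA -[flip_sign p * synth v _]/(orth v p) unorthK.
  have n0 : 0 < n.+1%:R^-1 :> R by rewrite invr_gt0 ltr0n.
  by case: (p \in Z); case: (p \in Z') => // a1 a2; exfalso; move: a1 a2 n0; clear; set x := orth _ _; set e := _^-1; lra.
have Hz n : orthH (flow rate (- t) (z n)).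
  case: (orth_cover (flow rate (- t) (z n))) => // /(orthM_flow t0).
  by rewrite flowD addrN flow0 => /nz.
have -> : c = flow rate (- t) (flow rate t c) by rewrite flowD addNr flow0.
apply: (@closed_ptws_cvg R 'I_d nat \oo _ orthH (fun n => flow rate (- t) (z n)) _ (@closed_orth (~: M))).
  by near=> n; exact: Hz.
move=> k; rewrite /flow; apply: cvgMr.
rewrite -[X in _ --> X]addr0; apply: cvgD; first exact: cvg_cst.
by rewrite -(mul0r (v k)); apply: cvgMl; exact: cvg_harmonic.
Unshelve. all: by end_near. Qed.

Lemma synth_neq0 (c : rf) : (exists k, c k != 0) -> exists2 n, (0 < n <= d)%N & synth c n != 0.
Proof.
move=> [k ck]; apply: contrapT => none; move: ck; rewrite -(synthK c k) /coef big1 ?mul0r ?eqxx// => n _.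
apply/eqP; rewrite mulf_eq0; apply/orP; left; apply/negPn/negP => ne; apply: none.
by exists n.+1; rewrite // ltn_ord.
Qed.

(** Otherwise both sets would contain the orbit on all of [0, t]. At a time s given by
    [vanishing_subinterval], a zero coordinate has zero derivative, so its neighbours sum to zero by
    the recurrence; [strict_signs] then excludes being in both sets. *)
Lemma orth_strict c t : 0 < t -> orthM c -> (exists k, c k != 0) -> ~ orthH (flow rate t c).
Proof.
move=> t0 Mc [k0 ck0] Ht.
pose f n s : R := synth (flow rate s c) n.
have cf n : continuous (f n).
  apply: cont_on_continuous; apply: cont_on_sum => k _; apply: cont_onM; last exact: cont_on_cst.
  have cc := @cont_flow_time R _ rate c.
  by apply: (@cont_on_comp _ _ _ _ setT _ (fun p : rf => p k)) cc _ => //; exact: cont_on_proj.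
have [a [b [a0 ab bt hf]]] := vanishing_subinterval d t0 cf.
pose s := (a + b) / 2; have sab : a < s < b by rewrite /s; apply/andP; split; lra.
have s0 : 0 <= s by case/andP: sab => ? _; lra.
have st : s <= t by case/andP: sab => _ ?; lra.
have Hs : orthH (flow rate s c).
  by apply: (@orthH_flow _ (t - s)); [rewrite subr_ge0|rewrite flowD subrK].
have Ms := orthM_flow s0 Mc.
apply: (@strict_signs R d (synth (flow rate s c))).
- exact: synth_left.
- exact: synth_right.
- move=> n nd fn; have [] := hf n; first by case/andP: nd.
    move=> fz; have ez r : a < r < b -> \sum_k (c k * mode R d k n) * expR (r * rate k) = 0.
      by move=> /fz; rewrite /f /synth => e0; rewrite -[RHS]e0; apply: eq_bigr => k _; rewrite /flow; ring.
    have := exponential_sum_zero ez sab.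
    have [m e] : exists m, n = m.+1 by exists n.-1; rewrite prednK//; case/andP: nd.
    move: fn; rewrite e /= synth_rec => fn D.
    have : synth (fun k => rate k * flow rate s c k) m.+1 = 0.
      by rewrite -[RHS]D /synth; apply: eq_bigr => k _; rewrite /flow; ring.
    have -> : synth (fun k => rate k * flow rate s c k) m.+1 =
        synth (fun k => lam R d k * flow rate s c k) m.+1 - lam0 * synth (flow rate s c) m.+1.
      by rewrite -mulNr -synth_linear; congr (synth _ _); apply/funext => k; rewrite /rate; ring.
    by rewrite fn mulr0 subr0.
  by move=> /(_ s sab); rewrite /f fn eqxx.
- by apply: synth_neq0; exists k0; rewrite flow_neq0.
- exact/orthM_monotone.
- exact: orthH_alternates.
Qed.

Let d_gt (i : nat) : (i < 2)%N -> (i < d)%N. Proof. by lia. Qed.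
Let k0 : 'I_d := Ordinal (@d_gt 0 isT).
Let k1 : 'I_d := Ordinal (@d_gt 1 isT).

Lemma orth_barrier : barrier rate low orthH orthM.
Proof.
split.
- exact: closed_orth.
- exact: closed_orth.
- exact: orth_cover.
- exact: conic_orth.
- exact: conic_orth.
- move=> c [Z ZM cZ]; exists (~: Z); first by rewrite finset.in_setC middleC -finset.in_setC.
  by rewrite orth_opp; apply/compatC.
- by move=> c t t0 Mc c0; exact: orth_strict.
- move=> c [k ck] high0 /orthH_alternates; apply: (@low_modes_signs R d _ (c k0) (c k1)).
    have lk : low k by apply: contraR ck => /high0->.
    move: ck; rewrite -negb_and; apply: contra => /andP[/eqP e0 /eqP e1]; move: lk; rewrite /low => lk.
    have [ek|ek] : k = k0 \/ k = k1.
    + by case: k lk => -[|[|k]] //= kd _; [left|right]; apply: val_inj.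
    + by rewrite ek e0.
    + by rewrite ek e1.
  move=> n _; rewrite /synth (bigD1 k0)//= (bigD1 k1)//= big1 ?addr0//.
  move=> i /andP[i0 i1]; rewrite high0 ?mul0r// /low; move: i0 i1; rewrite -!val_eqE /=; lia.
- move=> c c0 low0 /orthM_monotone ms.
  have proj (k : 'I_d) : low k -> \sum_(n < d) synth c n.+1 * mode R d k n.+1 = 0.
    move=> lk; have := synthK c k; rewrite (low0 _ lk) /coef => /eqP.
    by rewrite mulf_eq0 invr_eq0 (gt_eqF (norm2_gt0 _ _)) orbF => /eqP.
  apply: (monotone_low_modes _ ms (synth_neq0 c0) (proj k0 _) (proj k1 _)) => //; lia.
Qed.

End OrthantBarrier.

(** * The quadric *)

Section SquareBarrier.
Variables (R : realType) (J : finType) (mu : J -> R) (low : pred J).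
Local Notation rf := {ptws J -> R}.
Hypotheses (mu_low : forall k, low k -> 0 < mu k) (mu_high : forall k, ~~ low k -> mu k < 0).

Definition lowsq (c : rf) : R := \sum_(k | low k) c k ^+ 2.
Definition highsq (c : rf) : R := \sum_(k | ~~ low k) c k ^+ 2.

Lemma cont_on_sumsq (P : pred J) (A : set rf) : cont_on A (fun c => \sum_(k | P k) c k ^+ 2).
Proof.
by apply: cont_on_sum => k _; apply: cont_onM; exact: cont_on_proj.
Qed.

Lemma sumsqZ (P : pred J) k (c : rf) :
  \sum_(i | P i) scale k c i ^+ 2 = k ^+ 2 * \sum_(i | P i) c i ^+ 2.
Proof. by rewrite mulr_sumr; apply: eq_bigr => i _; rewrite exprMn. Qed.

Lemma sumsq_opp (P : pred J) (c : rf) : \sum_(i | P i) opp c i ^+ 2 = \sum_(i | P i) c i ^+ 2.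
Proof. by apply: eq_bigr => i _; rewrite sqrrN. Qed.

Lemma sumsq_ge0 (P : pred J) (c : rf) : 0 <= \sum_(k | P k) c k ^+ 2.
Proof. by apply: sumr_ge0 => i _; exact: sqr_ge0. Qed.

Lemma sumsq_gt0 (P : pred J) (c : rf) k : P k -> c k != 0 -> 0 < \sum_(k | P k) c k ^+ 2.
Proof.
move=> Pk ck; rewrite (bigD1 k)//= ltr_pwDl//; first by rewrite exprn_even_gt0.
by apply: sumr_ge0 => i _; exact: sqr_ge0.
Qed.

Definition squareH (c : rf) := lowsq c <= highsq c.
Definition squareM (c : rf) := highsq c <= lowsq c.

Lemma square_barrier : barrier mu low squareH squareM.
Proof.
have cl (f g : rf -> R) : cont_on setT f -> cont_on setT g -> closed [set c | f c <= g c].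
  move=> cf cg; have -> : [set c | f c <= g c] = [set c | f c - g c <= 0].
    by apply/funext => c; rewrite /= subr_le0.
  by apply: closed_le0; exact: cont_onB.
split.
- by apply: cl; exact: cont_on_sumsq.
- by apply: cl; exact: cont_on_sumsq.
- by move=> c; rewrite /squareH /squareM; case: (leP (lowsq c) (highsq c)) => [|/ltW]; [left|right].
- by move=> k c k0; rewrite /squareH /lowsq /highsq !sumsqZ ler_pM2l// exprn_gt0.
- by move=> k c k0; rewrite /squareM /lowsq /highsq !sumsqZ ler_pM2l// exprn_gt0.
- by move=> c; rewrite /squareH /lowsq /highsq !sumsq_opp.
- move=> c t t0 Mc [k ck].
  have [l ll cl0] : exists2 l, low l & c l != 0.
    have [lk|hk] := boolP (low k); first by exists k.
    apply: contrapT => none; have : lowsq c = 0.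
      by apply: big1 => i li; apply/eqP; rewrite sqrf_eq0; apply/negPn/negP => ci; apply: none; exists i.
    move: Mc; rewrite /squareM => /[swap] ->; rewrite leNgt.
    by rewrite (sumsq_gt0 (P := fun k => ~~ low k) hk ck).
  apply/negP; rewrite -ltNge; apply: (@le_lt_trans _ _ (highsq c)).
    apply: ler_sum => i hi; rewrite /flow exprMn ler_piMl ?sqr_ge0//.
    rewrite exprn_ile1 ?expR_ge0// -expR0 ler_expR; apply: mulr_ge0_le0; first exact: ltW.
    by apply: ltW; exact: mu_high.
  apply: (le_lt_trans Mc).
  have e1 i : low i -> 1 < expR (t * mu i) ^+ 2.
    by move=> li; rewrite exprn_egt1// -expR0 ltr_expR mulr_gt0// mu_low.
  rewrite /lowsq (bigD1 l)//= [X in _ < X](bigD1 l)//=; apply: ltr_leD.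
    by rewrite /flow exprMn ltr_pMl ?e1// exprn_even_gt0.
  apply: ler_sum => i /andP[li _]; rewrite /flow exprMn ler_peMl ?sqr_ge0// ltW//.
  exact: e1.
- move=> c [k ck] high0; apply/negP; rewrite -ltNge /highsq big1.
    apply: (sumsq_gt0 _ ck); by apply: contraR ck => /high0->.
  by move=> i hi; rewrite high0// expr0n.
- move=> c [k ck] low0; apply/negP; rewrite -ltNge /lowsq big1.
    apply: (sumsq_gt0 (P := fun k => ~~ low k) _ ck); by apply: contra ck => /low0->.
  by move=> i hi; rewrite low0// expr0n.
Qed.

Definition upper_quadric : set {ptws option J -> R} :=
  [set q | [/\ exists o, q o != 0, 0 <= q None & lowsq (floor q) + q None ^+ 2 = highsq (floor q)]].

Definition raise (c : rf) : {ptws option J -> R} :=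
  fun o => if o is Some k then c k else Num.sqrt (highsq c - lowsq c).

(** The upper half of the quadric is a graph over [squareH]; its height vanishes where [lowsq] =
    [highsq], which is where the two halves meet. *)
Lemma conic_iso_raise :
  conic_iso [set c | squareH c /\ exists k, c k != 0] upper_quadric raise (@floor R J).
Proof.
split.
- split; apply: cont_on_ptws.
    case=> [k|]; first exact: cont_on_proj.
    by apply: cont_on_sqrt; apply: cont_onB; exact: cont_on_sumsq.
  by move=> k; exact: cont_on_proj.
- move=> c [Hc [k ck]]; split; last by [].
  split; [by exists (Some k)|exact: sqrtr_ge0|].
  by rewrite /raise sqr_sqrtr ?subr_ge0// addrC subrK.
- move=> q [q0 qN e]; split.
    split; first by rewrite /squareH -e lerDl sqr_ge0.
    apply: contrapT => h; have z k : floor q k = 0.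
      by apply/eqP/negPn/negP => qk; apply: h; exists k.
    have hz (P : pred J) : \sum_(k | P k) floor q k ^+ 2 = 0.
      by apply: big1 => k _; rewrite z expr0n.
    move: e; rewrite /lowsq /highsq !hz add0r => /eqP; rewrite sqrf_eq0 => /eqP qN0.
    by have [[k|]] := q0; [rewrite -[q _]/(floor q k) z eqxx|rewrite qN0 eqxx].
  apply/funext => -[k|] //=; have -> : highsq (floor q) - lowsq (floor q) = q None ^+ 2.
    by rewrite -e; ring.
  by rewrite sqrtr_sqr ger0_norm.
- move=> k c k0 _; apply/funext => -[i|] //=.
  rewrite /raise /lowsq /highsq !sumsqZ -mulrBr sqrtrM ?sqr_ge0// sqrtr_sqr gtr0_norm//.
Qed.

End SquareBarrier.

(** * One half of the boundary and one half of the quadric *)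

Section HalfBoundary.
Variables (R : realType) (d : nat).
Hypothesis d5 : (5 <= d)%N.
Let I := arcs d.
Let M := middle I.
Local Notation rf := {ptws option 'I_d -> R}.
Local Notation Q := (upper_quadric (R := R) (@low d)).

Let b1 := orth_barrier R d5.
Let b2 := square_barrier (@rate_low R d d5) (@rate_high R d d5).

Let MI : M \subset I.
Proof. by apply/fintype.subsetP => Y; rewrite [Y \in M]inE => /andP[]. Qed.

Let ground (c : {ptws 'I_d -> R}) : rf := fun o => if o is Some k then orth c k else 0.

(** With all orthants included there is no frontier left to carry a wall, so the sheet lies at
    height zero. *)
Lemma conic_iso_ground : conic_iso (sheet (R := R) M finset.setT)
  [set c | orthH c /\ exists k, c k != 0] (fun u => unorth d5 (floor u)) ground.
Proof.
have uZ k (z : {ptws 'I_d -> R}) : unorth d5 (scale k z) = scale k (unorth d5 z).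
  by rewrite -{1}(unorthK d5 z) -orthZ (orthK d5).
have nz (c : {ptws 'I_d -> R}) : (exists k, orth c k != 0) -> exists k, c k != 0.
  move=> [k]; apply: contraPP => h; have c0 : c = fun=> 0.
    by apply/funext => i; apply/eqP/negPn/negP => ci; apply: h; exists i.
  by rewrite /orth /synth c0 big1 ?mulr0 ?eqxx// => i _; rewrite mul0r.
have nz' (c : {ptws 'I_d -> R}) : (exists k, c k != 0) -> exists k, orth c k != 0.
  move=> [k]; apply: contraPP => h; have c0 : orth c = fun=> 0.
    by apply/funext => i; apply/eqP/negPn/negP => ci; apply: h; exists i.
  rewrite -(orthK d5 c) c0 /unorth /coef big1 ?mul0r ?eqxx// => i _.
  by rewrite mulr0 mul0r.
split.
- split.
    apply: (@cont_on_comp _ _ _ _ setT (@floor R _)) => //; last exact: cont_on_unorth.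
    by apply: cont_on_ptws => k; exact: cont_on_proj.
  apply: cont_on_ptws => -[k|]; last exact: cont_on_cst.
  apply: (@cont_on_comp _ _ _ _ setT (@orth R d) (fun p : {ptws 'I_d -> R} => p k)) => //.
    exact: cont_on_orth.
  exact: cont_on_proj.
- move=> u [u0 _ [_ uM] uE].
  have uN : u None = 0 by case: uE => // -[Z]; rewrite finset.setCT inE.
  split; last by apply/funext => -[k|] //=; rewrite unorthK.
  split; first by rewrite /orthH unorthK.
  apply: nz; rewrite unorthK//; have [[k|] uk] := u0; first by exists k.
  by rewrite uN eqxx in uk.
- move=> c [Hc c0]; have fl : floor (ground c) = orth c by apply/funext.
  rewrite fl orthK//; split=> //; split.
  + by have [k ck] := nz' _ c0; exists (Some k).
  + exact: lexx.
  + rewrite fl; split=> //; have [Z _ cZ] := Hc; by exists Z.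
  + by left.
- by move=> k u _ _; rewrite -uZ.
Qed.

(** Oddness is needed only on the points shared with the antipodal half. There sweeping is the
    identity, the transfer is odd and takes frontier to frontier, and the raised height is zero. *)
Lemma half_boundary : exists F G, [/\ conic_iso (sheet (R := R) M I) Q F G,
  forall u, sheet M I u -> sheet M I (opp u) -> F (opp u) = opp (F u) &
  forall q, Q q -> Q (opp q) -> sheet M I (opp (G q))].
Proof.
have [F1 [G1 [iso1 id1]]] := sweep_geometry R MI (arcs0 d5) (arcs_extreme d5).
have iso2 := conic_iso_ground.
have iso3 := conic_iso_transfer (@rate_inj R d d5) (@low_rate R d d5) b1 b2.
have iso4 := conic_iso_raise R (@low d).
have iso := conic_iso_trans (conic_iso_trans (conic_iso_trans iso1 iso2) iso3) iso4.
do 2!eexists; split; first exact: iso.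
  move=> u Xu Xou; have [uN uM] := sheet_both d5 Xu Xou.
  have ouN : opp u None = 0 by rewrite /opp uN oppr0.
  rewrite /= !id1//; set c := unorth d5 (floor u).
  have -> : unorth d5 (floor (opp u)) = opp c.
    by rewrite -[RHS](orthK d5) orth_opp unorthK.
  rewrite (transfer_opp (@rate_inj R d d5) (@low_rate R d d5) b1 b2).
  have [Su Gu] := (let: And4 _ h _ _ := iso1 in h) u Xu.
  rewrite id1// in Su; have [[Hc c0] _] := (let: And4 _ h _ _ := iso2 in h) u Su.
  rewrite -/c in Hc c0.
  have Mc : orthM c by rewrite /orthM /c unorthK.
  have [H2c _ /(_ Mc) M2c] := transfer_barrier (@rate_inj R d d5) (@low_rate R d d5) b1 b2 Hc c0.
  set e := transfer _ _ _ _ _ _ _ in H2c M2c *.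
  have eq : lowsq (@low d) e = highsq (@low d) e by apply/eqP; rewrite eq_le; apply/andP; split; [exact: H2c|exact: M2c].
  apply/funext => -[k|] //=.
  by rewrite /opp /= /highsq /lowsq !sumsq_opp -/(highsq _ _) -/(lowsq _ _) eq subrr sqrtr0 oppr0.
move=> q Qq Qoq /=; have [q0 qN eq] := Qq; have [_ oqN _] := Qoq.
have qN0 : q None = 0 by apply/eqP; rewrite eq_le qN andbT -oppr_ge0.
have [[H2q fq0] _] := (let: And4 _ _ h _ := iso4 in h) q Qq.
have M2q : squareM (@low d) (floor q) by rewrite /squareM -eq qN0 expr0n addr0.
have [H1c c0 /(_ M2q) M1c] := transfer_barrier (@rate_inj R d d5) (@low_rate R d d5) b2 b1 H2q fq0.
set c := transfer _ _ _ _ _ _ _ in H1c c0 M1c *.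
have fl : floor (ground c) = orth c by apply/funext.
have gr0 : exists o, ground c o != 0.
  have [_ Sg] := (let: And4 _ _ h _ := iso2 in h) c (conj H1c c0).
  by have [[//] ] := (let: And4 _ _ h _ := iso2 in h) c (conj H1c c0).
have sub (u : rf) : (exists o, u o != 0) -> u None = 0 -> orthM (unorth d5 (floor u)) ->
    orthH (unorth d5 (floor u)) -> sheet M I u.
  rewrite /orthM /orthH !unorthK// => u0 uN [Y YM cY] uM; split=> //.
  - by rewrite uN.
  - by split=> //; exists Y => //; exact: (fintype.subsetP MI).
  - by left.
have Xg : sheet M I (ground c) by apply: sub => //; rewrite fl orthK.
(* The point lies already in the small sheet at height zero, where the sweep fixes it. *)
have -> : G1 (ground c) = ground c.
  by have [_ e] := (let: And4 _ h _ _ := iso1 in h) _ Xg; rewrite id1 in e.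
have ofl : floor (opp (ground c)) = orth (opp c) by rewrite orth_opp -fl.
apply: sub.
- by have [q1 ho] := gr0; exists q1; rewrite /opp oppr_eq0.
- by rewrite /opp /= oppr0.
- by rewrite ofl orthK//; have [Z ZM cZ] := M1c; exists (~: Z); [rewrite middleC|rewrite orth_opp; apply/compatC].
- by rewrite ofl orthK//; exact: (barrier_opp b1).
Qed.

End HalfBoundary.

Section Quadric.
Variables (R : realType) (J : finType) (low : pred J).
Local Notation rf := {ptws option J -> R}.

Definition quadric : set rf :=
  [set q | (exists o, q o != 0) /\ lowsq low (floor q) + q None ^+ 2 = highsq low (floor q)].

Definition closed_upper_quadric : set rf :=
  [set q | - q None <= 0] `&`
  [set q | `|lowsq low (floor q) + q None ^+ 2 - highsq low (floor q)| <= 0].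

Lemma cont_on_floor_sumsq (P : pred J) (A : set rf) :
  cont_on A (fun q => \sum_(k | P k) floor q k ^+ 2).
Proof.
apply: cont_on_sum => k _; rewrite /floor.
by apply: cont_onM; exact: cont_on_proj.
Qed.

Lemma closed_closed_upper_quadric : closed closed_upper_quadric.
Proof.
apply: closedI; apply: closed_le0; first by apply: cont_onN; exact: cont_on_proj.
apply: cont_on_abs; apply: cont_onB; last exact: cont_on_floor_sumsq.
apply: cont_onD; first exact: cont_on_floor_sumsq.
by apply: cont_onM; exact: cont_on_proj.
Qed.

Lemma upper_quadricE q : upper_quadric low q <-> closed_upper_quadric q /\ exists o, q o != 0.
Proof.
split=> [[q0 qN e]|[[/= qN e] q0]].
  by split=> //; split; rewrite /= ?oppr_le0// e subrr normr0.
by split=> //; [rewrite -oppr_le0|move: e; rewrite normr_le0 subr_eq0 => /eqP].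
Qed.

Lemma quadricE q : quadric q <-> upper_quadric low q \/ upper_quadric low (opp q).
Proof.
have e (q' : rf) (P : pred J) : \sum_(k | P k) floor (opp q') k ^+ 2 = \sum_(k | P k) floor q' k ^+ 2.
  by apply: eq_bigr => k _; rewrite /floor /opp sqrrN.
have nz (q' : rf) : (exists o, q' o != 0) -> exists o, opp q' o != 0.
  by move=> [x hx]; exists x; rewrite /opp oppr_eq0.
split=> [[q0 eq]|[[q0 _ eq]|[/nz]]]; last 2 first.
- by [].
- by rewrite oppK => q0 _; rewrite /lowsq /highsq !e /opp sqrrN => eq.
have [qN|qN] := leP 0 (q None); [by left|right; split; first exact: nz].
  by rewrite /opp oppr_ge0 ltW.
by rewrite /lowsq /highsq !e /opp sqrrN.
Qed.

End Quadric.

(** * The quadric as a cone over a product of spheres *)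

Section Spheres.
Variables (R : realType) (d : nat).
Hypothesis d5 : (5 <= d)%N.
Let I := arcs d.
Let M := middle I.
Local Notation rf := {ptws option 'I_d -> R}.
Let lo := @low d.
Local Notation n := (d - 3)%N.

Lemma conic_homeo_double : conic_homeo [set u | sheet (R := R) M I u \/ sheet M I (opp u)] (quadric (R := R) lo).
Proof.
have [F [G [iso odd back]]] := half_boundary R d5.
have := conic_iso_odd_union (@closed_closed_sheet R _ M I) (@sheetE R _ M I)
  (@closed_closed_upper_quadric R _ lo) (@upper_quadricE R _ lo) (@conic_sheet R _ M I) iso odd back.
by congr conic_homeo; apply/seteqP; split=> q /quadricE.
Qed.

Let hi_subproof (j : 'I_n.+1) : (j + 2 < d)%N. Proof. by have := ltn_ord j; lia. Qed.
Let hi (j : 'I_n.+1) : 'I_d := Ordinal (hi_subproof j).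
Let lo_subproof (i : nat) : (i < 2)%N -> (i < d)%N. Proof. by lia. Qed.
Let k0 : 'I_d := Ordinal (@lo_subproof 0 isT).
Let k1 : 'I_d := Ordinal (@lo_subproof 1 isT).

Let lowsqE (c : {ptws 'I_d -> R}) : lowsq lo c = c k0 ^+ 2 + c k1 ^+ 2.
Proof.
rewrite /lowsq (bigD1 k0)//= (bigD1 k1)//= big1 ?addr0// => k.
by move=> /andP[/andP[lk]]; rewrite -!val_eqE /= => h0 h1; exfalso; move: lk h0 h1; rewrite /lo /low; lia.
Qed.

Let highsqE (c : {ptws 'I_d -> R}) : highsq lo c = \sum_(j < n.+1) c (hi j) ^+ 2.
Proof.
rewrite /highsq (reindex_onto hi (fun k : 'I_d => inord (k - 2))) /=; last first.
  move=> k; rewrite /lo /low -leqNgt => k2; apply: val_inj; rewrite /= inordK; last by have := ltn_ord k; lia.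
  by rewrite subnK.
apply: eq_bigl => j; rewrite /lo /low /= addn2 /= -val_eqE /= inordK; last by have := ltn_ord j; lia.
by rewrite -addn2 addnK eqxx.
Qed.

(** On the quadric this is also the norm of the two low coordinates together with the height, so one
    division normalises both factors: three coordinates for the first sphere and d - 2 for the
    second. *)
Let radius (q : rf) := Num.sqrt (highsq lo (floor q)).

Let to_spheres (q : rf) : 'rV[R]_3 * 'rV[R]_n.+1 :=
  (\row_(i < 3) ((radius q)^-1 * q (if i == 0 then Some k0 else if i == 1 then Some k1 else None)),
   \row_(j < n.+1) ((radius q)^-1 * q (Some (hi j)))).

Let of_spheres (p : 'rV[R]_3 * 'rV[R]_n.+1) : rf := fun o =>
  if o is Some k then
    if k == k0 then p.1 0 0 else if k == k1 then p.1 0 1 else p.2 0 (inord (k - 2))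
  else p.1 0 ord_max.

Let sum3 (x : 'rV[R]_3) : \sum_i x 0 i ^+ 2 = x 0 0 ^+ 2 + x 0 1 ^+ 2 + x 0 ord_max ^+ 2.
Proof.
rewrite !big_ord_recr big_ord0 /= add0r; congr (_ + _ + _); congr (x 0 _ ^+ 2); exact: val_inj.
Qed.

Let radius_gt0 q : quadric lo q -> 0 < radius q.
Proof.
move=> [[x qx] e]; rewrite sqrtr_gt0 lt_neqAle sumsq_ge0 andbT eq_sym; apply/eqP => h0.
have h1 : lowsq lo (floor q) + q None ^+ 2 = 0 by rewrite e.
have h2 : lowsq lo (floor q) = 0.
  by apply/eqP; rewrite eq_le sumsq_ge0 andbT -h1 lerDl sqr_ge0.
have h3 : q None = 0 by move: h1; rewrite h2 add0r => /eqP; rewrite sqrf_eq0 => /eqP.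
case: x qx => [k|]; last by rewrite h3 eqxx.
move=> qk; have [lk|hk] := boolP (lo k).
  by have := @sumsq_gt0 R _ lo (floor q) k lk qk; rewrite -/(lowsq _ _) h2 ltxx.
by have := @sumsq_gt0 R _ (fun k => ~~ lo k) (floor q) k hk qk; rewrite -/(highsq _ _) h0 ltxx.
Qed.

Let radius2 q : radius q ^+ 2 = highsq lo (floor q).
Proof. by rewrite sqr_sqrtr// sumsq_ge0. Qed.

Let low_of p : lowsq lo (floor (of_spheres p)) = p.1 0 0 ^+ 2 + p.1 0 1 ^+ 2.
Proof. by rewrite lowsqE. Qed.

Let of_hi p j : floor (of_spheres p) (hi j) = p.2 0 j.
Proof.
rewrite /floor /of_spheres -!val_eqE /= addn2 /=; congr (p.2 0 _); apply: val_inj.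
by rewrite /= inordK; have := ltn_ord j; lia.
Qed.

Let high_of p : highsq lo (floor (of_spheres p)) = \sum_j p.2 0 j ^+ 2.
Proof. by rewrite highsqE; apply: eq_bigr => j _; rewrite of_hi. Qed.

Let cont_to_spheres : cont_on (quadric (R := R) lo) to_spheres.
Proof.
have cr : cont_on (quadric (R := R) lo) (fun q => (radius q)^-1).
  apply: cont_onV; first by move=> q /radius_gt0/gt_eqF->.
  by apply: cont_on_sqrt; exact: cont_on_floor_sumsq.
by apply: cont_on_pair; apply: cont_on_mx => i j; (apply: (cont_on_eq (fun q _ => esym (mxE _ _ _ _))));
  apply: cont_onM => //; exact: cont_on_proj.
Qed.

Let cont_of_spheres (A : set ('rV[R]_3 * 'rV[R]_n.+1)) : cont_on A of_spheres.
Proof.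
have c1 i : cont_on A (fun p => p.1 0 i).
  by apply: (@cont_on_comp _ _ _ _ setT fst (fun x : 'rV[R]_3 => x 0 i)) => //;
    [exact: cont_on_fst|exact: cont_on_mxproj].
have c2 i : cont_on A (fun p => p.2 0 i).
  by apply: (@cont_on_comp _ _ _ _ setT snd (fun x : 'rV[R]_n.+1 => x 0 i)) => //;
    [exact: cont_on_snd|exact: cont_on_mxproj].
apply: cont_on_ptws => -[k|] //=; rewrite /of_spheres.
by case: (k == k0) => //; case: (k == k1).
Qed.

Lemma boundary_spheres :
  homeomorphic (realization R (boundary R (D1 d :|: D2 d))) (unit_sphere R 2 `*` unit_sphere R n).
Proof.
have [F1 [G1 iso1]] := conic_homeo_double.
have iso0 : conic_iso (cone_over (R := R) (boundary R (D1 d :|: D2 d)))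
    (signed_cone (coord d5) (boundary R (D1 d :|: D2 d))) (to_signed (uncoord d5)) (of_signed (coord d5)).
  apply: cone_over_signed; [exact: coordK|exact: uncoordK|].
  move=> F i /(boundaryP R d5)[[T _ FT] _] /FT /= h1 /FT /= h2.
  by rewrite -h1 in h2.
have e : signed_cone (R := R) (coord d5) (boundary R (D1 d :|: D2 d)) =
    [set u | sheet (R := R) M I u \/ sheet M I (opp u)].
  by apply/seteqP; split=> z /signed_boundary.
rewrite e in iso0; have iso := conic_iso_trans iso0 iso1.
apply: (realization_homeomorphic (a := to_spheres) (c := of_spheres) iso).
- exact: cont_to_spheres.
- exact: cont_of_spheres.
- move=> q Qq; have r0 := radius_gt0 Qq; have [_ eq] := Qq.
  have rV : (radius q)^-1 ^+ 2 * radius q ^+ 2 = 1 by rewrite -exprMn mulVf ?expr1n// gt_eqF.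
  split; rewrite /unit_sphere /=.
    rewrite sum3 !mxE /= !exprMn -!mulrDr -[RHS]rV radius2 -eq lowsqE.
    by [].
  rewrite -[RHS]rV radius2 highsqE mulr_sumr; apply: eq_bigr => j _.
  by rewrite mxE exprMn.
- move=> [x y] [/= x1 y1]; rewrite /unit_sphere /= in x1 y1.
  have hq : highsq lo (floor (of_spheres (x, y))) = 1 by rewrite high_of.
  have r1 : radius (of_spheres (x, y)) = 1 by rewrite /radius hq sqrtr1.
  split.
    split; last by rewrite hq low_of /= -sum3.
    apply: contrapT => h; have z o : of_spheres (x, y) o = 0.
      by apply/eqP/negPn/negP => ho; apply: h; exists o.
    move: hq; rewrite /highsq big1 => [/eqP|k _]; first by rewrite eq_sym oner_eq0.
    by rewrite /floor z expr0n.
  congr pair; apply/rowP => i; rewrite mxE r1 invr1 mul1r; last exact: of_hi.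
  rewrite /of_spheres; have [->|i0] := eqVneq i 0; first by rewrite eqxx.
  have [->|i1] := eqVneq i 1; first by rewrite -val_eqE.
  by congr (x 0 _); apply: val_inj; case: i i0 i1 => -[|[|[|i]]] //=.
- move=> k q k0' Qq; have rZ : radius (scale k q) = k * radius q.
    rewrite /radius /highsq; have -> : floor (scale k q) = scale k (floor q) by [].
    by rewrite sumsqZ sqrtrM ?sqr_ge0// sqrtr_sqr gtr0_norm.
  by congr pair; apply/rowP => i; rewrite !mxE rZ invfM /scale mulrACA mulVf ?mul1r// gt_eqF.
- move=> q Qq; exists (radius q)^-1; first by rewrite invr_gt0 radius_gt0.
  apply/funext => -[k|]; rewrite /scale /of_spheres /=; last by rewrite mxE.
  have [->|ne0] := eqVneq k k0; first by rewrite ?mxE.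
  have [->|ne1] := eqVneq k k1; first by rewrite ?mxE.
  rewrite mxE; congr (_ * q (Some _)); apply: val_inj; rewrite /= inordK; last by have := ltn_ord k; lia.
  by move: ne0 ne1; rewrite -!val_eqE /=; lia.
Qed.

End Spheres.

Local Close Scope ring_scope.
Local Close Scope classical_set_scope.

Theorem theorem3p8 (R : realType) (d : nat) (hd : 5 <= d) :
  let B := boundary R (D1 d :|: D2 d) in
  [/\ simplicial_complex B,
      #|vertices B| = 2 * d + 2,
      centrally_symmetric_under (@antipode d.+1) B &
      homeomorphic (realization R B)
        (unit_sphere R 2 `*` unit_sphere R (d - 3))%classic].
Proof.
split.
- exact: boundary_simplicial.
- exact: card_vertices_boundary.
- exact: boundary_symmetric.
- exact: boundary_spheres.
Qed.
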